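(* Let $r>0$ and let $\tilde h(x,t,w)$ be a real-valued, real analytic function of its three real arguments. For a function $u$, define the (quasilinear) operator $$P_u(D)v := \left((D_x)^2 + (x^r D_t)^2 + \big(x^r\,\tilde h(x,t,u(x,t))\,D_t\big)^2\right)v,\qquad (x,t)\in\mathbb{R}^2,$$ where $D_x=-i\,\partial/\partial x$ and $D_t=-i\,\partial/\partial t$. Let $(x_0,t_0)\in\mathbb{R}^2$, let $f$ be real analytic in a neighborhood of $(x_0,t_0)$, and let $u$ be a real-valued $C^\infty$ function in a neighborhood of $(x_0,t_0)$ satisfying $$P_u(D)u = \left((D_x)^2 + (x^r D_t)^2 + \big(x^r\,\tilde h(x,t,u)\,D_t\big)^2\right)u = f$$ there. Then $u$ is real analytic in a neighborhood of $(x_0,t_0)$.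
   Context: The vector fields $D_x$, $x^rD_t$ and $x^r\tilde h(x,t,u)D_t$ have coefficients depending on the solution $u$ itself, so the equation is a non-linear sum of squares of vector fields. Real analyticity of $f$ and of the solution is meant locally near the given point $(x_0,t_0)$. *)

(* Defs.v *)
From Stdlib Require Import Reals Lra List.
From Coquelicot Require Import Coquelicot.
Open Scope R_scope.

Definition dx (v : R -> R -> R) : R -> R -> R :=
  fun x t => Derive (fun y => v y t) x.
Definition dt (v : R -> R -> R) : R -> R -> R :=
  fun x t => Derive (fun s => v x s) t.

Fixpoint pderiv (l : list bool) (v : R -> R -> R) : R -> R -> R :=
  match l with
  | nil => v
  | cons b l' => if b then dx (pderiv l' v) else dt (pderiv l' v)
  end.

Definition in_box (d x0 t0 x t : R) : Prop :=
  Rabs (x - x0) < d /\ Rabs (t - t0) < d.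

Definition smooth_on_box (d x0 t0 : R) (v : R -> R -> R) : Prop :=
  forall (l : list bool) (x t : R), in_box d x0 t0 x t ->
    ex_derive (fun y => pderiv l v y t) x /\
    ex_derive (fun s => pderiv l v x s) t /\
    continuous (fun p : R * R => pderiv l v (fst p) (snd p)) (x, t).

Definition psum2 (a : nat -> nat -> R) (y z : R) (n : nat) : R :=
  sum_f_R0 (fun i => a i (n - i)%nat * y ^ i * z ^ (n - i)) n.
Definition psum3 (a : nat -> nat -> nat -> R) (y z w : R) (n : nat) : R :=
  sum_f_R0 (fun i => sum_f_R0 (fun j =>
     a i j (n - i - j)%nat * y ^ i * z ^ j * w ^ (n - i - j)) (n - i)) n.

Definition analytic_at2 (f : R -> R -> R) (x0 t0 : R) : Prop :=
  exists (a : nat -> nat -> R) (d : R), 0 < d /\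
    forall x t, Rabs (x - x0) < d -> Rabs (t - t0) < d ->
      ex_series (psum2 (fun i j => Rabs (a i j)) (Rabs (x - x0)) (Rabs (t - t0)))
      /\ f x t = Series (psum2 a (x - x0) (t - t0)).

Definition analytic_at3 (h : R -> R -> R -> R) (x0 t0 w0 : R) : Prop :=
  exists (a : nat -> nat -> nat -> R) (d : R), 0 < d /\
    forall x t w, Rabs (x - x0) < d -> Rabs (t - t0) < d -> Rabs (w - w0) < d ->
      ex_series (psum3 (fun i j k => Rabs (a i j k))
                   (Rabs (x - x0)) (Rabs (t - t0)) (Rabs (w - w0)))
      /\ h x t w = Series (psum3 a (x - x0) (t - t0) (w - w0)).

Definition analytic_on_box (d x0 t0 : R) (f : R -> R -> R) : Prop :=
  forall x t, in_box d x0 t0 x t -> analytic_at2 f x t.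

(* The vector field  a(x,t) d/dt ; then a D_t = -i (a d/dt), so
   (a D_t)^2 v = - (a d/dt)(a d/dt) v. *)
Definition vf_t (a : R -> R -> R) (v : R -> R -> R) : R -> R -> R :=
  fun x t => a x t * dt v x t.

(* P_u(D) v = (D_x^2 + (x^r D_t)^2 + (x^r h(x,t,u) D_t)^2) v, with
   D = -i d, so each square contributes a factor i^2 = -1. *)
Definition P_op (r : nat) (h : R -> R -> R -> R) (u v : R -> R -> R)
  : R -> R -> R :=
  let a1 := fun x (_ : R) => x ^ r in
  let a2 := fun x t => x ^ r * h x t (u x t) in
  fun x t => - (dx (dx v) x t + vf_t a1 (vf_t a1 v) x t
                + vf_t a2 (vf_t a2 v) x t).

(* Main.v *)
Require Import Defs.
From Stdlib Require Import Reals Lra Lia List Permutation Factorial Wf_nat Classical_Prop.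
From Coquelicot Require Import Coquelicot.
Open Scope R_scope.

(* Write [z = x^(2r)] and [H = h(x,t,u)].  The equation reads
   [u_xx + z ((1 + H^2) u_tt + lower order) = - f].

   Derivatives in [t].  Let [V] be the derivative of order [k-1] and [v = V_t].
   A Bernstein argument bounds [v] by [C sup|V| / delta], where [delta] is the
   distance to the boundary of a larger domain: at an interior maximum of
   [phi^2 v^2 + K V^2 + b1 (t-t1)^2 + b2 (x-x0)^2] the degenerate operator is
   nonpositive, whereas [K V^2] contributes [2 K z v^2].  The cutoff [phi] depends
   on [x] only through a function [psi] with [psi'^2] and [psi''] at most [C z], so
   its derivatives do not see the degeneracy.  With [delta] of size [1/k] this
   iterates to factorial bounds, on domains that shrink only by a fixed amount.

   The nonlinearity is handled by pointwise majorants: the weights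
   [n!/(8(n+1)^2)] are submultiplicative under the Leibniz rule, so that bounds on
   the derivatives of [u] at one point pass to [h(x,t,u)] through its power series.

   Derivatives in [x].  The first one is interpolated between [u] and [u_xx]; then
   the equation trades every pair of [x]-derivatives for [t]-derivatives. *)

(** * Leibniz sums and factorial weights *)

(** The degeneracy on [x = 0] is tractable because [x^(2r)] commutes with [d/dt] and the
    coefficients depend on [t] only through [H]. After [k] derivatives in [t] the equation is [(D
    k)_xx + z (1 + H^2) (D k)_tt = - f_k - z R], where [R] contains only pure [t]-derivatives of
    [u], of order at most [k + 1]. Hence the induction on [t]-derivatives closes without any
    [x]-derivative, and every error involving the two top orders carries the same factor [z] as the
    good term [2 K z v^2]. The coefficients of the top orders in [R] grow like [k] and [k^2]. Since
    [delta] is of size [1/k], they are of size [1/delta] and [1/delta^2], which is exactly what the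
    maximum principle tolerates with a constant independent of [k]. The dependence of [R] on the top
    orders goes through the composition [h(x,t,u)]. Instead of a formula for its derivatives, the
    majorant calculus is applied at one point with a free weight at the top orders, set to the
    actual size of these derivatives there; submultiplicativity of the weights then shows that the
    dependence is linear. *)

Lemma sum_f_R0_rev (f : nat -> R) (n : nat) :
  sum_f_R0 (fun i => f (n - i)%nat) n = sum_f_R0 f n.
Proof.
  revert f; induction n as [|n IH]; intros f; [reflexivity|].
  rewrite decomp_sum by lia; rewrite tech5, Rplus_comm, Nat.sub_0_r.
  f_equal; rewrite <- IH; apply sum_eq; intros i Hi; f_equal; lia.
Qed.

Lemma sum_inv_sq_le (n : nat) :
  sum_f_R0 (fun i => / (INR i + 1) ^ 2) n <= 2 - / (INR n + 1).
Proof.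
  induction n as [|n IH]; [simpl; lra|].
  rewrite tech5, S_INR; pose proof (pos_INR n).
  assert (/ (INR n + 1 + 1) ^ 2 <= / (INR n + 1) - / (INR n + 1 + 1)).
  { replace (/ (INR n + 1) - / (INR n + 1 + 1))
      with (/ ((INR n + 1) * (INR n + 1 + 1))) by (field; lra).
    apply Rinv_le_contravar; nra. }
  lra.
Qed.

(** With [p = i + 1] and [q = n - i + 1], [1/(p^2 q^2) = (1/p + 1/q)^2 / (p + q)^2 <= 2 (1/p^2 +
    1/q^2) / (n + 2)^2], and the inverse squares sum to at most [2] on either side. *)
Lemma sum_inv_sq_conv_le (n : nat) :
  sum_f_R0 (fun i => / (INR i + 1) ^ 2 * / (INR (n - i) + 1) ^ 2) n
    <= 8 / (INR n + 1) ^ 2.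
Proof.
  pose proof (pos_INR n) as Hn.
  pose (g := fun i => / (INR i + 1) ^ 2).
  apply Rle_trans with
    (sum_f_R0 (fun i => (g i + g (n - i)%nat) * (2 / (INR n + 2) ^ 2)) n).
  - apply sum_Rle; intros i Hi; unfold g.
    rewrite (minus_INR n i) by lia.
    assert (Hi' : 0 <= INR i) by apply pos_INR.
    assert (Hni : 0 <= INR n - INR i)
      by (rewrite <- minus_INR by lia; apply pos_INR).
    set (p := INR i + 1); set (q := INR n - INR i + 1).
    assert (Hp : 1 <= p) by (unfold p; lra).
    assert (Hq : 1 <= q) by (unfold q; lra).
    replace (INR n + 2) with (p + q) by (unfold p, q; lra).
    replace (/ p ^ 2 * / q ^ 2) with ((/ p + / q) ^ 2 / (p + q) ^ 2)
      by (field; lra).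
    replace ((/ p ^ 2 + / q ^ 2) * (2 / (p + q) ^ 2))
      with (2 * ((/ p) ^ 2 + (/ q) ^ 2) / (p + q) ^ 2) by (field; lra).
    apply Rmult_le_compat_r.
    + left; apply Rinv_0_lt_compat; nra.
    + pose proof (pow2_ge_0 (/ p - / q)); lra.
  - rewrite <- (scal_sum (fun i => g i + g (n - i)%nat) n (2 / (INR n + 2) ^ 2)).
    rewrite sum_plus, (sum_f_R0_rev g).
    pose proof (sum_inv_sq_le n) as H; fold g in H.
    assert (0 < / (INR n + 1)) by (apply Rinv_0_lt_compat; lra).
    apply Rle_trans with (2 / (INR n + 2) ^ 2 * 4).
    + apply Rmult_le_compat_l; [|lra].
      apply Rle_mult_inv_pos; nra.
    + replace (2 / (INR n + 2) ^ 2 * 4) with (8 / (INR n + 2) ^ 2)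
        by (field; lra).
      apply Rmult_le_compat_l; [lra|]; apply Rinv_le_contravar; nra.
Qed.

(* The factor 1/(n+1)^2 makes these weights stable under the Leibniz sum. *)
Definition wt (n : nat) : R := INR (fact n) / (8 * (INR n + 1) ^ 2).

(** The sum of [F i j] over [i + j = n] with binomial weights, generated by Pascal's rule. The
    recursion follows the Leibniz rule and avoids binomial coefficients. *)
Fixpoint tsum (n : nat) (F : nat -> nat -> R) : R :=
  match n with
  | O => F O O
  | S n' => tsum n' (fun i j => F (S i) j + F i (S j))
  end.

Lemma tsum_ext (n : nat) (F F' : nat -> nat -> R) :
  (forall i j, (i + j = n)%nat -> F i j = F' i j) -> tsum n F = tsum n F'.
Proof.
  revert F F'; induction n as [|n IH]; intros F F' H; simpl; [apply H; lia|].
  apply IH; intros i j Hij; rewrite !H by lia; reflexivity.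
Qed.

Lemma tsum_le (n : nat) (F F' : nat -> nat -> R) :
  (forall i j, (i + j = n)%nat -> F i j <= F' i j) -> tsum n F <= tsum n F'.
Proof.
  revert F F'; induction n as [|n IH]; intros F F' H; simpl; [apply H; lia|].
  apply IH; intros i j Hij; apply Rplus_le_compat; apply H; lia.
Qed.

Lemma tsum_scal (n : nat) (c : R) (F : nat -> nat -> R) :
  tsum n (fun i j => c * F i j) = c * tsum n F.
Proof.
  revert F; induction n as [|n IH]; intros F; simpl; [reflexivity|].
  rewrite <- IH; apply tsum_ext; intros; ring.
Qed.

Lemma tsum_plus (n : nat) (F F' : nat -> nat -> R) :
  tsum n (fun i j => F i j + F' i j) = tsum n F + tsum n F'.
Proof.
  revert F F'; induction n as [|n IH]; intros F F'; simpl; [reflexivity|].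
  rewrite <- IH; apply tsum_ext; intros; ring.
Qed.

(** The hidden binomial weight times [i! j!] is [n!]. *)
Lemma tsum_fact (n : nat) (g : nat -> nat -> R) :
  tsum n (fun i j => INR (fact i) * INR (fact j) * g i j)
    = INR (fact n) * sum_f_R0 (fun i => g i (n - i)%nat) n.
Proof.
  revert g; induction n as [|n IH]; intros g; [simpl; ring|].
  cbn [tsum].
  rewrite (tsum_ext n _ (fun i j => INR (fact i) * INR (fact j) *
    (INR (S i) * g (S i) j + INR (S j) * g i (S j)))).
  2:{ intros i j _; rewrite !fact_simpl, !mult_INR; ring. }
  rewrite (IH (fun i j => INR (S i) * g (S i) j + INR (S j) * g i (S j))).
  rewrite fact_simpl, mult_INR.
  (* The factor [n + 1] is split as [i + (n + 1 - i)]; after reindexing, the two halves are the two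
     Pascal terms. *)
  assert (E : sum_f_R0 (fun i => INR (S i) * g (S i) (n - i)%nat +
        INR (S (n - i)) * g i (S (n - i))) n
      = INR (S n) * sum_f_R0 (fun i => g i (S n - i)%nat) (S n)).
  { rewrite scal_sum, sum_plus.
    rewrite (sum_eq (fun i => g i (S n - i)%nat * INR (S n))
      (fun i => INR i * g i (S n - i)%nat + INR (S n - i) * g i (S n - i)%nat) (S n)).
    2:{ intros i Hi; rewrite (minus_INR (S n) i) by lia; ring. }
    rewrite sum_plus; f_equal.
    - rewrite (decomp_sum (fun i => INR i * g i (S n - i)%nat)) by lia.
      simpl (INR 0); rewrite Rmult_0_l, Rplus_0_l.
      apply sum_eq; intros i Hi; reflexivity.
    - rewrite tech5, Nat.sub_diag; simpl (INR 0); rewrite Rmult_0_l, Rplus_0_r.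
      apply sum_eq; intros i Hi; replace (S n - i)%nat with (S (n - i)) by lia.
      reflexivity. }
  rewrite E; ring.
Qed.

Lemma wt_pos (n : nat) : 0 < wt n.
Proof.
  unfold wt; pose proof (pos_INR n); apply Rdiv_lt_0_compat.
  - apply INR_fact_lt_0.
  - nra.
Qed.

(** The [8] in [wt] is made for this: the convolution of inverse squares costs [8], and
    [8 / 8^2 = 1/8]. *)
Lemma tsum_wt (n : nat) : tsum n (fun i j => wt i * wt j) <= wt n.
Proof.
  rewrite (tsum_ext n _ (fun i j => / 64 * (INR (fact i) * INR (fact j) *
     (/ (INR i + 1) ^ 2 * / (INR j + 1) ^ 2)))).
  2:{ intros i j _; unfold wt; pose proof (pos_INR i); pose proof (pos_INR j).
      field; lra. }
  rewrite tsum_scal, (tsum_fact n (fun i j => / (INR i + 1) ^ 2 * / (INR j + 1) ^ 2)).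
  pose proof (sum_inv_sq_conv_le n) as H.
  pose proof (INR_fact_lt_0 n) as Hf.
  unfold wt; pose proof (pos_INR n).
  replace (INR (fact n) / (8 * (INR n + 1) ^ 2)) with
    (/ 64 * (INR (fact n) * (8 / (INR n + 1) ^ 2))) by (field; lra).
  apply Rmult_le_compat_l; [lra|]; apply Rmult_le_compat_l; lra.
Qed.

(** Each step of Pascal's recursion discards one of two nonnegative terms; in binomial terms,
    [C(n, i) <= C(n + s1 + s2, i + s1)]. *)
Lemma tsum_shift (n s1 s2 : nat) (F : nat -> nat -> R) :
  (forall i j, 0 <= F i j) ->
  tsum n (fun i j => F (i + s1)%nat (j + s2)%nat) <= tsum (n + s1 + s2) F.
Proof.
  revert F; induction s1 as [|s1 IH1]; intros F H.
  - induction s2 as [|s2 IH2] in F, H |- *.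
    + rewrite !Nat.add_0_r; apply tsum_le; intros; rewrite !Nat.add_0_r; lra.
    + replace (n + 0 + S s2)%nat with (S (n + 0 + s2)) by lia; cbn [tsum].
      eapply Rle_trans; [|apply (IH2 (fun i j => F (S i) j + F i (S j)))].
      * apply tsum_le; intros i j _; rewrite Nat.add_succ_r.
        pose proof (H (S (i + 0)) (j + s2)%nat); lra.
      * intros i j; pose proof (H (S i) j); pose proof (H i (S j)); lra.
  - replace (n + S s1 + s2)%nat with (S (n + s1 + s2)) by lia; cbn [tsum].
    eapply Rle_trans; [|apply (IH1 (fun i j => F (S i) j + F i (S j)))].
    + apply tsum_le; intros i j _; rewrite Nat.add_succ_r.
      pose proof (H (i + s1)%nat (S (j + s2))); lra.
    + intros i j; pose proof (H (S i) j); pose proof (H i (S j)); lra.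
Qed.

Lemma tsum_wt_shift (n s1 s2 : nat) :
  tsum n (fun i j => wt (i + s1) * wt (j + s2)) <= wt (n + s1 + s2).
Proof.
  eapply Rle_trans; [|apply tsum_wt].
  apply (tsum_shift n s1 s2 (fun i j => wt i * wt j)).
  intros i j; left; apply Rmult_lt_0_compat; apply wt_pos.
Qed.

Lemma wt_S_le (n : nat) : wt (S n) <= INR (S n) * wt n.
Proof.
  unfold wt; rewrite fact_simpl, mult_INR, !S_INR.
  pose proof (pos_INR n); pose proof (INR_fact_lt_0 n).
  unfold Rdiv; rewrite Rmult_assoc; apply Rmult_le_compat_l; [lra|].
  apply Rmult_le_compat_l; [lra|]; apply Rinv_le_contravar; nra.
Qed.

(** The constant [4] bounds [((n + 2) / (n + 1))^2]. With [wt_S_le] this makes one more order worth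
    a factor comparable to [n]. *)
Lemma wt_S_ge (n : nat) : INR (S n) * wt n <= 4 * wt (S n).
Proof.
  unfold wt; rewrite fact_simpl, mult_INR, !S_INR.
  pose proof (pos_INR n); pose proof (INR_fact_lt_0 n).
  replace (4 * ((INR n + 1) * INR (fact n) / (8 * (INR n + 1 + 1) ^ 2)))
    with ((INR n + 1) * (INR (fact n) * (4 / (8 * (INR n + 1 + 1) ^ 2))))
    by (field; lra).
  apply Rmult_le_compat_l; [lra|]; apply Rmult_le_compat_l; [lra|].
  replace (4 / (8 * (INR n + 1 + 1) ^ 2)) with (/ (2 * (INR n + 1 + 1) ^ 2))
    by (field; lra).
  apply Rinv_le_contravar; nra.
Qed.

Lemma wt_0 : wt 0 = / 8.
Proof. unfold wt; simpl; field. Qed.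

(** * Leibniz sums over words of derivatives *)

Definition nx (l : list bool) : nat := count_occ Bool.bool_dec l true.

(* The sum of [F l1 l2] over all splittings of the word [l] into two
   complementary subwords. *)
Fixpoint lsum (l : list bool) (F : list bool -> list bool -> R) : R :=
  match l with
  | nil => F nil nil
  | cons b l' => lsum l' (fun l1 l2 => F (b :: l1) l2 + F l1 (b :: l2))
  end.

Lemma lsum_ext (l : list bool) (F F' : list bool -> list bool -> R) :
  (forall l1 l2, F l1 l2 = F' l1 l2) -> lsum l F = lsum l F'.
Proof.
  revert F F'; induction l as [|b l IH]; intros F F' H; simpl; [apply H|].
  apply IH; intros; rewrite !H; reflexivity.
Qed.

Lemma lsum_plus (l : list bool) (F F' : list bool -> list bool -> R) :
  lsum l (fun l1 l2 => F l1 l2 + F' l1 l2) = lsum l F + lsum l F'.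
Proof.
  revert F F'; induction l as [|b l IH]; intros F F'; simpl; [reflexivity|].
  rewrite <- IH; apply lsum_ext; intros; ring.
Qed.

Lemma nx_cons_le (b : bool) (l : list bool) :
  nx (b :: l) = (nx (b :: nil) + nx l)%nat.
Proof. destruct b; reflexivity. Qed.

(** A word of length [n] has [C(n, i)] splittings whose first part has length [i], so a bound
    depending only on lengths turns [lsum] into [tsum]. *)
Lemma lsum_Rabs_le (l : list bool) (F : list bool -> list bool -> R)
    (B : nat -> nat -> R) :
  (forall l1 l2, (length l1 + length l2 = length l)%nat ->
     (nx l1 + nx l2 = nx l)%nat -> Rabs (F l1 l2) <= B (length l1) (length l2)) ->
  Rabs (lsum l F) <= tsum (length l) B.
Proof.
  revert F B; induction l as [|b l IH]; intros F B H; simpl.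
  - apply (H nil nil); reflexivity.
  - apply IH; intros l1 l2 Hl Hn; eapply Rle_trans; [apply Rabs_triang|].
    rewrite (nx_cons_le b l) in H.
    apply Rplus_le_compat; [apply (H (b :: l1) l2)|apply (H l1 (b :: l2))];
      simpl length; rewrite ?(nx_cons_le b l1), ?(nx_cons_le b l2); lia.
Qed.

(** Needed for commutators: [F nil l] is the term in which all derivatives fall on the second
    factor. The right side may keep the full sum because [B] is nonnegative. *)
Lemma lsum_sub_nil_Rabs_le (l : list bool) (F : list bool -> list bool -> R)
    (B : nat -> nat -> R) :
  (forall i j, 0 <= B i j) ->
  (forall l1 l2, l1 <> nil -> (length l1 + length l2 = length l)%nat ->
     (nx l1 + nx l2 = nx l)%nat -> Rabs (F l1 l2) <= B (length l1) (length l2)) ->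
  Rabs (lsum l F - F nil l) <= tsum (length l) B.
Proof.
  revert F B; induction l as [|b l IH]; intros F B HB H; simpl.
  - rewrite Rminus_diag, Rabs_R0; apply HB.
  - rewrite lsum_plus.
    replace (_ - _) with (lsum l (fun l1 l2 => F (b :: l1) l2) +
      (lsum l (fun l1 l2 => F l1 (b :: l2)) - F nil (b :: l))) by ring.
    eapply Rle_trans; [apply Rabs_triang|].
    rewrite (nx_cons_le b l) in H.
    rewrite (tsum_plus _ (fun i j => B (S i) j)); apply Rplus_le_compat.
    + apply lsum_Rabs_le; intros l1 l2 Hl Hn; apply (H (b :: l1) l2);
        [discriminate|simpl; lia|rewrite (nx_cons_le b l1); lia].
    + apply (IH (fun l1 l2 => F l1 (b :: l2)) (fun i j => B i (S j))).
      * intros; apply HB.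
      * intros l1 l2 Hne Hl Hn; apply (H l1 (b :: l2)); 
        [assumption|simpl; lia|rewrite (nx_cons_le b l2); lia].
Qed.

Lemma wt_le_fact (n : nat) : wt n <= INR (fact n).
Proof.
  unfold wt; pose proof (pos_INR n); pose proof (INR_fact_lt_0 n).
  apply Rle_div_l; nra.
Qed.

Lemma wt_1 : wt 1 = / 32.
Proof. unfold wt; simpl; field. Qed.

Global Opaque wt.

(** * Iterated partial derivatives *)

Lemma locally_Rabs_lt (c d x : R) :
  Rabs (x - c) < d -> locally x (fun y => Rabs (y - c) < d).
Proof.
  intros H; assert (He : 0 < d - Rabs (x - c)) by lra.
  exists (mkposreal _ He); intros y Hy; cbn in Hy.
  unfold ball in Hy; cbn in Hy; unfold AbsRing_ball, abs, minus, plus, opp in Hy; cbn in Hy.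
  replace (y - c) with ((y + - x) + (x - c)) by ring.
  pose proof (Rabs_triang (y + - x) (x - c)); lra.
Qed.

Lemma in_box_locally_x (d x0 t0 x t : R) :
  in_box d x0 t0 x t -> locally x (fun y => in_box d x0 t0 y t).
Proof.
  intros [Hx Ht]; generalize (locally_Rabs_lt _ _ _ Hx); apply filter_imp.
  intros y Hy; split; assumption.
Qed.

Lemma in_box_locally_t (d x0 t0 x t : R) :
  in_box d x0 t0 x t -> locally t (fun s => in_box d x0 t0 x s).
Proof.
  intros [Hx Ht]; generalize (locally_Rabs_lt _ _ _ Ht); apply filter_imp.
  intros y Hy; split; assumption.
Qed.

Lemma in_box_le (d d' x0 t0 x t : R) :
  d <= d' -> in_box d x0 t0 x t -> in_box d' x0 t0 x t.
Proof. intros Hd [Hx Ht]; split; lra. Qed.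

(* Weaker than [smooth_on_box]: no joint continuity. *)
Definition psmooth (d x0 t0 : R) (g : R -> R -> R) : Prop :=
  forall l x t, in_box d x0 t0 x t ->
    ex_derive (fun y => pderiv l g y t) x /\ ex_derive (fun s => pderiv l g x s) t.

Lemma smooth_psmooth (d x0 t0 : R) (g : R -> R -> R) :
  smooth_on_box d x0 t0 g -> psmooth d x0 t0 g.
Proof. intros H l x t Hb; destruct (H l x t Hb) as [H1 [H2 _]]; split; assumption. Qed.

Lemma pderiv_app (l1 l2 : list bool) (g : R -> R -> R) :
  pderiv (l1 ++ l2) g = pderiv l1 (pderiv l2 g).
Proof.
  induction l1 as [|b l1 IH]; simpl; [reflexivity|]; rewrite IH; reflexivity.
Qed.

Lemma pderiv_ext (d x0 t0 : R) (g q : R -> R -> R) :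
  (forall x t, in_box d x0 t0 x t -> g x t = q x t) ->
  forall l x t, in_box d x0 t0 x t -> pderiv l g x t = pderiv l q x t.
Proof.
  intros H l; induction l as [|b l IH]; intros x t Hb; [apply H, Hb|].
  destruct b; simpl; unfold dx, dt; apply Derive_ext_loc.
  - generalize (in_box_locally_x _ _ _ _ _ Hb); apply filter_imp.
    intros y Hy; apply IH, Hy.
  - generalize (in_box_locally_t _ _ _ _ _ Hb); apply filter_imp.
    intros y Hy; apply IH, Hy.
Qed.

Lemma psmooth_ext (d x0 t0 : R) (g q : R -> R -> R) :
  (forall x t, in_box d x0 t0 x t -> g x t = q x t) ->
  psmooth d x0 t0 g -> psmooth d x0 t0 q.
Proof.
  intros H Hg l x t Hb; destruct (Hg l x t Hb) as [H1 H2]; split.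
  - refine (ex_derive_ext_loc _ _ _ _ H1).
    generalize (in_box_locally_x _ _ _ _ _ Hb); apply filter_imp.
    intros y Hy; apply (pderiv_ext _ _ _ _ _ H l _ _ Hy).
  - refine (ex_derive_ext_loc _ _ _ _ H2).
    generalize (in_box_locally_t _ _ _ _ _ Hb); apply filter_imp.
    intros y Hy; apply (pderiv_ext _ _ _ _ _ H l _ _ Hy).
Qed.

Lemma psmooth_le (d d' x0 t0 : R) (g : R -> R -> R) :
  d <= d' -> psmooth d' x0 t0 g -> psmooth d x0 t0 g.
Proof. intros Hd H l x t Hb; apply H; apply (in_box_le d d'); assumption. Qed.

Lemma psmooth_pderiv (d x0 t0 : R) (g : R -> R -> R) (l : list bool) :
  psmooth d x0 t0 g -> psmooth d x0 t0 (pderiv l g).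
Proof. intros H l' x t Hb; rewrite <- pderiv_app; apply H, Hb. Qed.

(** Iterated derivatives are found by exhibiting a candidate family closed under one further
    derivative, which gives smoothness at the same time. The rules below for products, sums and
    series are instances. *)
Lemma pderiv_guess (d x0 t0 : R) (g : R -> R -> R) (Q : list bool -> R -> R -> R) :
  (forall x t, in_box d x0 t0 x t -> g x t = Q nil x t) ->
  (forall l x t, in_box d x0 t0 x t ->
     is_derive (fun y => Q l y t) x (Q (true :: l) x t) /\
     is_derive (fun s => Q l x s) t (Q (false :: l) x t)) ->
  psmooth d x0 t0 g /\
  forall l x t, in_box d x0 t0 x t -> pderiv l g x t = Q l x t.
Proof.
  intros H0 HQ.
  assert (E : forall l x t, in_box d x0 t0 x t -> pderiv l g x t = Q l x t).
  { induction l as [|b l IH]; intros x t Hb; [apply H0, Hb|].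
    destruct (HQ l x t Hb) as [H1 H2].
    destruct b; simpl; unfold dx, dt.
    - rewrite <- (is_derive_unique _ _ _ H1); apply Derive_ext_loc.
      generalize (in_box_locally_x _ _ _ _ _ Hb); apply filter_imp; intros; apply IH; assumption.
    - rewrite <- (is_derive_unique _ _ _ H2); apply Derive_ext_loc.
      generalize (in_box_locally_t _ _ _ _ _ Hb); apply filter_imp; intros; apply IH; assumption. }
  split; [|exact E].
  intros l x t Hb; destruct (HQ l x t Hb) as [H1 H2]; split.
  - apply (ex_derive_ext_loc (fun y => Q l y t)); [|eexists; exact H1].
    generalize (in_box_locally_x _ _ _ _ _ Hb); apply filter_imp; intros; symmetry; apply E; assumption.
  - apply (ex_derive_ext_loc (fun s => Q l x s)); [|eexists; exact H2].
    generalize (in_box_locally_t _ _ _ _ _ Hb); apply filter_imp; intros; symmetry; apply E; assumption.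
Qed.

Lemma psmooth_is_derive (d x0 t0 : R) (g : R -> R -> R) (l : list bool) (x t : R) :
  psmooth d x0 t0 g -> in_box d x0 t0 x t ->
  is_derive (fun y => pderiv l g y t) x (pderiv (true :: l) g x t) /\
  is_derive (fun s => pderiv l g x s) t (pderiv (false :: l) g x t).
Proof.
  intros Hg Hb; destruct (Hg l x t Hb) as [H1 H2].
  split; apply Derive_correct; assumption.
Qed.

Lemma is_derive_lsum (l : list bool) (F : list bool -> list bool -> R -> R)
    (F' : list bool -> list bool -> R) (x : R) :
  (forall l1 l2, is_derive (F l1 l2) x (F' l1 l2)) ->
  is_derive (fun y => lsum l (fun l1 l2 => F l1 l2 y)) x (lsum l F').
Proof.
  revert F F'; induction l as [|b l IH]; intros F F' H; simpl; [apply H|].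
  apply (IH (fun l1 l2 y => F (b :: l1) l2 y + F l1 (b :: l2) y)
            (fun l1 l2 => F' (b :: l1) l2 + F' l1 (b :: l2))).
  intros l1 l2; apply (@is_derive_plus R_AbsRing R_NormedModule); apply H.
Qed.

Lemma pderiv_mult (d x0 t0 : R) (g q : R -> R -> R) :
  psmooth d x0 t0 g -> psmooth d x0 t0 q ->
  psmooth d x0 t0 (fun x t => g x t * q x t) /\
  forall l x t, in_box d x0 t0 x t -> pderiv l (fun x t => g x t * q x t) x t =
    lsum l (fun l1 l2 => pderiv l1 g x t * pderiv l2 q x t).
Proof.
  intros Hg Hq; apply (pderiv_guess d x0 t0 _ (fun l x t =>
    lsum l (fun l1 l2 => pderiv l1 g x t * pderiv l2 q x t))); [reflexivity|].
  intros l x t Hb; split; cbn [lsum].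
  - apply (is_derive_lsum l (fun l1 l2 y => pderiv l1 g y t * pderiv l2 q y t)).
    intros l1 l2.
    destruct (psmooth_is_derive _ _ _ _ l1 _ _ Hg Hb) as [H1 _].
    destruct (psmooth_is_derive _ _ _ _ l2 _ _ Hq Hb) as [H2 _].
    apply (is_derive_mult (fun y => pderiv l1 g y t) (fun y => pderiv l2 q y t)
       x _ _ H1 H2 Rmult_comm).
  - apply (is_derive_lsum l (fun l1 l2 s => pderiv l1 g x s * pderiv l2 q x s)).
    intros l1 l2.
    destruct (psmooth_is_derive _ _ _ _ l1 _ _ Hg Hb) as [_ H1].
    destruct (psmooth_is_derive _ _ _ _ l2 _ _ Hq Hb) as [_ H2].
    apply (is_derive_mult (fun s => pderiv l1 g x s) (fun s => pderiv l2 q x s)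
       t _ _ H1 H2 Rmult_comm).
Qed.

Lemma psmooth_mult (d x0 t0 : R) (g q : R -> R -> R) :
  psmooth d x0 t0 g -> psmooth d x0 t0 q -> psmooth d x0 t0 (fun x t => g x t * q x t).
Proof. intros Hg Hq; apply (pderiv_mult d x0 t0 g q Hg Hq). Qed.

Lemma pderiv_plus (d x0 t0 : R) (g q : R -> R -> R) :
  psmooth d x0 t0 g -> psmooth d x0 t0 q ->
  psmooth d x0 t0 (fun x t => g x t + q x t) /\
  forall l x t, in_box d x0 t0 x t ->
    pderiv l (fun x t => g x t + q x t) x t = pderiv l g x t + pderiv l q x t.
Proof.
  intros Hg Hq; apply (pderiv_guess d x0 t0 _ (fun l x t =>
    pderiv l g x t + pderiv l q x t)); [reflexivity|].
  intros l x t Hb.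
  destruct (psmooth_is_derive _ _ _ _ l _ _ Hg Hb) as [H1 H2].
  destruct (psmooth_is_derive _ _ _ _ l _ _ Hq Hb) as [H3 H4].
  split.
  - exact (is_derive_plus _ _ _ _ _ H1 H3).
  - exact (is_derive_plus _ _ _ _ _ H2 H4).
Qed.

Lemma pderiv_opp (d x0 t0 : R) (g : R -> R -> R) :
  psmooth d x0 t0 g ->
  psmooth d x0 t0 (fun x t => - g x t) /\
  forall l x t, in_box d x0 t0 x t -> pderiv l (fun x t => - g x t) x t = - pderiv l g x t.
Proof.
  intros Hg; apply (pderiv_guess d x0 t0 _ (fun l x t => - pderiv l g x t)); [reflexivity|].
  intros l x t Hb; destruct (psmooth_is_derive _ _ _ _ l _ _ Hg Hb) as [H1 H2]; split.
  - exact (is_derive_opp _ _ _ H1).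
  - exact (is_derive_opp _ _ _ H2).
Qed.

Lemma pderiv_affine (d x0 t0 c a b : R) :
  psmooth d x0 t0 (fun x t => a * x + b * t + c) /\
  forall l x t, in_box d x0 t0 x t -> pderiv l (fun x t => a * x + b * t + c) x t =
    match l with
    | nil => a * x + b * t + c
    | true :: nil => a
    | false :: nil => b
    | _ => 0
    end.
Proof.
  apply (pderiv_guess d x0 t0 _ (fun l x t => 
    match l with
    | nil => a * x + b * t + c
    | true :: nil => a
    | false :: nil => b
    | _ => 0
    end)); [reflexivity|].
  intros l x t _; destruct l as [|b1 [|b2 l]].
  - split; auto_derive; trivial; ring.
  - destruct b1; split; auto_derive; trivial; ring.
  - destruct b1; split; auto_derive; trivial; ring.
Qed.

Lemma pderiv_const (d x0 t0 c : R) :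
  psmooth d x0 t0 (fun _ _ => c) /\
  forall l x t, in_box d x0 t0 x t -> pderiv l (fun _ _ => c) x t =
    match l with nil => c | _ => 0 end.
Proof.
  apply (pderiv_guess d x0 t0 _ (fun l x t =>
    match l with nil => c | _ => 0 end)); [reflexivity|].
  intros l x t _; destruct l; split; auto_derive; trivial.
Qed.

Lemma pderiv_sub_const (d x0 t0 c : R) (g : R -> R -> R) :
  psmooth d x0 t0 g ->
  psmooth d x0 t0 (fun x t => g x t - c) /\
  forall l x t, in_box d x0 t0 x t -> pderiv l (fun x t => g x t - c) x t =
    match l with nil => g x t - c | _ => pderiv l g x t end.
Proof.
  intros Hg; apply (pderiv_guess d x0 t0 _ (fun l x t =>
    match l with nil => g x t - c | _ => pderiv l g x t end)); [reflexivity|].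
  intros l x t Hb; destruct (psmooth_is_derive _ _ _ _ l _ _ Hg Hb) as [H1 H2].
  destruct l as [|b l]; [|split; assumption].
  split; cbn [pderiv] in *.
  - replace (dx g x t) with (minus (dx g x t) 0) by (unfold minus, plus, opp; simpl; ring).
    apply (is_derive_minus (fun y => g y t) (fun _ => c) x); [exact H1|].
    apply @is_derive_const.
  - replace (dt g x t) with (minus (dt g x t) 0) by (unfold minus, plus, opp; simpl; ring).
    apply (is_derive_minus (fun s => g x s) (fun _ => c) t); [exact H2|].
    apply @is_derive_const.
Qed.

(* A bound at the single point [(x,t)] for the words [l] of length at most [J] with
   at most [I] derivatives in [x]; [s] is a shift of the order, so that a derivative
   of order [s] of a majorized function is majorized with the same constant. *)
Definition majorized (al : R) (mu : nat -> R) (J I s : nat) (G : R)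
    (g : R -> R -> R) (x t : R) : Prop :=
  forall l, (length l <= J)%nat -> (nx l <= I)%nat ->
    Rabs (pderiv l g x t) <= G * al ^ nx l * (mu (length l + s)%nat * wt (length l + s)).

(** * Calculus of pointwise majorants *)

Section Majorants.
(** Submultiplicativity is asked only up to order [K], since the weights of the induction on
    [t]-derivatives are shown to have it only up to a finite order. *)
Variables (d x0 t0 al : R) (mu : nat -> R) (K : nat) (x t : R).
Hypothesis (Hb : in_box d x0 t0 x t) (Hal : 1 <= al) (Hmu : forall n, 0 <= mu n)
  (Hsub : forall i j, (i + j <= K)%nat -> mu i * mu j <= mu (i + j)%nat)
  (Hmu0 : 1 <= mu 0).

Lemma majorized_bound_nonneg (G : R) (k n : nat) : 0 <= G -> 0 <= G * al ^ k * (mu n * wt n).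
Proof.
  intros HG; pose proof (wt_pos n).
  apply Rmult_le_pos; apply Rmult_le_pos; try apply Hmu; try lra.
  apply pow_le; lra.
Qed.

Lemma majorized_ext (J I s : nat) (G : R) (g q : R -> R -> R) :
  (forall x t, in_box d x0 t0 x t -> g x t = q x t) ->
  majorized al mu J I s G g x t -> majorized al mu J I s G q x t.
Proof.
  intros H Hg l Hl Hn; rewrite <- (pderiv_ext d x0 t0 g q H l x t Hb).
  apply Hg; assumption.
Qed.

Lemma majorized_weaken (J J' I I' s : nat) (G G' : R) (g : R -> R -> R) :
  (J' <= J)%nat -> (I' <= I)%nat -> G <= G' ->
  majorized al mu J I s G g x t -> majorized al mu J' I' s G' g x t.
Proof.
  intros HJ HI HG Hg l Hl Hn; eapply Rle_trans; [apply Hg; lia|].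
  pose proof (majorized_bound_nonneg (G' - G) (nx l) (length l + s)); nra.
Qed.

Lemma majorized_mult_term (s1 s2 : nat) (G1 G2 p1 p2 : R) (l l1 l2 : list bool) :
  0 <= G1 -> 0 <= G2 ->
  (length l + s1 + s2 <= K)%nat ->
  (length l1 + length l2 = length l)%nat -> (nx l1 + nx l2 = nx l)%nat ->
  Rabs p1 <= G1 * al ^ nx l1 * (mu (length l1 + s1)%nat * wt (length l1 + s1)) ->
  Rabs p2 <= G2 * al ^ nx l2 * (mu (length l2 + s2)%nat * wt (length l2 + s2)) ->
  Rabs (p1 * p2) <= (G1 * G2 * al ^ nx l * mu (length l + s1 + s2)%nat) *
     (wt (length l1 + s1) * wt (length l2 + s2)).
Proof.
  intros HG1 HG2 HK Hl Hn H1 H2; rewrite Rabs_mult, <- Hn, pow_add.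
  assert (Hs : mu (length l1 + s1)%nat * mu (length l2 + s2)%nat <= mu (length l + s1 + s2)%nat).
  { replace (length l + s1 + s2)%nat with ((length l1 + s1) + (length l2 + s2))%nat by lia.
    apply Hsub; lia. }
  eapply Rle_trans; [apply Rmult_le_compat; [apply Rabs_pos|apply Rabs_pos|exact H1|exact H2]|].
  pose proof (wt_pos (length l1 + s1)); pose proof (wt_pos (length l2 + s2)).
  assert (0 < al ^ nx l1) by (apply pow_lt; lra).
  assert (0 < al ^ nx l2) by (apply pow_lt; lra).
  set (A1 := al ^ nx l1) in *; set (A2 := al ^ nx l2) in *.
  set (w1 := wt (length l1 + s1)) in *; set (w2 := wt (length l2 + s2)) in *.
  set (m1 := mu (length l1 + s1)%nat) in *; set (m2 := mu (length l2 + s2)%nat) in *.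
  replace (G1 * A1 * (m1 * w1) * (G2 * A2 * (m2 * w2))) with
    ((G1 * G2 * (A1 * A2) * (w1 * w2)) * (m1 * m2)) by ring.
  set (m3 := mu (length l + s1 + s2)%nat) in *.
  replace (G1 * G2 * (A1 * A2) * m3 * (w1 * w2)) with
    ((G1 * G2 * (A1 * A2) * (w1 * w2)) * m3) by ring.
  apply Rmult_le_compat_l; [|exact Hs].
  repeat apply Rmult_le_pos; lra.
Qed.

Lemma majorized_mult (J I s1 s2 : nat) (G1 G2 : R) (g q : R -> R -> R) :
  psmooth d x0 t0 g -> psmooth d x0 t0 q -> 0 <= G1 -> 0 <= G2 ->
  (J + s1 + s2 <= K)%nat ->
  majorized al mu J I s1 G1 g x t -> majorized al mu J I s2 G2 q x t ->
  majorized al mu J I (s1 + s2) (G1 * G2) (fun x t => g x t * q x t) x t.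
Proof.
  intros Sg Sq HG1 HG2 HK Hg Hq l Hl Hn.
  rewrite (proj2 (pderiv_mult d x0 t0 g q Sg Sq) l x t Hb).
  eapply Rle_trans; [apply (lsum_Rabs_le l _ (fun i j =>
    (G1 * G2 * al ^ nx l * mu (length l + s1 + s2)%nat) * (wt (i + s1) * wt (j + s2))))|].
  - intros l1 l2 Hl12 Hn12; apply majorized_mult_term; try assumption; try lia.
    + apply Hg; lia.
    + apply Hq; lia.
  - rewrite tsum_scal, Nat.add_assoc, <- Rmult_assoc.
    apply Rmult_le_compat_l; [|apply tsum_wt_shift].
    repeat apply Rmult_le_pos; try apply Hmu; try lra; apply pow_le; lra.
Qed.

(* All terms of the Leibniz sum but the one in which [g] is not differentiated:
   here derivatives of [q] of the top order [length l] are not needed. *)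
Lemma majorized_mult_commutator (J I s1 s2 : nat) (G1 G2 : R) (g q : R -> R -> R) (l : list bool) :
  psmooth d x0 t0 g -> psmooth d x0 t0 q -> 0 <= G1 -> 0 <= G2 ->
  (length l + s1 + s2 <= K)%nat -> (length l <= S J)%nat -> (nx l <= I)%nat ->
  majorized al mu (length l) I s1 G1 g x t -> majorized al mu J I s2 G2 q x t ->
  Rabs (pderiv l (fun x t => g x t * q x t) x t - g x t * pderiv l q x t)
   <= G1 * G2 * al ^ nx l * (mu (length l + s1 + s2)%nat * wt (length l + s1 + s2)).
Proof.
  intros Sg Sq HG1 HG2 HK HJ Hn Hg Hq.
  rewrite (proj2 (pderiv_mult d x0 t0 g q Sg Sq) l x t Hb).
  set (F := fun l1 l2 => pderiv l1 g x t * pderiv l2 q x t).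
  change (g x t * pderiv l q x t) with (F nil l).
  eapply Rle_trans; [apply (lsum_sub_nil_Rabs_le l F (fun i j =>
    (G1 * G2 * al ^ nx l * mu (length l + s1 + s2)%nat) * (wt (i + s1) * wt (j + s2))))|].
  - intros i j; pose proof (wt_pos (i + s1)); pose proof (wt_pos (j + s2)).
    repeat apply Rmult_le_pos; try apply Hmu; try lra; apply pow_le; lra.
  - intros l1 l2 Hne Hl12 Hn12; apply majorized_mult_term; try assumption; try lia.
    + apply Hg; lia.
    + apply Hq; [|lia]; destruct l1; [congruence|simpl in Hl12; lia].
  - rewrite tsum_scal, <- Rmult_assoc.
    apply Rmult_le_compat_l; [|apply tsum_wt_shift].
    repeat apply Rmult_le_pos; try apply Hmu; try lra; apply pow_le; lra.
Qed.

Lemma majorized_plus (J I s : nat) (G1 G2 : R) (g q : R -> R -> R) :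
  psmooth d x0 t0 g -> psmooth d x0 t0 q ->
  majorized al mu J I s G1 g x t -> majorized al mu J I s G2 q x t ->
  majorized al mu J I s (G1 + G2) (fun x t => g x t + q x t) x t.
Proof.
  intros Sg Sq Hg Hq l Hl Hn.
  rewrite (proj2 (pderiv_plus d x0 t0 g q Sg Sq) l x t Hb).
  eapply Rle_trans; [apply Rabs_triang|].
  pose proof (Hg l Hl Hn); pose proof (Hq l Hl Hn); lra.
Qed.

Lemma majorized_const (J I : nat) (c : R) : majorized al mu J I 0 (8 * Rabs c) (fun _ _ => c) x t.
Proof.
  intros l _ _; rewrite (proj2 (pderiv_const d x0 t0 c) l x t Hb).
  pose proof (Rabs_pos c).
  destruct l as [|b l].
  - cbn [length Nat.add]; rewrite wt_0; simpl; nra.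
  - rewrite Rabs_R0; apply majorized_bound_nonneg; lra.
Qed.

(** The factor [8] comes from the constant [1] at [n = 0], because [wt 0 = 1/8]. It does not grow
    with [n], which is what a power series needs. *)
Lemma majorized_pow (J I : nat) (G : R) (g : R -> R -> R) (n : nat) :
  psmooth d x0 t0 g -> 0 <= G -> (J <= K)%nat -> majorized al mu J I 0 G g x t ->
  psmooth d x0 t0 (fun x t => g x t ^ n) /\
  majorized al mu J I 0 (8 * G ^ n) (fun x t => g x t ^ n) x t.
Proof.
  intros Sg HG HJ Hg; induction n as [|n [IH1 IH2]]; cbn [pow].
  - split; [apply pderiv_const|].
    replace (8 * 1) with (8 * Rabs 1) by (rewrite Rabs_R1; ring); apply majorized_const.
  - split; [apply psmooth_mult; assumption|].
    replace (8 * (G * G ^ n)) with (G * (8 * G ^ n)) by ring.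
    apply (majorized_mult J I 0 0); try assumption; [|lia].
    pose proof (pow_le G n HG); lra.
Qed.

(** The constant is unchanged because only [t]-derivatives are taken; a derivative in [x] would cost
    a factor [al]. *)
Lemma majorized_pderiv (J I s : nat) (G : R) (g : R -> R -> R) (l : list bool) :
  nx l = O -> majorized al mu (J + length l) I s G g x t ->
  majorized al mu J I (s + length l) G (pderiv l g) x t.
Proof.
  intros Hl Hg l' Hl' Hn'; rewrite <- pderiv_app.
  assert (En : nx (l' ++ l) = nx l') by (unfold nx in *; rewrite count_occ_app; lia).
  pose proof (Hg (l' ++ l)) as H; rewrite En, length_app in H.
  replace (length l' + (s + length l))%nat with (length l' + length l + s)%nat by lia.
  apply H; lia.
Qed.

Lemma majorized_sum (J I s : nat) (c : nat -> R) (g : nat -> R -> R -> R) (n : nat) :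
  (forall i, (i <= n)%nat -> psmooth d x0 t0 (g i)) ->
  (forall i, (i <= n)%nat -> majorized al mu J I s (c i) (g i) x t) ->
  psmooth d x0 t0 (fun x t => sum_f_R0 (fun i => g i x t) n) /\
  majorized al mu J I s (sum_f_R0 c n) (fun x t => sum_f_R0 (fun i => g i x t) n) x t.
Proof.
  induction n as [|n IH]; intros Sg Hg; cbn [sum_f_R0].
  - split; [apply (Sg O)|apply (Hg O)]; lia.
  - destruct IH as [I1 I2]; [intros; apply Sg; lia|intros; apply Hg; lia|].
    split.
    + apply (pderiv_plus d x0 t0 (fun x t => sum_f_R0 (fun i => g i x t) n)); [exact I1|apply Sg; lia].
    + apply (majorized_plus J I s _ _ (fun x t => sum_f_R0 (fun i => g i x t) n)); 
        [exact I1|apply Sg; lia|exact I2|apply Hg; lia].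
Qed.
End Majorants.

(** * Composition with a power series *)

Lemma Rabs_between (a d x y c : R) :
  Rabs (x - a) < d -> Rabs (y - a) < d -> Rmin x y <= c <= Rmax x y ->
  Rabs (c - a) < d /\ Rabs (c - x) <= Rabs (y - x).
Proof.
  unfold Rmin, Rmax; destruct (Rle_dec x y); unfold Rabs;
    repeat destruct Rcase_abs; lra.
Qed.

Lemma mvt_ball (f f1 : R -> R) (a d x y : R) :
  (forall z, Rabs (z - a) < d -> is_derive f z (f1 z)) ->
  Rabs (x - a) < d -> Rabs (y - a) < d ->
  exists c, Rabs (c - a) < d /\ Rabs (c - x) <= Rabs (y - x) /\
    Rmin x y <= c <= Rmax x y /\ f y - f x = f1 c * (y - x).
Proof.
  intros Hf Hx Hy.
  destruct (MVT_gen f x y f1) as [c [Hc E]].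
  - intros z Hz; apply Hf; apply (Rabs_between a d x y z); lra.
  - intros z Hz; apply derivable_continuous_pt, ex_derive_Reals_0.
    exists (f1 z); apply Hf; apply (Rabs_between a d x y z); lra.
  - exists c; destruct (Rabs_between a d x y c Hx Hy Hc); auto.
Qed.

Lemma taylor2_ball (f f1 f2 : R -> R) (c2 a d x y : R) :
  (forall z, Rabs (z - a) < d -> is_derive f z (f1 z)) ->
  (forall z, Rabs (z - a) < d -> is_derive f1 z (f2 z)) ->
  (forall z, Rabs (z - a) < d -> Rabs (f2 z) <= c2) ->
  Rabs (x - a) < d -> Rabs (y - a) < d ->
  Rabs (f y - f x - f1 x * (y - x)) <= c2 * (Rabs (y - x) * Rabs (y - x)).
Proof.
  intros H1 H2 H3 Hx Hy.
  destruct (mvt_ball f f1 a d x y H1 Hx Hy) as [c [Hc [Hcx [_ E]]]].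
  destruct (mvt_ball f1 f2 a d x c H2 Hx Hc) as [e [He [_ [_ E2]]]].
  rewrite E; replace (f1 c * (y - x) - f1 x * (y - x)) with ((f1 c - f1 x) * (y - x)) by ring.
  rewrite E2, !Rabs_mult, Rmult_assoc.
  pose proof (H3 e He); pose proof (Rabs_pos (f2 e)); pose proof (Rabs_pos (c - x)).
  pose proof (Rabs_pos (y - x)).
  apply Rmult_le_compat; try assumption; [nra|].
  apply Rmult_le_compat_r; assumption.
Qed.

(** Summable bounds on the second derivatives make the summed Taylor remainder at most
    [C (y - x)^2]; this is differentiability of the sum, with no appeal to uniform convergence. *)
Lemma is_derive_Series (f f1 f2 : nat -> R -> R) (c0 c1 c2 : nat -> R) (a d x : R) :
  ex_series c0 -> ex_series c1 -> ex_series c2 ->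
  (forall n z, Rabs (z - a) < d -> is_derive (f n) z (f1 n z)) ->
  (forall n z, Rabs (z - a) < d -> is_derive (f1 n) z (f2 n z)) ->
  (forall n z, Rabs (z - a) < d -> Rabs (f n z) <= c0 n) ->
  (forall n z, Rabs (z - a) < d -> Rabs (f1 n z) <= c1 n) ->
  (forall n z, Rabs (z - a) < d -> Rabs (f2 n z) <= c2 n) ->
  Rabs (x - a) < d ->
  is_derive (fun z => Series (fun n => f n z)) x (Series (fun n => f1 n x)).
Proof.
  intros E0 E1 E2 D1 D2 B0 B1 B2 Hx.
  assert (S0 : forall z, Rabs (z - a) < d -> ex_series (fun n => f n z)).
  { intros z Hz; apply (@ex_series_le R_AbsRing R_CompleteNormedModule (fun n => f n z) c0); [|exact E0].
    intros n; apply (B0 n z Hz). }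
  assert (S1 : ex_series (fun n => f1 n x)).
  { apply (@ex_series_le R_AbsRing R_CompleteNormedModule (fun n => f1 n x) c1); [|exact E1].
    intros n; apply (B1 n x Hx). }
  assert (Hc2 : forall n, 0 <= c2 n).
  { intros n; eapply Rle_trans; [apply Rabs_pos|apply (B2 n x Hx)]. }
  set (C := Series c2).
  assert (HC : 0 <= C).
  { unfold C; apply Rle_trans with (Series (fun _ => 0)).
    - rewrite (Series_ext (fun _ : nat => 0) (fun n => 0 * c2 n)) by (intros; ring).
      rewrite Series_scal_l; lra.
    - apply Series_le; [|exact E2]; intros n; split; [lra|apply Hc2]. }
  assert (HT : forall y, Rabs (y - a) < d ->
    Rabs (Series (fun n => f n y) - Series (fun n => f n x)
       - Series (fun n => f1 n x) * (y - x)) <= C * (Rabs (y - x) * Rabs (y - x))).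
  { intros y Hy.
    assert (SS : ex_series (fun n => f1 n x * (y - x))).
    { apply ex_series_scal_r; exact S1. }
    rewrite <- Series_scal_r, <- Series_minus by (apply S0; assumption).
    rewrite <- Series_minus; [|apply (@ex_series_minus R_AbsRing R_NormedModule (fun n => f n y) (fun n => f n x));
       apply S0; assumption|exact SS].
    unfold C; rewrite <- Series_scal_r.
    assert (T : forall n, Rabs (f n y - f n x - f1 n x * (y - x))
        <= c2 n * (Rabs (y - x) * Rabs (y - x))).
    { intros n; apply (taylor2_ball (f n) (f1 n) (f2 n) (c2 n) a d); auto. }
    assert (E2' : ex_series (fun n => c2 n * (Rabs (y - x) * Rabs (y - x)))).
    { apply ex_series_scal_r; exact E2. }
    eapply Rle_trans; [apply Series_Rabs|apply Series_le].
    - apply (@ex_series_le R_AbsRing R_CompleteNormedModule (fun n => Rabs (f n y - f n x - f1 n x * (y - x)))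
         (fun n => c2 n * (Rabs (y - x) * Rabs (y - x)))); [|exact E2'].
      intros n; unfold norm; simpl; unfold abs; simpl; rewrite Rabs_Rabsolu; apply T.
    - intros n; split; [apply Rabs_pos|apply T].
    - exact E2'. }
  apply is_derive_Reals; intros eps Heps.
  assert (Hd : 0 < Rmin (d - Rabs (x - a)) (eps / (C + 1))).
  { apply Rmin_glb_lt; [lra|apply Rdiv_lt_0_compat; lra]. }
  exists (mkposreal _ Hd); intros h Hh0 Hh; simpl in Hh.
  pose proof (Rmin_l (d - Rabs (x - a)) (eps / (C + 1))).
  pose proof (Rmin_r (d - Rabs (x - a)) (eps / (C + 1))).
  assert (Hy : Rabs (x + h - a) < d).
  { replace (x + h - a) with ((x - a) + h) by ring.
    pose proof (Rabs_triang (x - a) h); lra. }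
  specialize (HT (x + h) Hy); replace (x + h - x) with h in HT by ring.
  assert (Hh' : 0 < Rabs h) by (apply Rabs_pos_lt; exact Hh0).
  replace ((Series (fun n => f n (x + h)) - Series (fun n => f n x)) / h - Series (fun n => f1 n x))
    with ((Series (fun n => f n (x + h)) - Series (fun n => f n x)
      - Series (fun n => f1 n x) * h) / h) by (field; exact Hh0).
  unfold Rdiv at 1; rewrite Rabs_mult, Rabs_inv.
  apply Rle_lt_trans with (C * Rabs h).
  - apply Rle_div_l; [exact Hh'|]; lra.
  - assert (Rabs h * (C + 1) < eps); [|nra].
    apply Rlt_div_r; lra.
Qed.

Lemma pderiv_Series (d x0 t0 : R) (P : nat -> R -> R -> R) (F : R -> R -> R) :
  (forall n, psmooth d x0 t0 (P n)) ->
  (forall l, exists c, ex_series c /\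
     forall n x t, in_box d x0 t0 x t -> Rabs (pderiv l (P n) x t) <= c n) ->
  (forall x t, in_box d x0 t0 x t -> F x t = Series (fun n => P n x t)) ->
  psmooth d x0 t0 F /\
  forall l x t, in_box d x0 t0 x t -> pderiv l F x t = Series (fun n => pderiv l (P n) x t).
Proof.
  intros SP Hc HF.
  apply (pderiv_guess d x0 t0 F (fun l x t => Series (fun n => pderiv l (P n) x t)));
    [exact HF|].
  intros l x t [Hx Ht].
  destruct (Hc l) as [c0 [E0 B0]].
  split.
  - destruct (Hc (true :: l)) as [c1 [E1 B1]].
    destruct (Hc (true :: true :: l)) as [c2 [E2 B2]].
    apply (is_derive_Series (fun n y => pderiv l (P n) y t)
      (fun n y => pderiv (true :: l) (P n) y t)
      (fun n y => pderiv (true :: true :: l) (P n) y t) c0 c1 c2 x0 d x E0 E1 E2);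
      try exact Hx; intros n z Hz.
    + apply (psmooth_is_derive d x0 t0 (P n) l z t); [apply SP|split; assumption].
    + apply (psmooth_is_derive d x0 t0 (P n) (true :: l) z t); [apply SP|split; assumption].
    + apply B0; split; assumption.
    + apply B1; split; assumption.
    + apply B2; split; assumption.
  - destruct (Hc (false :: l)) as [c1 [E1 B1]].
    destruct (Hc (false :: false :: l)) as [c2 [E2 B2]].
    apply (is_derive_Series (fun n y => pderiv l (P n) x y)
      (fun n y => pderiv (false :: l) (P n) x y)
      (fun n y => pderiv (false :: false :: l) (P n) x y) c0 c1 c2 t0 d t E0 E1 E2);
      try exact Ht; intros n z Hz.
    + apply (psmooth_is_derive d x0 t0 (P n) l x z); [apply SP|split; assumption].
    + apply (psmooth_is_derive d x0 t0 (P n) (false :: l) x z); [apply SP|split; assumption].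
    + apply B0; split; assumption.
    + apply B1; split; assumption.
    + apply B2; split; assumption.
Qed.

Lemma psum3_scal (a : nat -> nat -> nat -> R) (c y z w : R) (n : nat) :
  sum_f_R0 (fun i => sum_f_R0 (fun j =>
     c * (a i j (n - i - j)%nat * y ^ i * z ^ j * w ^ (n - i - j))) (n - i)) n
  = c * psum3 a y z w n.
Proof.
  unfold psum3; rewrite scal_sum; apply sum_eq; intros i Hi.
  rewrite Rmult_comm, scal_sum; apply sum_eq; intros j Hj; ring.
Qed.

(** Here [4096 = 8^4]: one [8] for the coefficient and one for each of the three powers. *)
Lemma majorized_psum3 (d x0 t0 al : R) (mu : nat -> R) (K : nat) (x t : R) (J I : nat) (G : R)
    (a : nat -> nat -> nat -> R) (g1 g2 g3 : R -> R -> R) (n : nat) :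
  in_box d x0 t0 x t -> 1 <= al -> (forall n, 0 <= mu n) -> 1 <= mu O ->
  (forall i j, (i + j <= K)%nat -> mu i * mu j <= mu (i + j)%nat) ->
  (J <= K)%nat -> 0 <= G ->
  psmooth d x0 t0 g1 -> psmooth d x0 t0 g2 -> psmooth d x0 t0 g3 ->
  majorized al mu J I 0 G g1 x t -> majorized al mu J I 0 G g2 x t -> majorized al mu J I 0 G g3 x t ->
  psmooth d x0 t0 (fun x t => psum3 a (g1 x t) (g2 x t) (g3 x t) n) /\
  majorized al mu J I 0 (4096 * psum3 (fun i j k => Rabs (a i j k)) G G G n)
    (fun x t => psum3 a (g1 x t) (g2 x t) (g3 x t) n) x t.
Proof.
  intros Hb Hal Hmu Hmu0 Hsub HJ HG S1 S2 S3 N1 N2 N3.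
  rewrite <- psum3_scal; unfold psum3.
  assert (T : forall i j k,
    psmooth d x0 t0 (fun x t => a i j k * g1 x t ^ i * g2 x t ^ j * g3 x t ^ k) /\
    majorized al mu J I 0 (4096 * (Rabs (a i j k) * G ^ i * G ^ j * G ^ k))
      (fun x t => a i j k * g1 x t ^ i * g2 x t ^ j * g3 x t ^ k) x t).
  { intros i j k.
    destruct (majorized_pow d x0 t0 al mu K x t Hb Hal Hmu Hsub Hmu0 J I G g1 i S1 HG HJ N1) as [P1 Q1].
    destruct (majorized_pow d x0 t0 al mu K x t Hb Hal Hmu Hsub Hmu0 J I G g2 j S2 HG HJ N2) as [P2 Q2].
    destruct (majorized_pow d x0 t0 al mu K x t Hb Hal Hmu Hsub Hmu0 J I G g3 k S3 HG HJ N3) as [P3 Q3].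
    pose proof (proj1 (pderiv_const d x0 t0 (a i j k))) as P0.
    pose proof (majorized_const d x0 t0 al mu x t Hb Hal Hmu Hmu0 J I (a i j k)) as Q0.
    pose proof (Rabs_pos (a i j k)).
    pose proof (pow_le G i HG); pose proof (pow_le G j HG); pose proof (pow_le G k HG).
    assert (P01 := psmooth_mult d x0 t0 _ _ P0 P1).
    assert (P012 := psmooth_mult d x0 t0 _ _ P01 P2).
    split; [apply (psmooth_mult d x0 t0 _ _ P012 P3)|].
    replace (4096 * (Rabs (a i j k) * G ^ i * G ^ j * G ^ k)) with
      (8 * Rabs (a i j k) * (8 * G ^ i) * (8 * G ^ j) * (8 * G ^ k)) by ring.
    assert (0 <= 8 * Rabs (a i j k) * (8 * G ^ i)) by (apply Rmult_le_pos; lra).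
    assert (0 <= 8 * Rabs (a i j k) * (8 * G ^ i) * (8 * G ^ j)) by (apply Rmult_le_pos; lra).
    apply (majorized_mult d x0 t0 al mu K x t Hb Hal Hmu Hsub J I 0 0 _ _
      (fun x t => a i j k * g1 x t ^ i * g2 x t ^ j)); try assumption; try lra; try lia.
    apply (majorized_mult d x0 t0 al mu K x t Hb Hal Hmu Hsub J I 0 0 _ _
      (fun x t => a i j k * g1 x t ^ i)); try assumption; try lra; try lia.
    apply (majorized_mult d x0 t0 al mu K x t Hb Hal Hmu Hsub J I 0 0 _ _
      (fun x t => a i j k)); try assumption; try lra; try lia. }
  apply (majorized_sum d x0 t0 al mu x t Hb J I 0 _ (fun i x t => sum_f_R0 (fun j =>
     a i j (n - i - j)%nat * g1 x t ^ i * g2 x t ^ j * g3 x t ^ (n - i - j)) (n - i)) n).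
  - intros i _.
    apply (majorized_sum d x0 t0 al mu x t Hb J I 0 (fun j => 4096 *
      (Rabs (a i j (n - i - j)%nat) * G ^ i * G ^ j * G ^ (n - i - j)))
      (fun j x t => a i j (n - i - j)%nat * g1 x t ^ i * g2 x t ^ j * g3 x t ^ (n - i - j)) (n - i)).
    + intros j _; apply (T i j (n - i - j)%nat).
    + intros j _; apply (T i j (n - i - j)%nat).
  - intros i _.
    apply (majorized_sum d x0 t0 al mu x t Hb J I 0 (fun j => 4096 *
      (Rabs (a i j (n - i - j)%nat) * G ^ i * G ^ j * G ^ (n - i - j)))
      (fun j x t => a i j (n - i - j)%nat * g1 x t ^ i * g2 x t ^ j * g3 x t ^ (n - i - j)) (n - i)).
    + intros j _; apply (T i j (n - i - j)%nat).
    + intros j _; apply (T i j (n - i - j)%nat).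
Qed.

Definition bounded_pderivs (d x0 t0 : R) (g : R -> R -> R) : Prop :=
  forall l, exists C, forall x t, in_box d x0 t0 x t -> Rabs (pderiv l g x t) <= C.

Lemma words_uniform (L : nat) (Phi : list bool -> R -> Prop) :
  (forall l C C', C <= C' -> Phi l C -> Phi l C') ->
  (forall l, exists C, Phi l C) ->
  exists C, forall l, (length l <= L)%nat -> Phi l C.
Proof.
  revert Phi; induction L as [|L IH]; intros Phi Hm Hex.
  - destruct (Hex nil) as [C HC]; exists C; intros [|b l] Hl; [exact HC|simpl in Hl; lia].
  - destruct (Hex nil) as [C0 H0].
    destruct (IH (fun l => Phi (true :: l))) as [C1 H1]; [intros l; apply Hm|intros l; apply Hex|].
    destruct (IH (fun l => Phi (false :: l))) as [C2 H2]; [intros l; apply Hm|intros l; apply Hex|].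
    exists (Rmax C0 (Rmax C1 C2)); intros [|b l] Hl.
    + apply (Hm _ C0); [apply Rmax_l|exact H0].
    + simpl in Hl; destruct b.
      * apply (Hm _ C1); [eapply Rle_trans; [apply Rmax_l|apply Rmax_r]|apply H1; lia].
      * apply (Hm _ C2); [eapply Rle_trans; [apply Rmax_r|apply Rmax_r]|apply H2; lia].
Qed.

(** A large [B] absorbs the finitely many constants of positive order. Order zero gains nothing from
    [B], so it needs the exact bound [G / 8], where [1/8 = wt 0]. *)
Lemma bounded_pderivs_majorized (d x0 t0 G : R) (g : R -> R -> R) (L : nat) :
  0 < G -> bounded_pderivs d x0 t0 g ->
  (forall x t, in_box d x0 t0 x t -> Rabs (g x t) <= G / 8) ->
  exists B0, 1 <= B0 /\ forall B al, B0 <= B -> 1 <= al -> forall x t, in_box d x0 t0 x t ->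
    majorized al (fun n => B ^ n) L L 0 G g x t.
Proof.
  intros HG Hg H0.
  destruct (words_uniform L (fun l C => forall x t, in_box d x0 t0 x t ->
    Rabs (pderiv l g x t) <= G * C * wt (length l))) as [C HC].
  - intros l C C' HCC H x t Hb; specialize (H x t Hb); pose proof (wt_pos (length l)).
    assert (0 <= G * wt (length l) * (C' - C)) by (repeat apply Rmult_le_pos; lra); lra.
  - intros l; destruct (Hg l) as [C HC]; exists (C / (G * wt (length l))).
    intros x t Hb; pose proof (wt_pos (length l)).
    replace (G * (C / (G * wt (length l))) * wt (length l)) with C by (field; lra).
    apply HC, Hb.
  - exists (Rmax 1 C); split; [apply Rmax_l|].
    intros B al HB Hal x t Hb l Hl _; rewrite Nat.add_0_r.
    pose proof (Rmax_l 1 C); pose proof (Rmax_r 1 C); pose proof (wt_pos (length l)).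
    assert (Ha : 1 <= al ^ nx l) by (apply pow_R1_Rle; lra).
    destruct l as [|b l].
    + simpl in *; rewrite wt_0; specialize (H0 x t Hb); lra.
    + eapply Rle_trans; [apply (HC _ Hl _ _ Hb)|].
      rewrite <- Rmult_assoc; apply Rmult_le_compat_r; [lra|].
      rewrite Rmult_assoc; apply Rmult_le_compat_l; [lra|].
      cbn [length]; assert (1 <= B ^ length l) by (apply pow_R1_Rle; lra).
      simpl (B ^ _); assert (B * 1 <= B * B ^ length l) by (apply Rmult_le_compat_l; lra).
      nra.
Qed.

(** The point is the order of quantifiers: [CF] is fixed before [al], [mu], [K], [J], [I] and the
    point. The same constant therefore serves at every stage of the later inductions, whatever
    weights are in force there. *)
Lemma majorized_compose3 (d x0 t0 G : R) (a : nat -> nat -> nat -> R)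
    (g1 g2 g3 F : R -> R -> R) :
  0 < G -> ex_series (psum3 (fun i j k => Rabs (a i j k)) G G G) ->
  psmooth d x0 t0 g1 -> psmooth d x0 t0 g2 -> psmooth d x0 t0 g3 ->
  bounded_pderivs d x0 t0 g1 -> bounded_pderivs d x0 t0 g2 -> bounded_pderivs d x0 t0 g3 ->
  (forall x t, in_box d x0 t0 x t -> Rabs (g1 x t) <= G / 8) ->
  (forall x t, in_box d x0 t0 x t -> Rabs (g2 x t) <= G / 8) ->
  (forall x t, in_box d x0 t0 x t -> Rabs (g3 x t) <= G / 8) ->
  (forall x t, in_box d x0 t0 x t -> F x t = Series (psum3 a (g1 x t) (g2 x t) (g3 x t))) ->
  psmooth d x0 t0 F /\
  exists CF, 0 <= CF /\ forall al mu K J I x t, in_box d x0 t0 x t ->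
    1 <= al -> (forall n, 0 <= mu n) -> 1 <= mu O ->
    (forall i j, (i + j <= K)%nat -> mu i * mu j <= mu (i + j)%nat) -> (J <= K)%nat ->
    majorized al mu J I 0 G g1 x t -> majorized al mu J I 0 G g2 x t -> majorized al mu J I 0 G g3 x t ->
    majorized al mu J I 0 CF F x t.
Proof.
  intros HG Ha S1 S2 S3 B1 B2 B3 L1 L2 L3 HF.
  set (A := psum3 (fun i j k => Rabs (a i j k)) G G G) in *.
  assert (HA : forall n, 0 <= A n).
  { intros n; unfold A, psum3; apply cond_pos_sum; intros i; apply cond_pos_sum; intros j.
    repeat apply Rmult_le_pos; try apply Rabs_pos; apply pow_le; lra. }
  assert (HAs : ex_series (fun n => 4096 * A n)).
  { exact (@ex_series_scal R_AbsRing R_NormedModule 4096 A Ha). }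
  (* Crude geometric weights, with a base depending on the length of the word, suffice to justify
     termwise differentiation; the given weights enter only afterwards. *)
  assert (Hcr : forall l : list bool, exists B, 1 <= B /\ forall n x t, in_box d x0 t0 x t ->
     psmooth d x0 t0 (fun x t => psum3 a (g1 x t) (g2 x t) (g3 x t) n) /\
     majorized 1 (fun n => B ^ n) (length l) (length l) 0 (4096 * A n)
       (fun x t => psum3 a (g1 x t) (g2 x t) (g3 x t) n) x t).
  { intros l.
    destruct (bounded_pderivs_majorized d x0 t0 G g1 (length l) HG B1 L1) as [b1 [Hb1 N1]].
    destruct (bounded_pderivs_majorized d x0 t0 G g2 (length l) HG B2 L2) as [b2 [Hb2 N2]].
    destruct (bounded_pderivs_majorized d x0 t0 G g3 (length l) HG B3 L3) as [b3 [Hb3 N3]].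
    exists (b1 + b2 + b3); split; [lra|]; intros n x t Hb.
    apply (majorized_psum3 d x0 t0 1 _ (length l)); try assumption; try lra; try lia.
    - intros k; apply pow_le; lra.
    - intros i j _; rewrite pow_add; lra.
    - apply N1; try assumption; lra.
    - apply N2; try assumption; lra.
    - apply N3; try assumption; lra. }
  (* [Hcr] gives smoothness only once a point of the box is at hand; for [d <= 0] the box is
     empty. *)
  assert (Hs : d <= 0 \/ 0 < d) by lra.
  assert (SP : forall n, psmooth d x0 t0 (fun x t => psum3 a (g1 x t) (g2 x t) (g3 x t) n)).
  { intros n; destruct Hs as [Hd|Hd].
    - intros l x t [Hx _]; pose proof (Rabs_pos (x - x0)); lra.
    - destruct (Hcr nil) as [B [_ H]]; apply (H n x0 t0).
      split; rewrite Rminus_diag, Rabs_R0; exact Hd. }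
  assert (Hbound : forall l, exists c, ex_series c /\ forall n x t, in_box d x0 t0 x t ->
     Rabs (pderiv l (fun x t => psum3 a (g1 x t) (g2 x t) (g3 x t) n) x t) <= c n).
  { intros l; destruct (Hcr l) as [B [HB H]].
    exists (fun n => B ^ length l * wt (length l) * (4096 * A n)); split.
    - exact (@ex_series_scal R_AbsRing R_NormedModule (B ^ length l * wt (length l)) _ HAs).
    - intros n x t Hb; destruct (H n x t Hb) as [_ Hn].
      specialize (Hn l (Nat.le_refl _)); rewrite Nat.add_0_r, pow1 in Hn.
      eapply Rle_trans; [apply Hn|lra].
      unfold nx; apply count_occ_bound. }
  destruct (pderiv_Series d x0 t0 (fun n x t => psum3 a (g1 x t) (g2 x t) (g3 x t) n) F
     SP Hbound HF) as [SF DF].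
  split; [exact SF|].
  exists (Series (fun n => 4096 * A n)); split.
  - apply Rle_trans with (Series (fun _ => 0)).
    + rewrite (Series_ext (fun _ : nat => 0) (fun n => 0 * A n)) by (intros; ring).
      rewrite Series_scal_l; lra.
    + apply Series_le; [|exact HAs]; intros n; pose proof (HA n); lra.
  - intros al mu K J I x t Hb Hal Hmu Hmu0 Hsub HJ N1 N2 N3 l Hl Hn.
    rewrite (DF l x t Hb).
    set (c := al ^ nx l * (mu (length l + 0)%nat * wt (length l + 0))).
    assert (Hterm : forall n, Rabs (pderiv l (fun x t => psum3 a (g1 x t) (g2 x t) (g3 x t) n) x t)
       <= 4096 * A n * c).
    { intros n; unfold c; rewrite <- Rmult_assoc.
      apply (majorized_psum3 d x0 t0 al mu K x t J I G); try assumption; lra. }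
    rewrite Rmult_assoc; fold c; rewrite <- Series_scal_r.
    assert (Ec : ex_series (fun n => 4096 * A n * c)).
    { apply ex_series_scal_r; exact HAs. }
    eapply Rle_trans; [apply Series_Rabs|apply Series_le].
    + apply (@ex_series_le R_AbsRing R_CompleteNormedModule _ (fun n => 4096 * A n * c)); [|exact Ec].
      intros n; unfold norm; simpl; unfold abs; simpl; rewrite Rabs_Rabsolu; apply Hterm.
    + intros n; split; [apply Rabs_pos|apply Hterm].
    + exact Ec.
Qed.

(** * Maximum principle *)

(** The gauge [1 / (|g| + 1)] encodes the values of [g], so the uniform lower bound [e] on gauges
    given by compactness becomes the upper bound [1/e] on [|g| + 1] at nearby points. *)
Lemma continuity_2d_rect_bounded (g : R -> R -> R) (a b a' b' : R) :
  (forall x y, a <= x <= b -> a' <= y <= b' -> continuity_2d_pt g x y) ->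
  exists C, forall x y, a <= x <= b -> a' <= y <= b' -> Rabs (g x y) <= C.
Proof.
  intros Hc.
  destruct (uniform_continuity_2d g a b a' b' Hc (mkposreal 1 Rlt_0_1)) as [de Hde].
  assert (Hp : forall u v, 0 < Rmin de (/ (Rabs (g u v) + 1))).
  { intros u v; apply Rmin_glb_lt; [apply cond_pos|apply Rinv_0_lt_compat].
    pose proof (Rabs_pos (g u v)); lra. }
  destruct (compactness_value_2d a b a' b' (fun u v => mkposreal _ (Hp u v))) as [e He].
  exists (/ e + 1); intros x y Hx Hy; apply Rnot_lt_le; intros Hlt.
  apply (He x y Hx Hy); intros [u [v [Hu [Hv [Hxu [Hyv Hd]]]]]]; simpl in *.
  pose proof (Rmin_l de (/ (Rabs (g u v) + 1))); pose proof (Rmin_r de (/ (Rabs (g u v) + 1))).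
  assert (H1 := Hde u v x y Hu Hv Hx Hy ltac:(lra) ltac:(lra)).
  assert (H2 : Rabs (g u v) + 1 <= / e).
  { pose proof (Rabs_pos (g u v)).
    rewrite <- (Rinv_inv (Rabs (g u v) + 1)); apply Rinv_le_contravar; [apply cond_pos|lra]. }
  pose proof (Rabs_triang (g x y - g u v) (g u v)).
  replace (g x y - g u v + g u v) with (g x y) in H3 by ring; lra.
Qed.

(** If the supremum [M] were not attained, [1 / (M - g)] would be continuous, hence bounded, and [M]
    could be lowered. *)
Lemma continuity_2d_rect_max (g : R -> R -> R) (a b a' b' : R) :
  a <= b -> a' <= b' ->
  (forall x y, a <= x <= b -> a' <= y <= b' -> continuity_2d_pt g x y) ->
  exists x y, a <= x <= b /\ a' <= y <= b' /\
    forall x' y', a <= x' <= b -> a' <= y' <= b' -> g x' y' <= g x y.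
Proof.
  intros Hab Hab' Hc.
  destruct (continuity_2d_rect_bounded g a b a' b' Hc) as [C HC].
  destruct (completeness (fun r => exists x y, a <= x <= b /\ a' <= y <= b' /\ r = g x y))
    as [M [HM1 HM2]].
  - exists C; intros r [x [y [Hx [Hy ->]]]]; specialize (HC x y Hx Hy).
    pose proof (Rle_abs (g x y)); lra.
  - exists (g a a'), a, a'; repeat split; lra.
  - assert (HM : forall x y, a <= x <= b -> a' <= y <= b' -> g x y <= M).
    { intros x y Hx Hy; apply HM1; exists x, y; auto. }
    destruct (classic (exists x y, a <= x <= b /\ a' <= y <= b' /\ g x y = M))
      as [[x [y [Hx [Hy E]]]]|Hn].
    { exists x, y; rewrite E; auto. }
    exfalso.
    assert (Hlt : forall x y, a <= x <= b -> a' <= y <= b' -> g x y < M).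
    { intros x y Hx Hy; destruct (HM x y Hx Hy) as [|E]; [assumption|].
      exfalso; apply Hn; exists x, y; auto. }
    destruct (continuity_2d_rect_bounded (fun x y => / (M - g x y)) a b a' b') as [C' HC'].
    { intros x y Hx Hy; apply continuity_2d_pt_inv; [|specialize (Hlt x y Hx Hy); lra].
      apply continuity_2d_pt_minus; [apply continuity_2d_pt_const|apply Hc; assumption]. }
    assert (HC0 : 0 < C').
    { specialize (HC' a a' ltac:(lra) ltac:(lra)); specialize (Hlt a a' ltac:(lra) ltac:(lra)).
      eapply Rlt_le_trans; [|exact HC']; apply Rabs_pos_lt, Rinv_neq_0_compat; lra. }
    assert (M <= M - / C'); [|pose proof (Rinv_0_lt_compat _ HC0); lra].
    apply HM2; intros r [x [y [Hx [Hy ->]]]].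
    specialize (HC' x y Hx Hy); specialize (Hlt x y Hx Hy).
    rewrite Rabs_pos_eq in HC' by (left; apply Rinv_0_lt_compat; lra).
    assert (/ C' <= M - g x y); [|lra].
    rewrite <- (Rinv_inv (M - g x y)); apply Rinv_le_contravar; [|exact HC'].
    apply Rinv_0_lt_compat; lra.
Qed.

Lemma is_derive_growth (g1 : R -> R) (x L : R) :
  is_derive g1 x L -> 0 < L ->
  exists e, 0 < e /\ forall y, Rabs (y - x) < e -> 
    (x < y -> g1 x < g1 y) /\ (y < x -> g1 y < g1 x).
Proof.
  intros Hd HL; apply is_derive_Reals in Hd.
  destruct (Hd (L / 2) ltac:(lra)) as [de Hde].
  exists de; split; [apply cond_pos|].
  assert (H : forall y, Rabs (y - x) < de -> y <> x -> 0 < (g1 y - g1 x) / (y - x)).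
  { intros y Hy Hne; specialize (Hde (y - x) ltac:(lra) Hy).
    replace (x + (y - x)) with y in Hde by ring.
    apply Rabs_def2 in Hde; lra. }
  intros y Hy; split; intros Hlt; specialize (H y Hy ltac:(lra)).
  - apply Rmult_lt_compat_r with (r := y - x) in H; [|lra].
    unfold Rdiv in H; rewrite Rmult_assoc, Rinv_l in H; lra.
  - apply Rmult_lt_compat_r with (r := x - y) in H; [|lra].
    replace ((g1 y - g1 x) / (y - x) * (x - y)) with (- (g1 y - g1 x)) in H by (field; lra).
    lra.
Qed.

(** The condition [g1 x = 0] is bypassed: if [L > 0], then [g1] grows through [x], and moving right
    when [g1 x >= 0], left otherwise, increases [g]. *)
Lemma second_derivative_at_max (g g1 : R -> R) (x L e : R) :
  0 < e -> (forall y, Rabs (y - x) < e -> is_derive g y (g1 y)) ->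
  is_derive g1 x L -> (forall y, Rabs (y - x) < e -> g y <= g x) -> L <= 0.
Proof.
  intros He H1 H2 Hm; apply Rnot_lt_le; intros HL.
  destruct (is_derive_growth g1 x L H2 HL) as [e' [He' Hg]].
  assert (Hr : exists r, 0 < r /\ r < e /\ r < e').
  { exists (Rmin e e' / 2); pose proof (Rmin_l e e'); pose proof (Rmin_r e e').
    assert (0 < Rmin e e') by (apply Rmin_glb_lt; lra); lra. }
  destruct Hr as [r [Hr0 [Hre Hre']]].
  assert (Hx : Rabs (x - x) < e) by (rewrite Rminus_diag, Rabs_R0; lra).
  destruct (Rle_lt_dec 0 (g1 x)) as [Hp|Hp].
  - assert (Hy : Rabs (x + r - x) < e) by (replace (x + r - x) with r by ring; rewrite Rabs_pos_eq; lra).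
    destruct (mvt_ball g g1 x e x (x + r) H1 Hx Hy) as [c [Hc [Hcx [Hb E]]]].
    specialize (Hm _ Hy).
    rewrite Rmin_left, Rmax_right in Hb by lra.
    (* The mean value point may be the endpoint [x], where [g1] is merely nonnegative. Halving the
       step produces a mean value point [c'] strictly to the right of [x]. *)
    destruct (Req_dec c x) as [->|Hne].
    + destruct (mvt_ball g g1 x e (x + r / 2) (x + r) H1) as [c' [Hc' [_ [Hb' E']]]];
        [replace (x + r / 2 - x) with (r / 2) by ring; rewrite Rabs_pos_eq; lra|exact Hy|].
      destruct (mvt_ball g g1 x e x (x + r / 2) H1 Hx) as [c'' [Hc'' [_ [Hb'' E'']]]];
        [replace (x + r / 2 - x) with (r / 2) by ring; rewrite Rabs_pos_eq; lra|].
      rewrite Rmin_left, Rmax_right in Hb' by lra.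
      rewrite Rmin_left, Rmax_right in Hb'' by lra.
      assert (g1 x < g1 c') by (apply Hg; [rewrite Rabs_pos_eq; lra|lra]).
      assert (g1 x <= g1 c'').
      { destruct (Req_dec c'' x) as [->|]; [lra|left; apply Hg; [rewrite Rabs_pos_eq; lra|lra]]. }
      nra.
    + assert (g1 x < g1 c) by (apply Hg; [rewrite Rabs_pos_eq; lra|lra]).
      nra.
  - assert (Hy : Rabs (x - r - x) < e)
      by (replace (x - r - x) with (- r) by ring; rewrite Rabs_Ropp, Rabs_pos_eq; lra).
    destruct (mvt_ball g g1 x e x (x - r) H1 Hx Hy) as [c [Hc [Hcx [Hb E]]]].
    specialize (Hm _ Hy).
    rewrite Rmin_right, Rmax_left in Hb by lra.
    assert (g1 c < 0).
    { destruct (Req_dec c x) as [->|]; [lra|].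
      assert (g1 c < g1 x); [|lra].
      apply Hg; [rewrite Rabs_left1; lra|lra]. }
    nra.
Qed.

(** Written in one variable so that it applies in [x] and in [t] alike; [k] is the quadratic term of
    the variable that is frozen. *)
Lemma test_function_at_max (f f1 v v1 V V1 : R -> R) (f2 v2 V2 K b c k x e : R) :
  0 < e ->
  (forall y, Rabs (y - x) < e -> is_derive f y (f1 y)) -> is_derive f1 x f2 ->
  (forall y, Rabs (y - x) < e -> is_derive v y (v1 y)) -> is_derive v1 x v2 ->
  (forall y, Rabs (y - x) < e -> is_derive V y (V1 y)) -> is_derive V1 x V2 ->
  (forall y, Rabs (y - x) < e ->
     (f y * v y) ^ 2 + K * V y ^ 2 + b * (y - c) ^ 2 + k
     <= (f x * v x) ^ 2 + K * V x ^ 2 + b * (x - c) ^ 2 + k) ->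
  2 * (f1 x * v x + f x * v1 x) ^ 2
   + 2 * (f x * v x) * (f2 * v x + 2 * f1 x * v1 x + f x * v2)
   + 2 * K * (V1 x ^ 2 + V x * V2) + 2 * b <= 0.
Proof.
  intros He Df Df1 Dv Dv1 DV DV1 Hm.
  apply (second_derivative_at_max
    (fun y => (f y * v y) ^ 2 + K * V y ^ 2 + b * (y - c) ^ 2 + k)
    (fun y => 2 * (f y * v y) * (f1 y * v y + f y * v1 y) + K * (2 * V y * V1 y) + 2 * b * (y - c))
    x _ e He); [| |exact Hm].
  - intros y Hy; specialize (Df y Hy); specialize (Dv y Hy); specialize (DV y Hy).
    auto_derive; [repeat split; eexists; eassumption|].
    rewrite (is_derive_unique _ _ _ Df : Derive (fun z => f z) y = f1 y), (is_derive_unique _ _ _ Dv : Derive (fun z => v z) y = v1 y), (is_derive_unique _ _ _ DV : Derive (fun z => V z) y = V1 y).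
    ring.
  - assert (Hx : Rabs (x - x) < e) by (rewrite Rminus_diag, Rabs_R0; lra).
    specialize (Df x Hx); specialize (Dv x Hx); specialize (DV x Hx).
    auto_derive; [repeat split; eexists; eassumption|].
    rewrite (is_derive_unique _ _ _ Df : Derive (fun z => f z) x = f1 x), (is_derive_unique _ _ _ Dv : Derive (fun z => v z) x = v1 x), (is_derive_unique _ _ _ DV : Derive (fun z => V z) x = V1 x),
     (is_derive_unique _ _ _ Df1 : Derive (fun z => f1 z) x = f2), (is_derive_unique _ _ _ Dv1 : Derive (fun z => v1 z) x = v2), (is_derive_unique _ _ _ DV1 : Derive (fun z => V1 z) x = V2).
    ring.
Qed.

Ltac nonneg := repeat match goal with
  | |- 0 <= _ ^ 2 => apply pow2_ge_0
  | |- 0 <= _ ^ _ => apply pow_le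
  | |- 0 <= _ * _ => apply Rmult_le_pos
  | |- 0 <= _ / 2 => apply Rmult_le_pos
  | |- 0 <= _ + _ => apply Rplus_le_le_0_compat
  | |- 0 <= Rabs _ => apply Rabs_pos
  end; try lra.

Lemma Rabs_prod_le (p q P Q : R) : Rabs p <= P -> Rabs q <= Q -> Rabs (p * q) <= P * Q.
Proof. intros; rewrite Rabs_mult; apply Rmult_le_compat; try apply Rabs_pos; assumption. Qed.

Lemma Rabs_ge_opp (p P : R) : Rabs p <= P -> - P <= p.
Proof. intros H; apply Rabs_le_between in H; lra. Qed.

Lemma sqr_Rabs (p : R) : p ^ 2 = Rabs p ^ 2.
Proof. rewrite RPow_abs, Rabs_pos_eq; [reflexivity|apply pow2_ge_0]. Qed.

(* The positive terms [2 K z v^2] (from [V_t = v]) and [z (f v)_t^2] absorb the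
   commutator terms; [b1] and [b2] absorb the inhomogeneous ones, with and
   without the degenerate factor [z]. *)
Lemma bernstein_algebra (z a A c C1 w N K P b1 b2
    f fx fxx ft ftt v vx vt vxx vtt V Vx Vxx : R) :
  0 <= z -> 1 <= a -> a <= A -> 0 <= c -> 0 <= C1 -> 0 < w -> 0 < N ->
  0 <= f <= 1 -> fx ^ 2 <= C1 * z * w ^ 2 -> Rabs fxx <= 2 * C1 * z * w ^ 2 ->
  Rabs ft <= 2 * w -> Rabs ftt <= 2 * w ^ 2 ->
  Rabs V <= N ->
  Rabs (Vxx + z * a * vt) <= c * N + z * c * (Rabs v * w + N * w ^ 2) ->
  Rabs (vxx + z * a * vtt) <=
    c * N * w + z * c * (Rabs vt * w + Rabs v * w ^ 2 + N * w ^ 3) ->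
  (f * v) ^ 2 <= P ->
  K = (12 * C1 + 36 * A + c ^ 2 + 7 * c) * w ^ 2 ->
  c * N ^ 2 * w ^ 4 + K * c ^ 2 * N ^ 2 * w ^ 2 + 2 * K * c * N ^ 2 * w ^ 2 <= 2 * b1 ->
  P + c ^ 2 * N ^ 2 * w ^ 2 + 2 * K * c * N ^ 2 < 2 * b2 ->
  2 * (fx * v + f * vx) ^ 2 + 2 * (f * v) * (fxx * v + 2 * fx * vx + f * vxx)
    + 2 * K * (Vx ^ 2 + V * Vxx) + 2 * b2 <= 0 ->
  2 * (ft * v + f * vt) ^ 2 + 2 * (f * v) * (ftt * v + 2 * ft * vt + f * vtt)
    + 2 * K * (v ^ 2 + V * vt) + 2 * b1 <= 0 ->
  False.
Proof.
  intros Hz Ha1 HaA Hc HC1 Hw HN Hf Hfx Hfxx Hft Hftt HV HLV HLv HP HK Hb1 Hb2 HX HT.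
  assert (HK0 : 0 <= K).
  { rewrite HK; apply Rmult_le_pos; [nra|apply pow2_ge_0]. }
  set (y := ft * v + f * vt) in *.
  set (yx := fx * v + f * vx) in *.
  (* Substituting [f vx = yx - v fx] and completing the square removes the cross term in [vx], at
     the price of [8 v^2 fx^2]; [ET] does the same in [t]. *)
  assert (EX : 2 * yx ^ 2 + 4 * (f * v) * (fx * vx) = yx ^ 2 + (yx + 2 * (v * fx)) ^ 2 - 8 * (v ^ 2 * fx ^ 2))
    by (unfold yx; ring).
  assert (ET : 2 * y ^ 2 + 4 * (f * v) * (ft * vt) = y ^ 2 + (y + 2 * (v * ft)) ^ 2 - 8 * (v ^ 2 * ft ^ 2))
    by (unfold y; ring).
  pose proof (pow2_ge_0 yx); pose proof (pow2_ge_0 (yx + 2 * (v * fx))).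
  pose proof (pow2_ge_0 y); pose proof (pow2_ge_0 (y + 2 * (v * ft))).
  pose proof (pow2_ge_0 v) as Hv2; pose proof (pow2_ge_0 w) as Hw2.
  pose proof (Rabs_pos v) as Hav; pose proof (Rabs_pos vt) as Havt.
  pose proof (Rabs_pos y) as Hay; pose proof (Rabs_pos V) as HaV.
  (* Commutator losses are counted in units of [S]: [12 C1 = 8 C1 + 4 C1] from [fx] and [fxx],
     [36 A = 32 A + 4 A] from [ft] and [ftt], and [c^2 + 7 c] from the equation for [v]. [K z v^2]
     is exactly their sum; of the available [2 K z v^2], the other half pays for the loss in
     [G6]. *)
  set (S := z * w ^ 2 * v ^ 2).
  assert (HS : 0 <= S) by (unfold S; nonneg).
  assert (HAS : S <= A * S) by nra.
  assert (G1 : v ^ 2 * fx ^ 2 <= C1 * S).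
  { unfold S; replace (C1 * (z * w ^ 2 * v ^ 2)) with (v ^ 2 * (C1 * z * w ^ 2)) by ring.
    apply Rmult_le_compat_l; assumption. }
  assert (Hza : 0 <= z * a) by nonneg.
  assert (HzA : z * a <= z * A) by (apply Rmult_le_compat_l; lra).
  assert (G2 : z * a * (v ^ 2 * ft ^ 2) <= 4 * A * S).
  { unfold S; replace (4 * A * (z * w ^ 2 * v ^ 2)) with (z * A * (v ^ 2 * (2 * w) ^ 2)) by ring.
    assert (ft ^ 2 <= (2 * w) ^ 2).
    { rewrite (sqr_Rabs ft); apply pow_incr; split; [apply Rabs_pos|exact Hft]. }
    apply Rmult_le_compat; [exact Hza| |exact HzA|].
    - apply Rmult_le_pos; [exact Hv2|apply pow2_ge_0].
    - apply Rmult_le_compat_l; assumption. }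
  assert (G3 : - (2 * C1 * S) <= f * v ^ 2 * fxx).
  { apply Rabs_ge_opp; rewrite Rabs_mult, (Rabs_pos_eq (f * v ^ 2)) by nonneg.
    unfold S; replace (2 * C1 * (z * w ^ 2 * v ^ 2)) with (v ^ 2 * (2 * C1 * z * w ^ 2)) by ring.
    apply Rmult_le_compat; [nonneg|apply Rabs_pos|nra|exact Hfxx]. }
  assert (G4 : - (2 * A * S) <= z * a * (f * v ^ 2 * ftt)).
  { apply Rabs_ge_opp; rewrite Rabs_mult, (Rabs_pos_eq (z * a)) by exact Hza.
    unfold S; replace (2 * A * (z * w ^ 2 * v ^ 2)) with (z * A * (v ^ 2 * (2 * w ^ 2))) by ring.
    apply Rmult_le_compat; [exact Hza|apply Rabs_pos|exact HzA|].
    rewrite Rabs_mult, (Rabs_pos_eq (f * v ^ 2)) by nonneg.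
    apply Rmult_le_compat; [nonneg|apply Rabs_pos|nra|exact Hftt]. }
  assert (G5 : - ((f * v) ^ 2 + c ^ 2 * N ^ 2 * w ^ 2 + z * y ^ 2 + (c ^ 2 + 7 * c) * S
       + z * c * N ^ 2 * w ^ 4) <= 2 * (f ^ 2 * v * (vxx + z * a * vtt))).
  { assert (Hf1 : f ^ 2 <= 1) by nra.
    assert (Hf2 : f ^ 2 <= f) by nra.
    assert (Hffv : f ^ 2 * Rabs v <= Rabs v)
      by (pose proof (Rmult_le_compat_r _ _ _ Hav Hf1); lra).
    assert (Hq : f ^ 2 * Rabs v <= Rabs (f * v)).
    { rewrite Rabs_mult, (Rabs_pos_eq f) by lra; apply Rmult_le_compat_r; assumption. }
    assert (Q0 : Rabs (f ^ 2 * v * (vxx + z * a * vtt)) <=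
        f ^ 2 * Rabs v * (c * N * w + z * c * (Rabs vt * w + Rabs v * w ^ 2 + N * w ^ 3))).
    { apply Rabs_prod_le; [|exact HLv].
      rewrite Rabs_mult, (Rabs_pos_eq (f ^ 2)) by (apply pow2_ge_0); lra. }
    assert (Q1 : 2 * (f ^ 2 * Rabs v * (c * N * w)) <= (f * v) ^ 2 + c ^ 2 * N ^ 2 * w ^ 2).
    { assert (0 <= c * N * w) by (nonneg).
      pose proof (pow2_ge_0 (Rabs (f * v) - c * N * w)) as Hsq.
      rewrite (sqr_Rabs (f * v)); nra. }
    assert (Hfvt : f * Rabs vt <= Rabs y + 2 * w * Rabs v).
    { replace (f * Rabs vt) with (Rabs (y + - (ft * v))).
      - eapply Rle_trans; [apply Rabs_triang|]; rewrite Rabs_Ropp, Rabs_mult.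
        pose proof (Rmult_le_compat_r (Rabs v) _ _ Hav Hft); lra.
      - replace (y + - (ft * v)) with (f * vt) by (unfold y; ring).
        rewrite Rabs_mult, (Rabs_pos_eq f); lra. }
    assert (Hzc : 0 <= z * c) by nonneg.
    (* Both factors of [f^2] are used: one bounds [f |v|] by [|v|], the other turns [f vt] into
       [y - ft v]. The resulting [z y^2] is absorbed by the square [z a y^2] kept in [ET]. *)
    assert (Q2 : 2 * (f ^ 2 * Rabs v * (z * c * (Rabs vt * w))) <= z * y ^ 2 + (c ^ 2 + 4 * c) * S).
    { replace (2 * (f ^ 2 * Rabs v * (z * c * (Rabs vt * w)))) with
        ((2 * (z * c) * w) * (f * Rabs v * (f * Rabs vt))) by ring.
      apply Rle_trans with ((2 * (z * c) * w) * (Rabs v * (Rabs y + 2 * w * Rabs v))).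
      - apply Rmult_le_compat_l; [nonneg|].
        apply Rmult_le_compat; [nra|nra|nra|exact Hfvt].
      - unfold S; rewrite (sqr_Rabs v), (sqr_Rabs y).
        assert (0 <= z * (Rabs y - c * w * Rabs v) ^ 2)
          by (apply Rmult_le_pos; [exact Hz|apply pow2_ge_0]).
        lra. }
    assert (Q3 : 2 * (f ^ 2 * Rabs v * (z * c * (Rabs v * w ^ 2))) <= 2 * c * S).
    { unfold S; rewrite (sqr_Rabs v).
      replace (2 * (f ^ 2 * Rabs v * (z * c * (Rabs v * w ^ 2)))) with
        (2 * (z * c) * w ^ 2 * Rabs v * (f ^ 2 * Rabs v)) by ring.
      replace (2 * c * (z * w ^ 2 * Rabs v ^ 2)) with
        (2 * (z * c) * w ^ 2 * Rabs v * Rabs v) by ring.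
      apply Rmult_le_compat_l; [|exact Hffv]; nonneg. }
    assert (Q4 : 2 * (f ^ 2 * Rabs v * (z * c * (N * w ^ 3))) <= c * S + z * c * N ^ 2 * w ^ 4).
    { apply Rle_trans with (2 * (z * c) * (N * w ^ 3) * Rabs v).
      - replace (2 * (f ^ 2 * Rabs v * (z * c * (N * w ^ 3)))) with
          (2 * (z * c) * (N * w ^ 3) * (f ^ 2 * Rabs v)) by ring.
        apply Rmult_le_compat_l; [|exact Hffv].
        assert (0 <= w ^ 3) by (apply pow_le; lra).
        nonneg.
      - unfold S; rewrite (sqr_Rabs v).
        assert (0 <= (z * c) * (Rabs v * w - N * w ^ 2) ^ 2)
          by (apply Rmult_le_pos; [exact Hzc|apply pow2_ge_0]).
        lra. }
    apply Rabs_ge_opp in Q0; lra. }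
  assert (G6 : - (2 * K * c * N ^ 2 + K * (z * v ^ 2) + z * (K * c ^ 2 * N ^ 2 * w ^ 2)
       + z * (2 * K * c * N ^ 2 * w ^ 2)) <= 2 * K * (V * (Vxx + z * a * vt))).
  { assert (Q0 : - (N * (c * N + z * c * (Rabs v * w + N * w ^ 2))) <= V * (Vxx + z * a * vt))
      by (apply Rabs_ge_opp, Rabs_prod_le; assumption).
    assert (Q1 : 2 * N * c * w * Rabs v <= v ^ 2 + c ^ 2 * N ^ 2 * w ^ 2).
    { rewrite (sqr_Rabs v); pose proof (pow2_ge_0 (Rabs v - c * N * w)); lra. }
    assert (Q2 := Rmult_le_compat_l (2 * K) _ _ ltac:(lra) Q0).
    assert (Q3 := Rmult_le_compat_l (K * z) _ _ ltac:(apply Rmult_le_pos; lra) Q1).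
    lra. }
  assert (HKS : K * (z * v ^ 2) = (12 * C1 + 36 * A + c ^ 2 + 7 * c) * S)
    by (rewrite HK; unfold S; ring).
  (* The inequality in [t] is multiplied by [z a] and added to the one in [x], which assembles the
     operator on [v] and on [V]. Losses with a factor [z] and no [v] go to [b1], those without [z]
     go to [b2], whose strict bound gives the contradiction. *)
  assert (HzT := Rmult_le_compat_l (z * a) _ _ Hza HT).
  assert (Hzb : z * (2 * b1) <= z * a * (2 * b1)).
  { apply Rmult_le_compat_r; [|nra].
    eapply Rle_trans; [|exact Hb1].
    assert (0 <= w ^ 4) by (apply pow_le; lra).
    pose proof (pow2_ge_0 c); pose proof (pow2_ge_0 N).
    nonneg. }
  assert (Hzb1 := Rmult_le_compat_l z _ _ Hz Hb1).
  assert (Hzv : z * (2 * K * v ^ 2) <= z * a * (2 * K * v ^ 2)).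
  { apply Rmult_le_compat_r; [nonneg|nra]. }
  assert (Hzy : z * y ^ 2 <= z * a * y ^ 2).
  { apply Rmult_le_compat_r; [assumption|nra]. }
  assert (Hzy2 : 0 <= z * a * (y + 2 * (v * ft)) ^ 2) by (apply Rmult_le_pos; assumption).
  assert (HVx : 0 <= 2 * K * Vx ^ 2) by (nonneg).
  assert (EX' : 2 * yx ^ 2 + 2 * (f * v) * (fxx * v + 2 * fx * vx + f * vxx) =
    yx ^ 2 + (yx + 2 * (v * fx)) ^ 2 - 8 * (v ^ 2 * fx ^ 2) + 2 * (f * v ^ 2 * fxx)
     + 2 * (f ^ 2 * v * vxx)) by (rewrite <- EX; ring).
  assert (ET' : z * a * (2 * y ^ 2 + 2 * (f * v) * (ftt * v + 2 * ft * vt + f * vtt)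
      + 2 * K * (v ^ 2 + V * vt) + 2 * b1) =
    z * a * y ^ 2 + z * a * (y + 2 * (v * ft)) ^ 2 - 8 * (z * a * (v ^ 2 * ft ^ 2))
     + 2 * (z * a * (f * v ^ 2 * ftt)) + 2 * (f ^ 2 * v * (z * a * vtt))
     + z * a * (2 * K * v ^ 2) + 2 * K * (V * (z * a * vt)) + z * a * (2 * b1)).
  { replace (2 * y ^ 2 + 2 * (f * v) * (ftt * v + 2 * ft * vt + f * vtt)) with
      ((2 * y ^ 2 + 4 * (f * v) * (ft * vt)) + 2 * (f * v) * (ftt * v + f * vtt)) by ring.
    rewrite ET; ring. }
  rewrite EX' in HX; rewrite ET', Rmult_0_r in HzT.
  clear EX ET EX' ET' HT Hb1 HLV HLv Hfx Hfxx Hft Hftt.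
  lra.
Qed.

(** * Cutoff function and Bernstein estimate for one [t]-derivative *)

Lemma smooth_continuity_2d (d x0 t0 : R) (g : R -> R -> R) (l : list bool) (x t : R) :
  smooth_on_box d x0 t0 g -> in_box d x0 t0 x t -> continuity_2d_pt (pderiv l g) x t.
Proof.
  intros H Hb; apply continuity_2d_pt_filterlim, (H l x t Hb).
Qed.

Lemma exp_ge_2 (y : R) : 1 <= y -> 2 < exp y.
Proof.
  intros H; pose proof (exp_ineq1 1 ltac:(lra)).
  destruct (Req_dec y 1) as [->|]; [lra|].
  assert (exp 1 < exp y) by (apply exp_increasing; lra); lra.
Qed.

(** Its value at [(x1, t1)] is [1/2]. The exponential cuts off on the side of large [psi] only:
    where [psi] lies far below [psi x1], the function still stays below [1] and its derivatives stay
    controlled, so the support is a sublevel set of [psi] and not a thin layer around a level. *)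
Definition cutoff (psi : R -> R) (x1 t1 de x t : R) : R :=
  1 - ((t - t1) / de) ^ 2 - / 2 * exp ((psi x - psi x1) / de).

Lemma cutoff_pos (psi : R -> R) (x1 t1 de x t : R) :
  0 < de -> 0 < cutoff psi x1 t1 de x t ->
  psi x < psi x1 + de /\ Rabs (t - t1) < de /\ cutoff psi x1 t1 de x t <= 1 /\
  exp ((psi x - psi x1) / de) <= 2.
Proof.
  unfold cutoff; intros Hd Hp.
  pose proof (pow2_ge_0 ((t - t1) / de)); pose proof (exp_pos ((psi x - psi x1) / de)).
  split; [|split; [|split; lra]].
  - apply Rnot_le_lt; intros Hle.
    assert (1 <= (psi x - psi x1) / de) by (apply Rle_div_r; lra).
    pose proof (exp_ge_2 _ H1); lra.
  - apply Rnot_le_lt; intros Hle.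
    assert (1 <= Rabs ((t - t1) / de)).
    { unfold Rdiv; rewrite Rabs_mult, Rabs_inv, (Rabs_pos_eq de) by lra.
      apply Rle_div_r; lra. }
    rewrite sqr_Rabs in Hp; nra.
Qed.

Lemma cutoff_derive_x (psi psi1 psi2 : R -> R) (x1 t1 de x t : R) :
  de <> 0 -> (forall y, is_derive psi y (psi1 y)) -> (forall y, is_derive psi1 y (psi2 y)) ->
  is_derive (fun y => cutoff psi x1 t1 de y t) x
    (- / 2 * (exp ((psi x - psi x1) / de) * (psi1 x / de))) /\
  is_derive (fun y => - / 2 * (exp ((psi y - psi x1) / de) * (psi1 y / de))) x
    (- / 2 * (exp ((psi x - psi x1) / de) * ((psi1 x / de) ^ 2 + psi2 x / de))).
Proof.
  intros Hd D1 D2; unfold cutoff; split.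
  - auto_derive; [eexists; apply D1|].
    rewrite (is_derive_unique _ _ _ (D1 x) : Derive (fun z => psi z) x = psi1 x).
    unfold Rdiv, Rminus; field; exact Hd.
  - assert (E1 : ex_derive (fun z => psi z) x) by exact (ex_intro _ _ (D1 x)).
    assert (E2 : ex_derive (fun z => psi1 z) x) by exact (ex_intro _ _ (D2 x)).
    auto_derive; [tauto|].
    rewrite (is_derive_unique _ _ _ (D1 x) : Derive (fun z => psi z) x = psi1 x).
    rewrite (is_derive_unique _ _ _ (D2 x) : Derive (fun z => psi1 z) x = psi2 x).
    unfold Rdiv, Rminus; field; exact Hd.
Qed.

Lemma cutoff_derive_t (psi : R -> R) (x1 t1 de x t : R) :
  de <> 0 ->
  is_derive (fun s => cutoff psi x1 t1 de x s) t (- 2 * (t - t1) / de ^ 2) /\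
  is_derive (fun s => - 2 * (s - t1) / de ^ 2) t (- 2 / de ^ 2).
Proof.
  intros Hd; unfold cutoff; split; auto_derive; trivial; field; exact Hd.
Qed.

Lemma locally_ball_R (x : R) (P : R -> Prop) :
  locally x P -> exists e, 0 < e /\ forall y, Rabs (y - x) < e -> P y.
Proof.
  intros [e He]; exists e; split; [apply cond_pos|]; intros y Hy; apply He, Hy.
Qed.

Lemma locally_pos (g : R -> R) (x : R) :
  ex_derive g x -> 0 < g x -> locally x (fun y => 0 < g y).
Proof.
  intros H Hp; apply (ex_derive_continuous g x) in H.
  apply (H (fun r => 0 < r)); apply (open_gt 0 (g x) Hp).
Qed.

Lemma Rabs_le_mult_self (p q : R) : Rabs p <= q -> p * p <= q ^ 2.
Proof.
  intros H; replace (p * p) with (p ^ 2) by ring; rewrite sqr_Rabs.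
  apply pow_incr; split; [apply Rabs_pos|exact H].
Qed.

(** Here [k] is the factor in [K = k w^2] below. In units of [N^2 w^2] the three summands multiplied
    by [5] bound the contributions of [K], of [b1], and of [b2] apart from the supremum that it
    contains. For [s] their sum, [(1 + 5 s)^2 >= 5 s] replaces a square root. *)
Definition bconst (c A C1 : R) : R :=
  let k := 12 * C1 + 36 * A + c ^ 2 + 7 * c in
  1 + 5 * (k + (c + k * c ^ 2 + 2 * k * c) / 2 + (c ^ 2 + 2 * k * c + 1)).

Section Bernstein.
Variables (d x0 t0 : R) (V : R -> R -> R) (psi psi1 psi2 z : R -> R) (a : R -> R -> R)
  (A c C1 rho x1 t1 de N : R).
Hypothesis (SV : smooth_on_box d x0 t0 V)
  (Hbox : forall x t, Rabs (x - x0) <= rho -> Rabs (t - t1) <= de -> in_box d x0 t0 x t)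
  (D1 : forall x, is_derive psi x (psi1 x)) (D2 : forall x, is_derive psi1 x (psi2 x))
  (Hpsi : forall x, Rabs (x - x0) <= rho ->
     0 <= z x /\ psi1 x ^ 2 <= C1 * z x /\ Rabs (psi2 x) <= C1 * z x)
  (Hpsib : forall x, Rabs (x - x0) = rho -> psi x1 + de <= psi x)
  (Hc : 0 <= c) (HC1 : 0 <= C1) (HA : 1 <= A) (Hde : 0 < de <= 1) (Hrho : rho <= / 2) (HN : 0 < N)
  (Hx1 : Rabs (x1 - x0) <= rho)
  (Heq : forall x t, Rabs (x - x0) <= rho -> Rabs (t - t1) <= de -> psi x < psi x1 + de ->
     1 <= a x t <= A /\ Rabs (V x t) <= N /\
     Rabs (pderiv (true :: true :: nil) V x t + z x * a x t * pderiv (false :: false :: nil) V x t)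
       <= c * N + z x * c * (Rabs (dt V x t) * / de + N * (/ de) ^ 2) /\
     Rabs (pderiv (true :: true :: false :: nil) V x t
           + z x * a x t * pderiv (false :: false :: false :: nil) V x t)
       <= c * N * / de + z x * c * (Rabs (pderiv (false :: false :: nil) V x t) * / de
            + Rabs (dt V x t) * (/ de) ^ 2 + N * (/ de) ^ 3)).

Let phi := cutoff psi x1 t1 de.
Let w := / de.
Let k := 12 * C1 + 36 * A + c ^ 2 + 7 * c.
Let K := k * w ^ 2.
Let b1 := (c + k * c ^ 2 + 2 * k * c) / 2 * N ^ 2 * w ^ 4.

(* Truncations keep the test function continuous on the whole rectangle, while
   [V] is bounded by [N] only where [phi] is positive. *)
Let pos (r : R) := (r + Rabs r) / 2.
Let trunc (r : R) := (r + N * N - Rabs (r - N * N)) / 2.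
Let E (b2 x t : R) := pos (phi x t) * dt V x t * (pos (phi x t) * dt V x t)
   + K * trunc (V x t * V x t) + b1 * ((t - t1) * (t - t1)) + b2 * ((x - x0) * (x - x0)).

Lemma cutoff_continuity_2d (x t : R) : continuity_2d_pt phi x t.
Proof.
  apply (continuity_2d_pt_ext (fun x t => (1 - (t - t1) * (/ de) * ((t - t1) * / de))
     - / 2 * exp ((psi x - psi x1) / de))).
  { intros u v; unfold phi, cutoff; unfold Rdiv; ring. }
  assert (HT : continuity_2d_pt (fun _ v : R => (v - t1) * / de) x t).
  { apply continuity_2d_pt_mult; [|apply continuity_2d_pt_const].
    apply continuity_2d_pt_minus; [apply continuity_2d_pt_id2|apply continuity_2d_pt_const]. }
  apply continuity_2d_pt_minus.
  - apply continuity_2d_pt_minus; [apply continuity_2d_pt_const|].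
    apply (continuity_2d_pt_mult (fun u v => (v - t1) * / de) (fun u v => (v - t1) * / de));
      exact HT.
  - apply continuity_2d_pt_mult; [apply continuity_2d_pt_const|].
    apply (continuity_1d_2d_pt_comp (fun y => exp ((psi y - psi x1) / de)) (fun u _ => u));
      [|apply continuity_2d_pt_id1].
    apply derivable_continuous_pt, ex_derive_Reals_0.
    auto_derive; eexists; apply D1.
Qed.

Lemma trunc_continuity (r : R) : continuity_pt trunc r.
Proof. unfold trunc; reg. Qed.

Lemma pos_continuity (r : R) : continuity_pt pos r.
Proof. unfold pos; reg. Qed.

Lemma posv_continuity_2d (x t : R) : Rabs (x - x0) <= rho -> Rabs (t - t1) <= de ->
  continuity_2d_pt (fun x t => pos (phi x t) * dt V x t * (pos (phi x t) * dt V x t)) x t.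
Proof.
  intros Hx Ht.
  assert (C : continuity_2d_pt (fun x t => pos (phi x t) * dt V x t) x t).
  { apply continuity_2d_pt_mult.
    - apply (continuity_1d_2d_pt_comp pos phi); [apply pos_continuity|apply cutoff_continuity_2d].
    - apply (smooth_continuity_2d d x0 t0 V (false :: nil)); [exact SV|apply Hbox; assumption]. }
  apply continuity_2d_pt_mult; exact C.
Qed.

Lemma E_continuity_2d (b2 x t : R) : Rabs (x - x0) <= rho -> Rabs (t - t1) <= de ->
  continuity_2d_pt (E b2) x t.
Proof.
  intros Hx Ht; unfold E.
  assert (CV : continuity_2d_pt V x t).
  { apply (smooth_continuity_2d d x0 t0 V nil); [exact SV|apply Hbox; assumption]. }
  repeat apply continuity_2d_pt_plus.
  - apply posv_continuity_2d; assumption.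
  - apply continuity_2d_pt_mult; [apply continuity_2d_pt_const|].
    apply (continuity_1d_2d_pt_comp trunc (fun x t => V x t * V x t)); [apply trunc_continuity|].
    apply continuity_2d_pt_mult; exact CV.
  - apply continuity_2d_pt_mult; [apply continuity_2d_pt_const|].
    apply continuity_2d_pt_mult; apply continuity_2d_pt_minus;
      try apply continuity_2d_pt_id2; apply continuity_2d_pt_const.
  - apply continuity_2d_pt_mult; [apply continuity_2d_pt_const|].
    apply continuity_2d_pt_mult; apply continuity_2d_pt_minus;
      try apply continuity_2d_pt_id1; apply continuity_2d_pt_const.
Qed.

Lemma E_where_pos (b2 x t : R) : Rabs (x - x0) <= rho -> 0 < phi x t ->
  E b2 x t = (phi x t * dt V x t) ^ 2 + K * V x t ^ 2 + b1 * (t - t1) ^ 2 + b2 * (x - x0) ^ 2.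
Proof.
  intros Hx Hp; destruct (cutoff_pos psi x1 t1 de x t (proj1 Hde) Hp) as [Hps [Ht _]].
  destruct (Heq x t Hx ltac:(lra) Hps) as [_ [HV _]].
  unfold E, pos, trunc; rewrite (Rabs_pos_eq (phi x t)) by lra.
  rewrite (Rabs_left1 (V x t * V x t - N * N)).
  - field.
  - pose proof (sqr_Rabs (V x t)); pose proof (Rabs_pos (V x t)); nra.
Qed.

(** A point with [phi > 0] is interior: [psi] is too large on the sides [|x - x0| = rho], and
    [|t - t1| < de] by the form of the cutoff. Near it the truncations are inactive, so the second
    order conditions in [x] and [t] hold and contradict [bernstein_algebra]. *)
Lemma E_max_not_pos (P b2 x t : R) :
  (forall x t, Rabs (x - x0) <= rho -> Rabs (t - t1) <= de ->
     pos (phi x t) * dt V x t * (pos (phi x t) * dt V x t) <= P) ->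
  P + c ^ 2 * N ^ 2 * w ^ 2 + 2 * K * c * N ^ 2 < 2 * b2 ->
  Rabs (x - x0) <= rho -> Rabs (t - t1) <= de ->
  (forall x' t', Rabs (x' - x0) <= rho -> Rabs (t' - t1) <= de -> E b2 x' t' <= E b2 x t) ->
  phi x t <= 0.
Proof.
  intros HP Hb2 Hx Ht Hmax; apply Rnot_lt_le; intros Hp.
  assert (Hd0 : de <> 0) by lra.
  assert (Hw : 1 <= w) by (unfold w; rewrite <- Rinv_1; apply Rinv_le_contravar; lra).
  destruct (cutoff_pos psi x1 t1 de x t (proj1 Hde) Hp) as [Hps [Hts [Hphi1 Hexp]]].
  fold phi in Hphi1.
  assert (Hxs : Rabs (x - x0) < rho).
  { destruct Hx as [|Ex]; [assumption|]; specialize (Hpsib x Ex); lra. }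
  assert (Hb : in_box d x0 t0 x t) by (apply Hbox; assumption).
  pose proof (smooth_psmooth _ _ _ _ SV) as PV.
  pose proof (exp_pos ((psi x - psi x1) / de)) as Hexp0.
  destruct (locally_ball_R x (fun y => 0 < phi y t /\ Rabs (y - x0) < rho)) as [ex [Hex Hnx]].
  { apply filter_and; [|apply locally_Rabs_lt, Hxs].
    apply (locally_pos (fun y => phi y t)); [|exact Hp].
    destruct (cutoff_derive_x psi psi1 psi2 x1 t1 de x t Hd0 D1 D2) as [HD _].
    exact (ex_intro _ _ HD). }
  destruct (locally_ball_R t (fun s => 0 < phi x s /\ Rabs (s - t1) < de)) as [et [Het Hnt]].
  { apply filter_and; [|apply locally_Rabs_lt, Hts].
    apply (locally_pos (fun s => phi x s)); [|exact Hp].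
    destruct (cutoff_derive_t psi x1 t1 de x t Hd0) as [HD _].
    exact (ex_intro _ _ HD). }
  assert (HX := test_function_at_max (fun y => phi y t)
    (fun y => - / 2 * (exp ((psi y - psi x1) / de) * (psi1 y / de)))
    (fun y => pderiv (false :: nil) V y t) (fun y => pderiv (true :: false :: nil) V y t)
    (fun y => V y t) (fun y => pderiv (true :: nil) V y t)
    (- / 2 * (exp ((psi x - psi x1) / de) * ((psi1 x / de) ^ 2 + psi2 x / de)))
    (pderiv (true :: true :: false :: nil) V x t) (pderiv (true :: true :: nil) V x t)
    K b2 x0 (b1 * (t - t1) ^ 2) x ex Hex).
  assert (HT := test_function_at_max (fun s => phi x s)
    (fun s => - 2 * (s - t1) / de ^ 2)
    (fun s => pderiv (false :: nil) V x s) (fun s => pderiv (false :: false :: nil) V x s)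
    (fun s => V x s) (fun s => pderiv (false :: nil) V x s)
    (- 2 / de ^ 2)
    (pderiv (false :: false :: false :: nil) V x t) (pderiv (false :: false :: nil) V x t)
    K b1 t1 (b2 * (x - x0) ^ 2) t et Het).
  assert (HbX : forall y, Rabs (y - x) < ex -> in_box d x0 t0 y t).
  { intros y Hy; apply Hbox; [left; apply Hnx, Hy|lra]. }
  assert (HbT : forall s, Rabs (s - t) < et -> in_box d x0 t0 x s).
  { intros s Hs; apply Hbox; [lra|left; apply Hnt, Hs]. }
  cbv beta in HX, HT.
  specialize (HX (fun y _ => proj1 (cutoff_derive_x psi psi1 psi2 x1 t1 de y t Hd0 D1 D2))
    (proj2 (cutoff_derive_x psi psi1 psi2 x1 t1 de x t Hd0 D1 D2))
    (fun y Hy => proj1 (psmooth_is_derive d x0 t0 V (false :: nil) y t PV (HbX y Hy)))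
    (proj1 (psmooth_is_derive d x0 t0 V (true :: false :: nil) x t PV Hb))
    (fun y Hy => proj1 (psmooth_is_derive d x0 t0 V nil y t PV (HbX y Hy)))
    (proj1 (psmooth_is_derive d x0 t0 V (true :: nil) x t PV Hb))).
  specialize (HT (fun s _ => proj1 (cutoff_derive_t psi x1 t1 de x s Hd0))
    (proj2 (cutoff_derive_t psi x1 t1 de x t Hd0))
    (fun s Hs => proj2 (psmooth_is_derive d x0 t0 V (false :: nil) x s PV (HbT s Hs)))
    (proj2 (psmooth_is_derive d x0 t0 V (false :: false :: nil) x t PV Hb))
    (fun s Hs => proj2 (psmooth_is_derive d x0 t0 V nil x s PV (HbT s Hs)))
    (proj2 (psmooth_is_derive d x0 t0 V (false :: nil) x t PV Hb))).
  pose proof (E_where_pos b2 x t Hx Hp) as Ext.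
  assert (HX' := HX ltac:(intros y Hy; destruct (Hnx y Hy) as [Hpy Hxy];
    pose proof (E_where_pos b2 y t ltac:(lra) Hpy);
    pose proof (Hmax y t ltac:(lra) Ht); cbn [pderiv]; lra)).
  assert (HT' := HT ltac:(intros s Hs; destruct (Hnt s Hs) as [Hps' Hts'];
    pose proof (E_where_pos b2 x s Hx Hps');
    pose proof (Hmax x s Hx ltac:(lra)); cbn [pderiv]; lra)).
  destruct (Heq x t Hx Ht Hps) as [Ha [HV [HLV HLv]]].
  destruct (Hpsi x Hx) as [Hz [Hq1 Hq2]].
  set (e := exp ((psi x - psi x1) / de)) in *.
  assert (Hw2 : w <= w ^ 2) by nra.
  assert (HCz : 0 <= C1 * z x) by (apply Rmult_le_pos; assumption).
  refine (bernstein_algebra (z x) (a x t) A c C1 w N K P b1 b2 (phi x t) _ _ _ _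
    (pderiv (false :: nil) V x t) _ _ _ _ (V x t) _ _
    Hz (proj1 Ha) (proj2 Ha) Hc HC1 ltac:(lra) HN _ _ _ _ _ HV HLV HLv _ _ _ Hb2 HX' HT').
  - lra.
  - replace ((- / 2 * (e * (psi1 x / de))) ^ 2) with ((/ 4 * e ^ 2) * (psi1 x ^ 2 * w ^ 2))
      by (unfold w; field; lra).
    assert (e ^ 2 <= 4) by nra.
    pose proof (pow2_ge_0 e).
    assert (psi1 x ^ 2 * w ^ 2 <= C1 * z x * w ^ 2)
      by (apply Rmult_le_compat_r; [apply pow2_ge_0|assumption]).
    assert (0 <= psi1 x ^ 2 * w ^ 2) by nonneg.
    nra.
  - replace (- / 2 * (e * ((psi1 x / de) ^ 2 + psi2 x / de))) with
      ((- / 2 * e) * (psi1 x ^ 2 * w ^ 2 + psi2 x * w)) by (unfold w; field; lra).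
    replace (2 * C1 * z x * w ^ 2) with (1 * (C1 * z x * w ^ 2 + C1 * z x * w ^ 2)) by ring.
    apply Rabs_prod_le; [rewrite Rabs_left1; lra|].
    eapply Rle_trans; [apply Rabs_triang|]; apply Rplus_le_compat.
    + rewrite Rabs_pos_eq by nonneg; apply Rmult_le_compat_r; [nonneg|assumption].
    + rewrite Rabs_mult, (Rabs_pos_eq w) by lra.
      apply Rle_trans with (C1 * z x * w); [apply Rmult_le_compat_r; lra|].
      apply Rmult_le_compat_l; lra.
  - replace (- 2 * (t - t1) / de ^ 2) with ((- 2 * w) * ((t - t1) * w)) by (unfold w; field; lra).
    replace (2 * w) with (2 * w * 1) by ring.
    apply Rabs_prod_le; [rewrite Rabs_left1; lra|].
    rewrite Rabs_mult, (Rabs_pos_eq w) by lra; unfold w; apply Rle_div_l; lra.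
  - replace (- 2 / de ^ 2) with (- (2 * w ^ 2)) by (unfold w; field; lra).
    rewrite Rabs_Ropp, Rabs_pos_eq; [lra|nonneg].
  - specialize (HP x t Hx Ht); unfold pos in HP; rewrite (Rabs_pos_eq (phi x t)) in HP by lra.
    replace ((phi x t + phi x t) / 2) with (phi x t) in HP by field.
    change (pderiv (false :: nil) V x t) with (dt V x t); lra.
  - unfold K, k; reflexivity.
  - unfold b1, K; lra.
Qed.

Lemma bernstein : Rabs (dt V x1 t1) <= bconst c A C1 * (N * / de).
Proof.
  assert (Hw : 1 <= w) by (unfold w; rewrite <- Rinv_1; apply Rinv_le_contravar; lra).
  assert (Hrect : forall x t, x0 - rho <= x <= x0 + rho -> t1 - de <= t <= t1 + de ->
     Rabs (x - x0) <= rho /\ Rabs (t - t1) <= de).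
  { intros x t Hx Ht; split; apply Rabs_le; lra. }
  assert (Hrho0 : 0 <= rho) by (pose proof (Rabs_pos (x1 - x0)); lra).
  destruct (continuity_2d_rect_max
    (fun x t => pos (phi x t) * dt V x t * (pos (phi x t) * dt V x t))
    (x0 - rho) (x0 + rho) (t1 - de) (t1 + de)) as [xp [tp [Hxp [Htp HP]]]]; try lra.
  { intros x t Hx Ht; apply posv_continuity_2d; apply (Hrect x t Hx Ht). }
  set (P := pos (phi xp tp) * dt V xp tp * (pos (phi xp tp) * dt V xp tp)) in *.
  (* [b2] contains the supremum [P] that is to be estimated, because the term [(f v)^2] carries no
     factor [z]. As [rho <= 1/2], [b2 (x - x0)^2 <= b2 / 4], so [P] comes back only with the factor
     [1/8]. The summand [1] makes the required inequality strict. *)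
  set (b2 := (P + (c ^ 2 + 2 * k * c + 1) * N ^ 2 * w ^ 2) / 2).
  destruct (continuity_2d_rect_max (E b2)
    (x0 - rho) (x0 + rho) (t1 - de) (t1 + de)) as [xm [tm [Hxm [Htm HM]]]]; try lra.
  { intros x t Hx Ht; apply E_continuity_2d; apply (Hrect x t Hx Ht). }
  assert (Hrect' : forall x t, Rabs (x - x0) <= rho -> Rabs (t - t1) <= de ->
     x0 - rho <= x <= x0 + rho /\ t1 - de <= t <= t1 + de).
  { intros x t Hx Ht; apply Rabs_le_between in Hx, Ht; lra. }
  assert (HNw : 0 < N ^ 2 * w ^ 2) by (apply Rmult_lt_0_compat; apply pow_lt; lra).
  assert (Hphim : phi xm tm <= 0).
  { apply (E_max_not_pos P b2); try (apply (Hrect xm tm Hxm Htm)).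
    - intros x t Hx Ht; apply HP; apply (Hrect' x t Hx Ht).
    - unfold b2, K; lra.
    - intros x t Hx Ht; apply HM; apply (Hrect' x t Hx Ht). }
  assert (Hk : 0 <= k) by (unfold k; nonneg).
  assert (HK : 0 <= K) by (unfold K; nonneg).
  assert (HPp : P <= E b2 xp tp).
  { unfold E; fold P.
    assert (0 <= trunc (V xp tp * V xp tp)).
    { unfold trunc, Rabs; destruct Rcase_abs; nra. }
    assert (0 <= K * trunc (V xp tp * V xp tp)) by nonneg.
    assert (0 <= b1) by (unfold b1; nonneg).
    assert (0 <= b1 * ((tp - t1) * (tp - t1))) by (apply Rmult_le_pos; [assumption|apply Rle_0_sqr]).
    assert (0 <= P) by (unfold P; apply Rle_0_sqr).
    assert (0 <= c ^ 2 + 2 * k * c + 1) by nonneg.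
    assert (0 <= b2) by (unfold b2; assert (0 <= (c ^ 2 + 2 * k * c + 1) * N ^ 2 * w ^ 2) by nonneg; lra).
    assert (0 <= b2 * ((xp - x0) * (xp - x0))) by (apply Rmult_le_pos; [assumption|apply Rle_0_sqr]).
    lra. }
  assert (HEm : E b2 xm tm <= K * N ^ 2 + b1 * de ^ 2 + b2 * / 4).
  { unfold E, pos; rewrite (Rabs_left1 (phi xm tm)) by exact Hphim.
    replace ((phi xm tm + - phi xm tm) / 2) with 0 by field.
    assert (trunc (V xm tm * V xm tm) <= N ^ 2).
    { unfold trunc, Rabs; destruct Rcase_abs; nra. }
    assert (K * trunc (V xm tm * V xm tm) <= K * N ^ 2) by (apply Rmult_le_compat_l; assumption).
    assert (0 <= b1) by (unfold b1; nonneg).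
    assert (b1 * ((tm - t1) * (tm - t1)) <= b1 * de ^ 2)
      by (apply Rmult_le_compat_l; [assumption|apply Rabs_le_mult_self, (Hrect xm tm Hxm Htm)]).
    assert (0 <= P) by (unfold P; apply Rle_0_sqr).
    assert (0 <= c ^ 2 + 2 * k * c + 1) by nonneg.
    assert (0 <= b2) by (unfold b2; assert (0 <= (c ^ 2 + 2 * k * c + 1) * N ^ 2 * w ^ 2) by nonneg; lra).
    assert (b2 * ((xm - x0) * (xm - x0)) <= b2 * / 4).
    { apply Rmult_le_compat_l; [assumption|].
      replace (/ 4) with ((/ 2) ^ 2) by field; apply Rabs_le_mult_self.
      destruct (Hrect xm tm Hxm Htm); lra. }
    lra. }
  specialize (HM xp tp Hxp Htp).
  assert (Hb1d : b1 * de ^ 2 = (c + k * c ^ 2 + 2 * k * c) / 2 * (N ^ 2 * w ^ 2)).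
  { unfold b1, w; field; lra. }
  rewrite Hb1d in HEm.
  assert (HP1 := HP x1 t1 ltac:(apply Rabs_le_between in Hx1; lra) ltac:(lra)).
  assert (Hphi1 : pos (phi x1 t1) = / 2).
  { assert (Ep : phi x1 t1 = / 2).
    { unfold phi, cutoff; rewrite !Rminus_diag; unfold Rdiv; rewrite !Rmult_0_l, exp_0; field. }
    unfold pos; rewrite Ep, Rabs_pos_eq; lra. }
  rewrite Hphi1 in HP1.
  set (s := k + (c + k * c ^ 2 + 2 * k * c) / 2 + (c ^ 2 + 2 * k * c + 1)).
  assert (Hs : 0 <= s) by (unfold s; nonneg).
  (* Moving [P / 8] to the left produces [8/7]. Since [phi = 1/2] at [(x1, t1)], the square of the
     derivative there is at most [4 P], and [32/7 <= 5]. *)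
  assert (HPs : P <= (8 / 7) * s * (N ^ 2 * w ^ 2)).
  { unfold s, b2, K in *.
    assert (0 <= (c ^ 2 + 2 * k * c + 1) * (N ^ 2 * w ^ 2)) by nonneg; lra. }
  unfold bconst; fold k; fold s; fold w.
  assert (Hv : Rabs (dt V x1 t1) ^ 2 <= ((1 + 5 * s) * (N * w)) ^ 2).
  { assert (0 <= s * (N ^ 2 * w ^ 2)) by (apply Rmult_le_pos; lra).
    rewrite <- sqr_Rabs; apply Rle_trans with (5 * s * (N ^ 2 * w ^ 2)); [lra|].
    replace (((1 + 5 * s) * (N * w)) ^ 2) with ((1 + 5 * s) ^ 2 * (N ^ 2 * w ^ 2)) by ring.
    apply Rmult_le_compat_r; [lra|].
    generalize Hs; generalize s; clear; intros s Hs; nra. }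
  apply Rsqr_incr_0.
  - rewrite !Rsqr_pow2; exact Hv.
  - apply Rabs_pos.
  - apply Rmult_le_pos; [lra|apply Rmult_le_pos; lra].
Qed.
End Bernstein.

Lemma smooth_pderiv (d x0 t0 : R) (g : R -> R -> R) (l : list bool) :
  smooth_on_box d x0 t0 g -> smooth_on_box d x0 t0 (pderiv l g).
Proof. intros H l' x t Hb; rewrite <- pderiv_app; apply H, Hb. Qed.

Lemma in_box_locally_2d (d x0 t0 x t : R) :
  in_box d x0 t0 x t -> locally_2d (fun u v => in_box d x0 t0 u v) x t.
Proof.
  intros [Hx Ht].
  destruct (locally_ball_R _ _ (locally_Rabs_lt _ _ _ Hx)) as [e1 [He1 H1]].
  destruct (locally_ball_R _ _ (locally_Rabs_lt _ _ _ Ht)) as [e2 [He2 H2]].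
  assert (He : 0 < Rmin e1 e2) by (apply Rmin_glb_lt; assumption).
  exists (mkposreal _ He); intros y s Hy Hs; simpl in *.
  pose proof (Rmin_l e1 e2); pose proof (Rmin_r e1 e2).
  split; [apply H1|apply H2]; lra.
Qed.

Lemma pderiv_dx_dt (d x0 t0 : R) (g : R -> R -> R) (x t : R) :
  smooth_on_box d x0 t0 g -> in_box d x0 t0 x t ->
  dx (dt g) x t = dt (dx g) x t.
Proof.
  intros Sg Hb; unfold dx, dt.
  pose proof (smooth_psmooth _ _ _ _ Sg) as P.
  apply (Schwarz g x t).
  - destruct (in_box_locally_2d _ _ _ _ _ Hb) as [e He]; exists e; intros u v Hu Hv.
    specialize (He u v Hu Hv).
    split; [apply (P nil u v He)|split; [apply (P nil u v He)|split]].
    + apply (P (false :: nil) u v He).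
    + apply (P (true :: nil) u v He).
  - apply (smooth_continuity_2d d x0 t0 g (true :: false :: nil)); assumption.
  - apply (smooth_continuity_2d d x0 t0 g (false :: true :: nil)); assumption.
Qed.

Lemma pderiv_perm (d x0 t0 : R) (g : R -> R -> R) (l l' : list bool) :
  smooth_on_box d x0 t0 g -> Permutation l l' ->
  forall x t, in_box d x0 t0 x t -> pderiv l g x t = pderiv l' g x t.
Proof.
  intros Sg HP; induction HP as [|b l l' HP IH|b1 b2 l|l l' l'' H1 IH1 H2 IH2]; intros x t Hb.
  - reflexivity.
  - apply (pderiv_ext d x0 t0 (pderiv l g) (pderiv l' g) IH (b :: nil) x t Hb).
  - pose proof (smooth_pderiv d x0 t0 g l Sg) as Sl.
    destruct b1, b2; try reflexivity; cbn [pderiv];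
      [symmetry|]; apply (pderiv_dx_dt d x0 t0 (pderiv l g)); assumption.
  - rewrite IH1 by exact Hb; apply IH2, Hb.
Qed.

(** This is why the degenerate factor survives differentiation in [t]. No regularity is required, as
    [Derive_scal] is unconditional. *)
Lemma pderiv_t_scal (z : R -> R) (g : R -> R -> R) (n : nat) (x t : R) :
  pderiv (repeat false n) (fun x t => z x * g x t) x t = z x * pderiv (repeat false n) g x t.
Proof.
  revert x t; induction n as [|n IH]; intros x t; [reflexivity|].
  simpl; unfold dt at 1; rewrite (Derive_ext _ (fun s => z x * pderiv (repeat false n) g x s))
    by (intros s; apply IH).
  apply Derive_scal.
Qed.

Lemma psmooth_pow_x (d x0 t0 : R) (n : nat) : psmooth d x0 t0 (fun x _ => x ^ n).
Proof.
  induction n as [|n IH]; cbn [pow]; [apply pderiv_const|].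
  apply (psmooth_mult d x0 t0 (fun x _ => x) (fun x _ => x ^ n)); [|exact IH].
  apply (psmooth_ext d x0 t0 (fun x t => 1 * x + 0 * t + 0)); [intros; ring|apply pderiv_affine].
Qed.

Lemma pow_one_sub_ge (y : R) (n : nat) : 0 <= y <= 1 -> 1 - INR n * y <= (1 - y) ^ n.
Proof.
  intros Hy; induction n as [|n IH]; [simpl; lra|].
  rewrite S_INR; cbn [pow]; pose proof (pos_INR n).
  apply Rle_trans with ((1 - y) * (1 - INR n * y)); [nra|].
  apply Rmult_le_compat_l; lra.
Qed.

Lemma INR_S_le_pow2 (n : nat) : INR (S n) <= 2 ^ n.
Proof.
  induction n as [|n IH]; [simpl; lra|].
  rewrite S_INR; cbn [pow]; assert (1 <= 2 ^ n) by (apply pow_R1_Rle; lra); lra.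
Qed.

(** * The quasilinear equation *)

(** The threshold [32 / G] is the inverse of [G * wt 1]: it lets a first derivative of modulus at
    most [1] fit. *)
Lemma majorized_affine (d x0 t0 al : R) (mu : nat -> R) (x t : R) (J I : nat) (G a b c : R) :
  in_box d x0 t0 x t -> 1 <= al -> (forall n, 0 <= mu n) -> 1 <= mu 0%nat ->
  0 < G -> 32 / G <= mu 1%nat ->
  Rabs a <= 1 -> Rabs b <= 1 -> Rabs (a * x + b * t + c) <= G / 8 ->
  majorized al mu J I 0 G (fun x t => a * x + b * t + c) x t.
Proof.
  intros Hb Hal Hmu H0 HG H1 Ha Hb1 Hv l _ _.
  rewrite (proj2 (pderiv_affine d x0 t0 c a b) l x t Hb).
  assert (H32 : 1 <= G * (mu 1%nat * / 32)).
  { apply (Rmult_le_compat_l (G * / 32)) in H1; [|lra].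
    replace (G * / 32 * (32 / G)) with 1 in H1 by (field; lra); lra. }
  assert (Hz : 0 <= G * al ^ nx l * (mu (length l + 0)%nat * wt (length l + 0))).
  { apply (majorized_bound_nonneg al mu Hal Hmu); lra. }
  destruct l as [|[|] [|b2 l]]; try (rewrite Rabs_R0; exact Hz).
  - simpl; rewrite wt_0; nra.
  - change (nx (true :: nil)) with 1%nat; cbn [length Nat.add]; rewrite wt_1, pow_1.
    apply Rle_trans with (G * (mu 1%nat * / 32)); [lra|]; nra.
  - change (nx (false :: nil)) with O; cbn [length Nat.add]; rewrite wt_1; simpl; lra.
Qed.

Lemma nx_0_repeat (l : list bool) : nx l = O -> l = repeat false (length l).
Proof.
  induction l as [|[|] l IH]; intros H; [reflexivity|discriminate|].
  simpl; rewrite <- IH; [reflexivity|exact H].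
Qed.

Lemma nx_repeat_false (n : nat) : nx (repeat false n) = O.
Proof. induction n as [|n IH]; [reflexivity|exact IH]. Qed.

(* [HH] and [HF] are the conclusions of [majorized_compose3] for [H = h(x,t,u)] and
   for [f]. *)
Section Equation.
Variables (r : nat) (d x0 t0 w0 G CH CF : R) (u H f : R -> R -> R).
Let W (x t : R) := u x t - w0.
Hypothesis (Su : smooth_on_box d x0 t0 u) (SH : psmooth d x0 t0 H) (Sf : psmooth d x0 t0 f)
  (HG : 0 < G) (HCH : 0 <= CH) (HCF : 0 <= CF)
  (HW : forall x t, in_box d x0 t0 x t -> Rabs (W x t) <= G / 8)
  (HH : forall al mu K J I x t, in_box d x0 t0 x t -> 1 <= al -> (forall n, 0 <= mu n) ->
    1 <= mu 0%nat -> 32 / G <= mu 1%nat ->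
    (forall i j, (i + j <= K)%nat -> mu i * mu j <= mu (i + j)%nat) -> (J <= K)%nat ->
    majorized al mu J I 0 G W x t -> majorized al mu J I 0 CH H x t)
  (HF : forall al mu K J I x t, in_box d x0 t0 x t -> 1 <= al -> (forall n, 0 <= mu n) ->
    1 <= mu 0%nat -> 32 / G <= mu 1%nat ->
    (forall i j, (i + j <= K)%nat -> mu i * mu j <= mu (i + j)%nat) -> (J <= K)%nat ->
    majorized al mu J I 0 CF f x t)
  (Heqn : forall x t, in_box d x0 t0 x t ->
    dx (dx u) x t = - f x t
      - x ^ r * x ^ r * (dt (dt u) x t + H x t * dt (fun x t => H x t * dt u x t) x t)).

(** With these notations the equation reads [u_xx = - f - x^(2r) E]. *)
Let Q (x t : R) := H x t * dt u x t.
Let E (x t : R) := dt (dt u) x t + H x t * dt Q x t.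
Let D (k : nat) := pderiv (repeat false k) u.

Lemma psmooth_u : psmooth d x0 t0 u.
Proof. exact (smooth_psmooth _ _ _ _ Su). Qed.

Lemma pderiv_W (l : list bool) (x t : R) : in_box d x0 t0 x t ->
  pderiv l W x t = match l with nil => W x t | _ => pderiv l u x t end.
Proof. apply (pderiv_sub_const d x0 t0 w0 u psmooth_u). Qed.

Lemma psmooth_W : psmooth d x0 t0 W.
Proof. apply (pderiv_sub_const d x0 t0 w0 u psmooth_u). Qed.

Lemma psmooth_Q : psmooth d x0 t0 Q.
Proof. apply psmooth_mult; [exact SH|apply (psmooth_pderiv d x0 t0 u (false :: nil) psmooth_u)]. Qed.

Lemma psmooth_dtQ : psmooth d x0 t0 (dt Q).
Proof. apply (psmooth_pderiv d x0 t0 Q (false :: nil) psmooth_Q). Qed.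

Lemma psmooth_E : psmooth d x0 t0 E.
Proof.
  apply (pderiv_plus d x0 t0 (dt (dt u)) (fun x t => H x t * dt Q x t)).
  - apply (psmooth_pderiv d x0 t0 u (false :: false :: nil) psmooth_u).
  - apply psmooth_mult; [exact SH|exact psmooth_dtQ].
Qed.

Lemma pderiv_E (l : list bool) (x t : R) : in_box d x0 t0 x t ->
  pderiv l E x t = pderiv l (dt (dt u)) x t + pderiv l (fun x t => H x t * dt Q x t) x t.
Proof.
  apply (pderiv_plus d x0 t0 (dt (dt u)) (fun x t => H x t * dt Q x t)).
  - apply (psmooth_pderiv d x0 t0 u (false :: false :: nil) psmooth_u).
  - apply psmooth_mult; [exact SH|exact psmooth_dtQ].
Qed.

Lemma majorized_dt_u (al : R) (mu : nat -> R) (J I s : nat) (C x t : R) :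
  in_box d x0 t0 x t ->
  majorized al mu (S J) I s C W x t -> majorized al mu J I (s + 1) C (dt u) x t.
Proof.
  intros Hb HN.
  apply (majorized_ext d x0 t0 al mu x t Hb J I (s + 1) C (pderiv (false :: nil) W)).
  - intros x' t' Hb'; apply (pderiv_W (false :: nil) x' t' Hb').
  - apply (majorized_pderiv al mu x t J I s C W (false :: nil)); [reflexivity|].
    rewrite Nat.add_1_r; exact HN.
Qed.

Section Weights.
Variables (k : nat) (B M x t : R).
Hypothesis (Hk : (3 <= k)%nat) (HB1 : 1 <= B) (HBG : 32 / G <= B) (HM : 1 <= M)
  (Hb : in_box d x0 t0 x t)
  (Hlow : forall j, (j < k)%nat ->
    Rabs (pderiv (repeat false j) W x t) <= G * B ^ j * wt j * M ^ (j - 3)).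

(* [Lam] is chosen so that the derivatives of order [k] and [k + 1] at the given
   point are majorized; below order [k] the weights are those of the induction
   hypothesis.  The truncated exponent [j - 3] keeps [mu] submultiplicative up to
   order [k + 2] although only [M ^ (k - 4)] is available there. *)
Let Lam := M ^ (k - 4) + Rabs (D k x t) / (G * B ^ k * wt k)
  + Rabs (D (S k) x t) / (G * B ^ S k * wt (S k)).
Let mu (j : nat) := B ^ j * (if (j <? k)%nat then M ^ (j - 3) else Lam).

Lemma GBwt_pos (j : nat) : 0 < G * B ^ j * wt j.
Proof.
  pose proof (wt_pos j); assert (0 < B ^ j) by (apply pow_lt; lra).
  repeat apply Rmult_lt_0_compat; lra.
Qed.

Lemma Lam_ge : M ^ (k - 4) <= Lam.
Proof.
  unfold Lam; pose proof (GBwt_pos k); pose proof (GBwt_pos (S k)).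
  assert (0 <= Rabs (D k x t) / (G * B ^ k * wt k))
    by (apply Rdiv_le_0_compat; [apply Rabs_pos|assumption]).
  assert (0 <= Rabs (D (S k) x t) / (G * B ^ S k * wt (S k)))
    by (apply Rdiv_le_0_compat; [apply Rabs_pos|assumption]).
  lra.
Qed.

Lemma Lam_ge_1 : 1 <= Lam.
Proof. eapply Rle_trans; [|exact Lam_ge]; apply pow_R1_Rle, HM. Qed.

Lemma mu_nonneg (n : nat) : 0 <= mu n.
Proof.
  unfold mu; pose proof Lam_ge_1; assert (0 < B ^ n) by (apply pow_lt; lra).
  assert (0 < M ^ (n - 3)) by (apply pow_lt; lra).
  destruct (n <? k)%nat; apply Rmult_le_pos; lra.
Qed.

(** The offset [3] is forced. For [i, j < k] with [i + j] up to [k + 2], the truncated exponents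
    must add up to at most [k - 4], the exponent at order [k - 1]; with offset [s] this asks
    [k + 2 - 2 s <= k - 1 - s]. If one index is at least [k], the other is at most [2] and its
    exponent is zero. *)
Lemma mu_submult (i j : nat) : (i + j <= k + 2)%nat -> mu i * mu j <= mu (i + j)%nat.
Proof.
  intros Hij; unfold mu.
  rewrite pow_add; pose proof Lam_ge as HL; pose proof Lam_ge_1 as HL1.
  assert (Bi : 0 < B ^ i) by (apply pow_lt; lra).
  assert (Bj : 0 < B ^ j) by (apply pow_lt; lra).
  set (wi := if (i <? k)%nat then M ^ (i - 3) else Lam).
  set (wj := if (j <? k)%nat then M ^ (j - 3) else Lam).
  replace (B ^ i * wi * (B ^ j * wj)) with (B ^ i * B ^ j * (wi * wj)) by ring.
  apply Rmult_le_compat_l; [left; apply Rmult_lt_0_compat; assumption|].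
  unfold wi, wj.
  destruct (Nat.ltb_spec i k); destruct (Nat.ltb_spec j k); destruct (Nat.ltb_spec (i + j) k);
    try lia.
  - rewrite <- pow_add; apply Rle_pow; [exact HM|lia].
  - rewrite <- pow_add; eapply Rle_trans; [|exact HL]; apply Rle_pow; [exact HM|lia].
  - replace (i - 3)%nat with O by lia; simpl; lra.
  - replace (j - 3)%nat with O by lia; simpl; lra.
Qed.

Lemma majorized_W_weights : majorized 1 mu (S k) 0 0 G W x t.
Proof.
  intros l Hl Hn; rewrite (nx_0_repeat l) by lia; rewrite repeat_length.
  rewrite pow1, Rmult_1_r, Nat.add_0_r.
  pose proof (Rabs_pos (D k x t)); pose proof (Rabs_pos (D (S k) x t)).
  assert (HM4 : 0 < M ^ (k - 4)) by (apply pow_lt; lra).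
  pose proof (GBwt_pos k) as P1; pose proof (GBwt_pos (S k)) as P2.
  assert (0 <= Rabs (D k x t) / (G * B ^ k * wt k)) by (apply Rdiv_le_0_compat; assumption).
  assert (0 <= Rabs (D (S k) x t) / (G * B ^ S k * wt (S k))) by (apply Rdiv_le_0_compat; assumption).
  set (n := length l) in *; unfold mu.
  replace (G * (B ^ n * (if (n <? k)%nat then M ^ (n - 3) else Lam) * wt n)) with
    (G * B ^ n * wt n * (if (n <? k)%nat then M ^ (n - 3) else Lam)) by ring.
  destruct (Nat.ltb_spec n k) as [Hlt|Hge].
  - apply Hlow, Hlt.
  - rewrite pderiv_W by exact Hb.
    assert (En : n = k \/ n = S k) by lia; destruct En as [-> | ->].
    + destruct k as [|k']; [lia|].
      change (match repeat false (S k') with nil => W x t | _ => pderiv (repeat false (S k')) u x t end)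
        with (D (S k') x t).
      apply Rle_trans with (G * B ^ S k' * wt (S k') * (Rabs (D (S k') x t) / (G * B ^ S k' * wt (S k')))).
      * right; field; pose proof (wt_pos (S k')); repeat split; try lra; apply pow_nonzero; lra.
      * apply Rmult_le_compat_l; [lra|unfold Lam; lra].
    + change (match repeat false (S k) with nil => W x t | _ => pderiv (repeat false (S k)) u x t end)
        with (D (S k) x t).
      apply Rle_trans with (G * B ^ S k * wt (S k) * (Rabs (D (S k) x t) / (G * B ^ S k * wt (S k)))).
      * right; field; pose proof (wt_pos (S k)); repeat split; try lra; apply pow_nonzero; lra.
      * apply Rmult_le_compat_l; [lra|unfold Lam; lra].
Qed.

Lemma D_repeat_app (n : nat) (g : R -> R -> R) :
  pderiv (repeat false n) (dt g) = pderiv (repeat false (S n)) g.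
Proof.
  change (repeat false (S n)) with (false :: repeat false n).
  rewrite repeat_cons, pderiv_app; reflexivity.
Qed.

(** The commutator bound is used twice, for [H] against [dt Q] and for [H] against [dt u].
    Extracting [H] both times leaves [(1 + H^2)] on the top derivative, and the remainder uses
    derivatives of [W] of order at most [k + 1], the range of [majorized_W_weights]. *)
Lemma pderiv_E_commutator_mu :
  Rabs (pderiv (repeat false k) E x t - (1 + H x t ^ 2) * D (S (S k)) x t)
  <= (2 * CH ^ 2 * G) * (mu (k + 2)%nat * wt (k + 2)).
Proof.
  pose proof mu_nonneg as Hmu; pose proof mu_submult as Hsub.
  assert (H1 : 1 <= 1) by lra.
  assert (Hmu0 : mu 0%nat = 1).
  { unfold mu; destruct (Nat.ltb_spec 0 k); [simpl; ring|lia]. }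
  assert (Hmu1 : mu 1%nat = B).
  { unfold mu; destruct (Nat.ltb_spec 1 k); [simpl; ring|lia]. }
  assert (NW := majorized_W_weights).
  assert (NH : majorized 1 mu (S k) 0 0 CH H x t).
  { apply (HH 1 mu (k + 2)%nat); try assumption; try lra; try lia. }
  assert (Nt : majorized 1 mu k 0 1 G (dt u) x t) by (apply (majorized_dt_u 1 mu k 0 0 G x t Hb NW)).
  pose proof (psmooth_pderiv d x0 t0 u (false :: nil) psmooth_u) as St.
  assert (NQ : majorized 1 mu k 0 1 (CH * G) Q x t).
  { apply (majorized_mult d x0 t0 1 mu (k + 2) x t Hb H1 Hmu Hsub k 0 0 1 CH G H (dt u));
      try assumption; try lra; try lia.
    apply (majorized_weaken 1 mu x t H1 Hmu (S k) k 0 0 0 CH CH H); try lia; try lra; assumption. }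
  assert (NdQ : majorized 1 mu (k - 1) 0 2 (CH * G) (dt Q) x t).
  { apply (majorized_pderiv 1 mu x t (k - 1) 0 1 (CH * G) Q (false :: nil)); [reflexivity|].
    simpl length; replace (k - 1 + 1)%nat with k by lia; exact NQ. }
  assert (HCHG : 0 <= CH * G) by (apply Rmult_le_pos; lra).
  assert (C1 : Rabs (pderiv (repeat false k) (fun x t => H x t * dt Q x t) x t
      - H x t * pderiv (repeat false k) (dt Q) x t) <= CH * (CH * G) * (mu (k + 2)%nat * wt (k + 2))).
  { pose proof (majorized_mult_commutator d x0 t0 1 mu (k + 2) x t Hb H1 Hmu Hsub (k - 1) 0 0 2 CH (CH * G)
      H (dt Q) (repeat false k) SH psmooth_dtQ HCH HCHG) as HC.
    rewrite repeat_length, nx_repeat_false, Nat.add_0_r, pow_O, Rmult_1_r in HC.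
    apply HC; try lia; [|exact NdQ].
    apply (majorized_weaken 1 mu x t H1 Hmu (S k) k 0 0 0 CH CH H); try lia; try lra; assumption. }
  assert (C2 : Rabs (pderiv (repeat false (S k)) Q x t - H x t * pderiv (repeat false (S k)) (dt u) x t)
      <= CH * G * (mu (k + 2)%nat * wt (k + 2))).
  { pose proof (majorized_mult_commutator d x0 t0 1 mu (k + 2) x t Hb H1 Hmu Hsub k 0 0 1 CH G
      H (dt u) (repeat false (S k)) SH St HCH (Rlt_le _ _ HG)) as HC.
    rewrite repeat_length, nx_repeat_false, Nat.add_0_r, pow_O, Rmult_1_r in HC.
    replace (S k + 1)%nat with (k + 2)%nat in HC by lia.
    apply HC; try lia; assumption. }
  rewrite D_repeat_app in C1; rewrite D_repeat_app in C2.
  rewrite pderiv_E by exact Hb.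
  rewrite (D_repeat_app k (dt u)), (D_repeat_app (S k) u).
  fold (D (S (S k))).
  change (pderiv (repeat false (S (S k))) u) with (D (S (S k))) in C2.
  set (p1 := pderiv (repeat false k) (fun x t => H x t * dt Q x t) x t) in *.
  set (p2 := pderiv (repeat false (S k)) Q x t) in *.
  set (p3 := D (S (S k)) x t) in *.
  set (m := mu (k + 2)%nat * wt (k + 2)) in *.
  replace (p3 + p1 - (1 + H x t ^ 2) * p3) with ((p1 - H x t * p2) + H x t * (p2 - H x t * p3)) by ring.
  assert (HHb : Rabs (H x t) <= CH).
  { pose proof (NH nil (Nat.le_0_l _) (Nat.le_refl O)) as HN.
    simpl in HN; rewrite Hmu0, wt_0 in HN; lra. }
  assert (Hm : 0 <= m) by (unfold m; apply Rmult_le_pos; [apply Hmu|left; apply wt_pos]).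
  eapply Rle_trans; [apply Rabs_triang|].
  assert (C3 := Rabs_prod_le _ _ _ _ HHb C2).
  replace (2 * CH ^ 2 * G * m) with (CH * (CH * G) * m + CH * (CH * G * m)) by ring.
  lra.
Qed.

(** Expanding [Lam] exhibits the linear dependence on the top orders. The factors [k] and [k^2] are
    the ratios of [wt (k + 2)] to [wt (k + 1)] and to [wt k], at most [2 k] and [4 k^2]. *)
Lemma pderiv_E_commutator :
  Rabs (pderiv (repeat false k) E x t - (1 + H x t ^ 2) * D (S (S k)) x t)
  <= (2 * CH ^ 2 * G) * (4 * B ^ 2 + 4 * B ^ 2 / G + 2 * B / G) *
     (INR k * Rabs (D (S k) x t) + INR k ^ 2 * Rabs (D k x t)
      + INR k ^ 2 * (B ^ k * wt k * M ^ (k - 4))).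
Proof.
  eapply Rle_trans; [exact pderiv_E_commutator_mu|].
  assert (HC : 0 <= 2 * CH ^ 2 * G) by (pose proof (pow2_ge_0 CH); nonneg).
  rewrite (Rmult_assoc (2 * CH ^ 2 * G)); apply Rmult_le_compat_l; [exact HC|].
  unfold mu; destruct (Nat.ltb_spec (k + 2) k); [lia|].
  assert (Hk3 : 3 <= INR k) by (apply (le_INR 3 k) in Hk; simpl in Hk; lra).
  replace (k + 2)%nat with (S (S k)) by lia.
  pose proof (wt_S_le k) as W1; pose proof (wt_S_le (S k)) as W2.
  rewrite !S_INR in W2; rewrite S_INR in W1.
  pose proof (wt_pos k) as Wk; pose proof (wt_pos (S k)) as Wk1; pose proof (wt_pos (S (S k))) as Wk2.
  assert (V1 : wt (S (S k)) <= 2 * INR k * wt (S k)).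
  { eapply Rle_trans; [exact W2|]; apply Rmult_le_compat_r; lra. }
  assert (V0 : wt (S (S k)) <= 4 * INR k ^ 2 * wt k).
  { eapply Rle_trans; [exact V1|].
    replace (4 * INR k ^ 2 * wt k) with (2 * INR k * (2 * INR k * wt k)) by ring.
    apply Rmult_le_compat_l; [lra|]; eapply Rle_trans; [exact W1|].
    apply Rmult_le_compat_r; lra. }
  assert (HBk : 0 < B ^ k) by (apply pow_lt; lra).
  assert (HMk : 0 < M ^ (k - 4)) by (apply pow_lt; lra).
  set (v := Rabs (D k x t)) in *; set (vt := Rabs (D (S k) x t)) in *.
  assert (Hv : 0 <= v) by apply Rabs_pos; assert (Hvt : 0 <= vt) by apply Rabs_pos.
  assert (HG' : 0 < / G) by (apply Rinv_0_lt_compat; exact HG).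
  assert (T1 : B ^ S (S k) * M ^ (k - 4) * wt (S (S k)) <=
    4 * B ^ 2 * (INR k ^ 2 * (B ^ k * wt k * M ^ (k - 4)))).
  { replace (4 * B ^ 2 * (INR k ^ 2 * (B ^ k * wt k * M ^ (k - 4)))) with
      (B ^ S (S k) * M ^ (k - 4) * (4 * INR k ^ 2 * wt k)) by (simpl; ring).
    apply Rmult_le_compat_l; [|exact V0].
    apply Rmult_le_pos; [apply pow_le; lra|lra]. }
  assert (T2 : B ^ S (S k) * (v / (G * B ^ k * wt k)) * wt (S (S k)) <=
    4 * B ^ 2 / G * (INR k ^ 2 * v)).
  { replace (B ^ S (S k) * (v / (G * B ^ k * wt k)) * wt (S (S k))) with
      (B ^ 2 * v * / G * / wt k * wt (S (S k))) by (simpl; field; lra).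
    replace (4 * B ^ 2 / G * (INR k ^ 2 * v)) with
      (B ^ 2 * v * / G * / wt k * (4 * INR k ^ 2 * wt k)) by (field; lra).
    apply Rmult_le_compat_l; [|exact V0].
    assert (0 < / wt k) by (apply Rinv_0_lt_compat; exact Wk); nonneg. }
  assert (T3 : B ^ S (S k) * (vt / (G * B ^ S k * wt (S k))) * wt (S (S k)) <=
    2 * B / G * (INR k * vt)).
  { replace (B ^ S (S k) * (vt / (G * B ^ S k * wt (S k))) * wt (S (S k))) with
      (B * vt * / G * / wt (S k) * wt (S (S k))) by (simpl; field; lra).
    replace (2 * B / G * (INR k * vt)) with
      (B * vt * / G * / wt (S k) * (2 * INR k * wt (S k))) by (field; lra).
    apply Rmult_le_compat_l; [|exact V1].
    assert (0 < / wt (S k)) by (apply Rinv_0_lt_compat; exact Wk1); nonneg. }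
  unfold Lam; fold v; fold vt.
  set (S1 := INR k ^ 2 * (B ^ k * wt k * M ^ (k - 4))) in *.
  set (S2 := INR k ^ 2 * v) in *; set (S3 := INR k * vt) in *.
  assert (HS1 : 0 <= S1) by (unfold S1; nonneg).
  assert (HS2 : 0 <= S2) by (unfold S2; nonneg).
  assert (HS3 : 0 <= S3) by (unfold S3; nonneg).
  assert (HB2 : 0 <= 4 * B ^ 2) by nonneg.
  assert (HB2G : 0 <= 4 * B ^ 2 / G) by (apply Rmult_le_pos; lra).
  assert (HBG' : 0 <= 2 * B / G) by (apply Rmult_le_pos; lra).
  assert (0 <= 4 * B ^ 2 * S2) by nonneg; assert (0 <= 4 * B ^ 2 * S3) by nonneg.
  assert (0 <= 4 * B ^ 2 / G * S1) by nonneg; assert (0 <= 4 * B ^ 2 / G * S3) by nonneg.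
  assert (0 <= 2 * B / G * S1) by nonneg; assert (0 <= 2 * B / G * S2) by nonneg.
  lra.
Qed.
End Weights.

Lemma f_t_bound (B : R) (k : nat) (x t : R) : 1 <= B -> 32 / G <= B -> in_box d x0 t0 x t ->
  Rabs (pderiv (repeat false k) f x t) <= CF * (B ^ k * wt k).
Proof.
  intros HB1 HBG Hb.
  assert (N : majorized 1 (fun n => B ^ n) k 0 0 CF f x t).
  { apply (HF 1 _ k); try assumption; try lra; try lia.
    - intros n; apply pow_le; lra.
    - intros i j _; rewrite pow_add; lra. }
  specialize (N (repeat false k)); rewrite repeat_length, nx_repeat_false, Nat.add_0_r in N.
  simpl (1 ^ 0) in N; rewrite Rmult_1_r in N; apply N; lia.
Qed.

Lemma H_bound (x t : R) : in_box d x0 t0 x t -> Rabs (H x t) <= CH.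
Proof.
  intros Hb.
  (* Only order zero is wanted; the base [1 + 32 / G] just meets the condition on [mu 1]. *)
  assert (N : majorized 1 (fun n => (1 + 32 / G) ^ n) 0 0 0 CH H x t).
  { assert (0 < 32 / G) by (apply Rdiv_lt_0_compat; lra).
    apply (HH 1 _ 0%nat); try assumption; try lra; try lia.
    - intros n; apply pow_le; lra.
    - intros i j _; rewrite pow_add; lra.
    - intros [|b l] Hl _; [|simpl in Hl; lia].
      specialize (HW x t Hb); simpl; rewrite wt_0; lra. }
  specialize (N nil (Nat.le_refl _) (Nat.le_refl _)); simpl in N; rewrite wt_0 in N; lra.
Qed.

Lemma D_equation (k : nat) (x t : R) : in_box d x0 t0 x t ->
  pderiv (true :: true :: repeat false k) u x t
    = - pderiv (repeat false k) f x t - x ^ r * x ^ r * pderiv (repeat false k) E x t.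
Proof.
  intros Hb.
  assert (Hp : Permutation (true :: true :: repeat false k) (repeat false k ++ true :: true :: nil)).
  { apply (Permutation_app_comm (true :: true :: nil)). }
  rewrite (pderiv_perm d x0 t0 u _ _ Su Hp x t Hb), pderiv_app.
  rewrite (pderiv_ext d x0 t0 (pderiv (true :: true :: nil) u)
    (fun x t => -1 * f x t + - (x ^ r * x ^ r) * E x t)); [| |exact Hb].
  2:{ intros x' t' Hb'; simpl; rewrite (Heqn x' t' Hb'); unfold E, Q; ring. }
  assert (S1 : psmooth d x0 t0 (fun x t => -1 * f x t)).
  { apply (psmooth_mult d x0 t0 (fun _ _ => -1)); [apply pderiv_const|exact Sf]. }
  assert (S2 : psmooth d x0 t0 (fun x t => - (x ^ r * x ^ r) * E x t)).
  { apply (psmooth_mult d x0 t0 (fun x _ => - (x ^ r * x ^ r))); [|exact psmooth_E].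
    apply (psmooth_ext d x0 t0 (fun x t => -1 * (x ^ r * x ^ r))); [intros; ring|].
    apply (psmooth_mult d x0 t0 (fun _ _ => -1)); [apply pderiv_const|].
    apply (psmooth_mult d x0 t0 (fun x _ => x ^ r) (fun x _ => x ^ r)); apply psmooth_pow_x. }
  rewrite (proj2 (pderiv_plus d x0 t0 _ _ S1 S2) _ x t Hb).
  rewrite (pderiv_t_scal (fun _ => -1)), (pderiv_t_scal (fun x => - (x ^ r * x ^ r))).
  ring.
Qed.

(** * Factorial bounds for the [t]-derivatives on nested domains *)

Section PhaseOne.
Variables (rho T C1 B : R) (psi psi1 psi2 : R -> R).
Hypothesis (Hrd : rho < d) (Hrho : rho <= / 2) (HT : 0 < T <= rho) (HC1 : 0 <= C1)
  (D1 : forall x, is_derive psi x (psi1 x)) (D2 : forall x, is_derive psi1 x (psi2 x))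
  (Hpsi : forall x, Rabs (x - x0) <= rho ->
     0 <= x ^ r * x ^ r /\ psi1 x ^ 2 <= C1 * (x ^ r * x ^ r) /\ Rabs (psi2 x) <= C1 * (x ^ r * x ^ r))
  (Hpsib : forall x, Rabs (x - x0) = rho -> T <= psi x)
  (HB1 : 1 <= B) (HBG : 32 / G <= B)
  (Hbase : forall j x t, (j <= 3)%nat -> in_box d x0 t0 x t ->
     Rabs (pderiv (repeat false j) W x t) <= G * B ^ j * wt j).

(** [c] gathers the multiples of [cR] and [CF] occurring in the equations for [D k] and for its
    [t]-derivative, so that one constant, independent of [k], serves both. In [M], [16 = 2 * 4 * 2]:
    from [de = (T - s) / (2 n)], from [wt_S_ge], and from the change of level. *)
Let cR := (2 * CH ^ 2 * G) * (4 * B ^ 2 + 4 * B ^ 2 / G + 2 * B / G).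
Let c := cR * (1 + / G + B / G) + CF / G + CF * B / G.
Let M := 1 + 16 * bconst c (1 + CH ^ 2) C1.

Lemma cR_nonneg : 0 <= cR.
Proof.
  unfold cR; pose proof (Rinv_0_lt_compat G HG).
  unfold Rdiv; pose proof (pow2_ge_0 CH); nonneg.
Qed.

Lemma c_nonneg : 0 <= c.
Proof.
  unfold c; pose proof cR_nonneg; pose proof (Rinv_0_lt_compat G HG).
  unfold Rdiv; nonneg.
Qed.

Lemma bconst_nonneg (c' A C : R) : 0 <= c' -> 0 <= A -> 0 <= C -> 0 <= bconst c' A C.
Proof. intros; unfold bconst; nonneg. Qed.

Lemma M_ge_1 : 1 <= M.
Proof.
  unfold M; pose proof (bconst_nonneg c (1 + CH ^ 2) C1 c_nonneg) as Hb.
  pose proof (pow2_ge_0 CH); specialize (Hb ltac:(lra) HC1); lra.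
Qed.

(** The level [s] is universally quantified in the induction: order [k + 1] at level [s] follows
    from the orders up to [k] at the slightly larger level [s' = s + de]. The factor [M / (T - s)]
    gained per order pays for the Bernstein constant divided by [de]. *)
Lemma D_bound (k : nat) : forall s x t, s < T -> Rabs (x - x0) <= rho -> Rabs (t - t0) < s ->
  psi x < s -> Rabs (pderiv (repeat false k) W x t) <= G * B ^ k * wt k * (M / (T - s)) ^ (k - 3).
Proof.
  induction k as [k IH] using lt_wf_ind; intros s x1 t1 Hs Hx1 Ht1 Hps1.
  destruct (Nat.le_gt_cases k 3) as [Hk3|Hk4].
  { replace (k - 3)%nat with O by lia; rewrite pow_O, Rmult_1_r; apply Hbase; [exact Hk3|].
    split; lra. }
  destruct k as [|k]; [lia|].
  assert (Hk : (3 <= k)%nat) by lia.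
  assert (Hs0 : 0 < s) by (pose proof (Rabs_pos (t1 - t0)); lra).
  assert (HKn : 4 <= INR (S k)) by (apply (le_INR 4) in Hk4; simpl in Hk4 |- *; lra).
  set (n := INR (S k)) in *.
  (* A width proportional to [1/n] gives [n <= 1/de], so the powers of [k] in the commutators become
     powers of [w]; yet [T - s'] remains close to [T - s]. *)
  set (de := (T - s) / (2 * n)).
  assert (Hde0 : 0 < de) by (apply Rdiv_lt_0_compat; lra).
  assert (Hden : de * (2 * n) = T - s) by (unfold de; field; lra).
  assert (Hde1 : de <= 1) by nra.
  assert (Hnw : n <= / de).
  { apply (Rmult_le_reg_l de); [exact Hde0|]; rewrite Rinv_r by lra; nra. }
  set (s' := s + de).
  assert (HTs' : T - s' = (T - s) * (1 - / (2 * n))).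
  { unfold s', de; field; lra. }
  assert (Hn2 : 0 < / (2 * n) <= / 8).
  { split; [apply Rinv_0_lt_compat; lra|apply Rinv_le_contravar; lra]. }
  assert (Hs' : 0 < T - s') by (rewrite HTs'; apply Rmult_lt_0_compat; lra).
  set (M' := M / (T - s')).
  pose proof M_ge_1 as HM1.
  assert (HM' : 1 <= M').
  { unfold M'; apply Rle_div_r; [exact Hs'|]; unfold s' in *; lra. }
  set (N := G * B ^ k * wt k * M' ^ (k - 3)).
  assert (HBk : 0 < B ^ k) by (apply pow_lt; lra).
  pose proof (wt_pos k) as Hwk.
  assert (HMk : 0 < M' ^ (k - 3)) by (apply pow_lt; lra).
  assert (HN : 0 < N) by (unfold N; repeat apply Rmult_lt_0_compat; assumption).
  assert (HNG : B ^ k * wt k * M' ^ (k - 3) = N / G) by (unfold N; field; lra).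
  pose proof (Rinv_0_lt_compat G HG) as HGi.
  assert (HNG1 : B ^ k * wt k <= N / G).
  { rewrite <- HNG, <- (Rmult_1_r (B ^ k * wt k)) at 1; apply Rmult_le_compat_l; [nonneg|].
    apply pow_R1_Rle, HM'. }
  (* Data of order [k + 1] cost one factor [n <= w] more than [N], which matches the extra [w]
     allowed in the equation for [v]. *)
  assert (HNGS : B ^ S k * wt (S k) * M' ^ (S k - 4) <= B * n * (N / G)).
  { replace (S k - 4)%nat with (k - 3)%nat by lia; rewrite <- HNG.
    replace (B * n * (B ^ k * wt k * M' ^ (k - 3))) with (B ^ S k * (n * wt k) * M' ^ (k - 3))
      by (simpl; ring).
    apply Rmult_le_compat_r; [lra|]; apply Rmult_le_compat_l; [apply pow_le; lra|].
    apply wt_S_le. }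
  assert (HNGS1 : B ^ S k * wt (S k) <= B * n * (N / G)).
  { eapply Rle_trans; [|exact HNGS].
    rewrite <- (Rmult_1_r (B ^ S k * wt (S k))) at 1; apply Rmult_le_compat_l.
    - pose proof (wt_pos (S k)); nonneg.
    - apply pow_R1_Rle, HM'. }
  assert (Hbox : forall x t, Rabs (x - x0) <= rho -> Rabs (t - t1) <= de -> Rabs (t - t0) < s').
  { intros x t _ Ht; replace (t - t0) with ((t - t1) + (t1 - t0)) by ring.
    pose proof (Rabs_triang (t - t1) (t1 - t0)); unfold s'; lra. }
  assert (Hind : forall x t, Rabs (x - x0) <= rho -> Rabs (t - t1) <= de -> in_box d x0 t0 x t).
  { intros x t Hx Ht; specialize (Hbox x t Hx Ht); split; lra. }
  assert (Hmain := bernstein d x0 t0 (D k) psi psi1 psi2 (fun x => x ^ r * x ^ r)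
    (fun x t => 1 + H x t ^ 2) (1 + CH ^ 2) c C1 rho x1 t1 de N
    (smooth_pderiv d x0 t0 u (repeat false k) Su) Hind D1 D2 Hpsi).
  assert (Hv : Rabs (dt (D k) x1 t1) <= bconst c (1 + CH ^ 2) C1 * (N * / de)).
  { apply Hmain; try lra.
    - intros x Hx; specialize (Hpsib x Hx); unfold s' in *; lra.
    - exact c_nonneg.
    - pose proof (pow2_ge_0 CH); lra.
    - intros x t Hx Ht Hps.
      assert (Hb : in_box d x0 t0 x t) by (apply Hind; assumption).
      assert (Hlow : forall j, (j < S k)%nat ->
        Rabs (pderiv (repeat false j) W x t) <= G * B ^ j * wt j * M' ^ (j - 3)).
      { intros j Hj; apply IH; try assumption; try lia.
        - lra.
        - apply (Hbox x t Hx Ht).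
        - unfold s'; lra. }
      assert (Hlow' : forall j, (j < k)%nat ->
        Rabs (pderiv (repeat false j) W x t) <= G * B ^ j * wt j * M' ^ (j - 3))
        by (intros j Hj; apply Hlow; lia).
      (* [R1] belongs to the equation for [V = D k], [R2] to the one for [v = D (S k)]; the latter
         also uses the induction hypothesis at order [k] itself. *)
      assert (R1 := pderiv_E_commutator k B M' x t Hk HB1 HBG HM' Hb Hlow').
      assert (R2 := pderiv_E_commutator (S k) B M' x t ltac:(lia) HB1 HBG HM' Hb Hlow).
      fold cR in R1, R2; fold n in R2.
      assert (HVN : Rabs (D k x t) <= N).
      { specialize (Hlow k ltac:(lia)); rewrite pderiv_W in Hlow by exact Hb.
        destruct k as [|k']; [lia|exact Hlow]. }
      assert (HkI : 0 <= INR k <= n) by (unfold n; rewrite S_INR; pose proof (pos_INR k); lra).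
      pose proof cR_nonneg as HcR.
      set (w := / de) in *.
      assert (Hw : 0 < w) by (apply Rinv_0_lt_compat; exact Hde0).
      pose proof (H_bound x t Hb) as HHb.
      destruct (Hpsi x Hx) as [Hz _]; set (z := x ^ r * x ^ r) in *.
      assert (Hnn : n ^ 2 <= w ^ 2) by (apply pow_incr; lra).
      assert (Hkk : INR k ^ 2 <= w ^ 2) by (apply pow_incr; lra).
      assert (Hn3 : n ^ 2 * n <= w ^ 3).
      { replace (n ^ 2 * n) with (n ^ 3) by ring; apply pow_incr; lra. }
      assert (F1 := f_t_bound B k x t HB1 HBG Hb).
      assert (F2 := f_t_bound B (S k) x t HB1 HBG Hb).
      assert (E1 := D_equation k x t Hb).
      assert (E2 := D_equation (S k) x t Hb).
      fold z in E1, E2.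
      assert (HNGp : 0 <= N / G) by (apply Rlt_le, Rdiv_lt_0_compat; assumption).
      assert (c1 : cR <= c /\ cR * / G <= c /\ cR * (B / G) <= c /\ CF / G <= c /\ CF * B / G <= c
         /\ cR + cR * / G <= c).
      { unfold c; unfold Rdiv; assert (0 <= cR * / G) by nonneg.
        assert (0 <= cR * (B * / G)) by nonneg.
        assert (0 <= CF * / G) by nonneg; assert (0 <= CF * B * / G) by nonneg.
        repeat split; lra. }
      destruct c1 as [c1 [c2 [c3 [c4 [c5 c6]]]]].
      pose proof (Rabs_pos (D (S k) x t)) as Hv0; pose proof (Rabs_pos (D (S (S k)) x t)) as Hvt0.
      pose proof (Rabs_pos (D k x t)) as HV0.
      split; [|split; [exact HVN|split]].
      + rewrite sqr_Rabs; pose proof (Rabs_pos (H x t)).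
        pose proof (pow2_ge_0 (Rabs (H x t))).
        assert (Rabs (H x t) ^ 2 <= CH ^ 2) by (apply pow_incr; lra); lra.
      + change (pderiv (true :: true :: nil) (D k) x t) with
          (pderiv (true :: true :: repeat false k) u x t); rewrite E1.
        change (pderiv (false :: false :: nil) (D k) x t) with (D (S (S k)) x t).
        set (Rk := pderiv (repeat false k) E x t - (1 + H x t ^ 2) * D (S (S k)) x t) in *.
        replace (_ + _) with (- pderiv (repeat false k) f x t + z * - Rk) by (unfold Rk; ring).
        eapply Rle_trans; [apply Rabs_triang|]; rewrite Rabs_Ropp, Rabs_mult, Rabs_Ropp.
        rewrite (Rabs_pos_eq z) by exact Hz.
        apply Rplus_le_compat.
        * eapply Rle_trans; [exact F1|].
          apply Rle_trans with (CF * (N / G)); [apply Rmult_le_compat_l; assumption|].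
          replace (CF * (N / G)) with (CF / G * N) by (field; lra).
          apply Rmult_le_compat_r; lra.
        * rewrite (Rmult_assoc z c); apply Rmult_le_compat_l; [exact Hz|].
          eapply Rle_trans; [exact R1|].
          change (dt (D k) x t) with (D (S k) x t).
          apply Rle_trans with (cR * (Rabs (D (S k) x t) * w) + (cR + cR * / G) * (N * w ^ 2)).
          -- replace (cR * (Rabs (D (S k) x t) * w) + (cR + cR * / G) * (N * w ^ 2)) with
               (cR * (w * Rabs (D (S k) x t) + w ^ 2 * N + w ^ 2 * (N / G))) by (field; lra).
             apply Rmult_le_compat_l; [exact HcR|].
             apply Rplus_le_compat; [apply Rplus_le_compat|].
             ++ apply Rmult_le_compat_r; lra.
             ++ apply Rmult_le_compat; try lra; apply pow2_ge_0.
             ++ apply Rmult_le_compat; [apply pow2_ge_0| |exact Hkk|].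
                { pose proof (pow_lt M' (k - 4) ltac:(lra)); nonneg. }
                rewrite <- HNG; apply Rmult_le_compat_l; [nonneg|].
                apply Rle_pow; [exact HM'|lia].
          -- rewrite Rmult_plus_distr_l; apply Rplus_le_compat; apply Rmult_le_compat_r;
               try assumption; nonneg.
      + change (pderiv (true :: true :: false :: nil) (D k) x t) with
          (pderiv (true :: true :: repeat false (S k)) u x t); rewrite E2.
        change (pderiv (false :: false :: false :: nil) (D k) x t) with (D (S (S (S k))) x t).
        change (pderiv (false :: false :: nil) (D k) x t) with (D (S (S k)) x t).
        change (dt (D k) x t) with (D (S k) x t).
        set (Rk := pderiv (repeat false (S k)) E x t - (1 + H x t ^ 2) * D (S (S (S k))) x t) in *.
        replace (_ + _) with (- pderiv (repeat false (S k)) f x t + z * - Rk) by (unfold Rk; ring).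
        eapply Rle_trans; [apply Rabs_triang|]; rewrite Rabs_Ropp, Rabs_mult, Rabs_Ropp.
        rewrite (Rabs_pos_eq z) by exact Hz.
        apply Rplus_le_compat.
        * eapply Rle_trans; [exact F2|].
          apply Rle_trans with (CF * (B * n * (N / G))); [apply Rmult_le_compat_l; assumption|].
          replace (CF * (B * n * (N / G))) with (CF * B / G * (N * n)) by (field; lra).
          rewrite (Rmult_assoc c N w); apply Rmult_le_compat; [unfold Rdiv; nonneg|nonneg|lra|].
          apply Rmult_le_compat_l; lra.
        * rewrite (Rmult_assoc z c); apply Rmult_le_compat_l; [exact Hz|].
          eapply Rle_trans; [exact R2|].
          apply Rle_trans with (cR * (Rabs (D (S (S k)) x t) * w) + cR * (Rabs (D (S k) x t) * w ^ 2)
             + (cR * (B / G)) * (N * w ^ 3)).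
          -- replace (cR * (Rabs (D (S (S k)) x t) * w) + cR * (Rabs (D (S k) x t) * w ^ 2)
             + (cR * (B / G)) * (N * w ^ 3)) with
               (cR * (w * Rabs (D (S (S k)) x t) + w ^ 2 * Rabs (D (S k) x t)
                 + w ^ 3 * (B * (N / G)))) by (field; lra).
             apply Rmult_le_compat_l; [exact HcR|].
             apply Rplus_le_compat; [apply Rplus_le_compat|].
             ++ apply Rmult_le_compat_r; lra.
             ++ apply Rmult_le_compat_r; lra.
             ++ apply Rle_trans with (n ^ 2 * (B * n * (N / G))).
                { apply Rmult_le_compat_l; [apply pow2_ge_0|exact HNGS]. }
                replace (n ^ 2 * (B * n * (N / G))) with ((n ^ 2 * n) * (B * (N / G))) by ring.
                apply Rmult_le_compat_r; [nonneg|exact Hn3].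
          -- rewrite 2!Rmult_plus_distr_l; repeat apply Rplus_le_compat; apply Rmult_le_compat_r;
               try assumption; nonneg. }
  rewrite pderiv_W by (split; lra).
  change (match repeat false (S k) with nil => W x1 t1 | _ => pderiv (repeat false (S k)) u x1 t1 end)
    with (dt (D k) x1 t1).
  eapply Rle_trans; [exact Hv|].
  set (Cb := bconst c (1 + CH ^ 2) C1) in *.
  assert (HCb : 0 <= Cb).
  { apply bconst_nonneg; [exact c_nonneg|pose proof (pow2_ge_0 CH); lra|exact HC1]. }
  assert (HMp : M' ^ (k - 3) <= 2 * (M / (T - s)) ^ (k - 3)).
  { assert (EM : M / (T - s) = M' * (1 - / (2 * n))).
    { unfold M'; rewrite HTs'; field; lra. }
    rewrite EM, Rpow_mult_distr.
    (* Bernoulli's inequality: replacing [s'] by [s] costs [(1 - 1/(2 n))^(k - 3)], which is at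
       least [1/2] because [k - 3 <= n]. *)
    assert (Hbern := pow_one_sub_ge (/ (2 * n)) (k - 3) ltac:(lra)).
    assert (INR (k - 3) * / (2 * n) <= / 2).
    { assert (HI : 0 <= INR (k - 3) <= n)
        by (split; [apply pos_INR|apply le_INR; lia]).
      replace (/ 2) with (n * / (2 * n)) by (field; lra).
      apply Rmult_le_compat_r; lra. }
    nra. }
  assert (HTs : 0 < T - s) by lra.
  assert (HMs : 0 < (M / (T - s)) ^ (k - 3)) by (apply pow_lt, Rdiv_lt_0_compat; lra).
  replace (S k - 3)%nat with (S (k - 3)) by lia; cbn [pow].
  pose proof (wt_S_ge k) as HW4; fold n in HW4.
  pose proof (wt_pos (S k)) as HwS.
  replace (N * / de) with (2 / (T - s) * (G * B ^ k * (n * wt k) * M' ^ (k - 3))).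
  2:{ unfold N, de; field; lra. }
  apply Rle_trans with (Cb * (2 / (T - s) * (G * (B * B ^ k) * (4 * wt (S k)) * (2 * (M / (T - s)) ^ (k - 3))))).
  - apply Rmult_le_compat_l; [exact HCb|].
    apply Rmult_le_compat_l; [apply Rlt_le, Rdiv_lt_0_compat; lra|].
    apply Rmult_le_compat; [|lra| |exact HMp].
    + assert (0 <= n * wt k) by nonneg; nonneg.
    + apply Rmult_le_compat; [nonneg|nonneg| |exact HW4].
      apply Rmult_le_compat_l; [lra|].
      rewrite <- (Rmult_1_l (B ^ k)) at 1; apply Rmult_le_compat_r; lra.
  - replace (G * (B * B ^ k) * wt (S k) * (M / (T - s) * (M / (T - s)) ^ (k - 3))) with
      (M * (/ (T - s) * (G * (B * B ^ k) * wt (S k) * (M / (T - s)) ^ (k - 3)))) by (unfold Rdiv; ring).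
    replace (Cb * _) with (16 * Cb * (/ (T - s) * (G * (B * B ^ k) * wt (S k) * (M / (T - s)) ^ (k - 3))))
      by (unfold Rdiv; ring).
    apply Rmult_le_compat_r; [|unfold M; fold Cb; lra].
    pose proof (Rinv_0_lt_compat _ HTs).
    assert (0 <= M / (T - s)) by (unfold Rdiv; nonneg); nonneg.
Qed.

(** At the fixed level [s = T / 2] the quotient [M / (T - s)] is a constant and is absorbed in the
    base. *)
Lemma D_geometric_bound : exists N0, 1 <= N0 /\ 32 / G <= N0 /\
  forall k x t, Rabs (x - x0) <= rho -> Rabs (t - t0) < T / 2 -> psi x < T / 2 ->
    Rabs (pderiv (repeat false k) W x t) <= G * N0 ^ k * wt k.
Proof.
  pose proof M_ge_1 as HM.
  assert (HMT : 1 <= M / (T / 2)) by (apply Rle_div_r; lra).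
  assert (HB : B <= B * (M / (T / 2))) by (rewrite <- (Rmult_1_r B) at 1; apply Rmult_le_compat_l; lra).
  exists (B * (M / (T / 2))); repeat split; try lra.
  intros k x t Hx Ht Hps.
  eapply Rle_trans; [apply (D_bound k (T / 2)); try assumption; lra|].
  replace (T - T / 2) with (T / 2) by field.
  rewrite Rpow_mult_distr.
  replace (G * (B ^ k * (M / (T / 2)) ^ k) * wt k) with (G * B ^ k * wt k * (M / (T / 2)) ^ k) by ring.
  pose proof (GBwt_pos B HB1 k); apply Rmult_le_compat_l; [lra|].
  apply Rle_pow; [exact HMT|lia].
Qed.
End PhaseOne.

(** * Mixed derivatives *)

Let Gx := G + 8 * (Rabs x0 + d).
Let CZ := 8 * Gx ^ r * (8 * Gx ^ r).
(** Majorant constant of [u_xx], as [Gx] is that of the coordinate [x] and [CZ] that of [x^(2r)].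
    The [16] brings [f], majorized without shift, to the shift [2] of the other terms. *)
Let CE := 16 * CF + CZ * (G + CH * (CH * G)).

Lemma wt_le_shift2 (n : nat) : wt n <= 16 * wt (n + 2).
Proof.
  rewrite Nat.add_comm; cbn [Nat.add].
  pose proof (wt_S_ge n) as W1; pose proof (wt_S_ge (S n)) as W2.
  rewrite S_INR in W1, W2; rewrite S_INR in W2; pose proof (pos_INR n).
  pose proof (wt_pos n); pose proof (wt_pos (S n)); nra.
Qed.

Lemma Gx_ge (x t : R) : in_box d x0 t0 x t -> G <= Gx /\ Rabs x <= Gx / 8.
Proof.
  intros [Hx _]; pose proof (Rabs_pos (x - x0)); pose proof (Rabs_pos x0).
  unfold Gx; split; [lra|].
  pose proof (Rabs_triang (x - x0) x0); replace (x - x0 + x0) with x in * by ring; lra.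
Qed.

(** The equation expresses [u_xx] by two derivatives in [t]: the length grows by [2] while the
    number [I] of [x]-derivatives stays the same. This is what drives the induction on [I]. *)
Lemma majorized_uxx (al N : R) (J I : nat) (x t : R) : in_box d x0 t0 x t ->
  1 <= al -> 1 <= N -> 32 / G <= N ->
  majorized al (fun n => N ^ n) (J + 2) I 0 G W x t ->
  majorized al (fun n => N ^ n) J I 2 CE (dx (dx u)) x t.
Proof.
  intros Hb Hal HN1 HNG NW.
  set (mu := fun n => N ^ n) in *.
  assert (Hmu : forall n, 0 <= mu n) by (intros n; apply pow_le; lra).
  assert (Hmu0 : 1 <= mu 0%nat) by (unfold mu; simpl; lra).
  assert (Hmu1 : mu 1%nat = N) by (unfold mu; ring).
  assert (Hsub : forall K i j, (i + j <= K)%nat -> mu i * mu j <= mu (i + j)%nat)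
    by (intros K i j _; unfold mu; rewrite pow_add; lra).
  assert (NH : majorized al mu (J + 2) I 0 CH H x t).
  { apply (HH al mu (J + 2)%nat); try assumption; try lia; [lra|apply Hsub]. }
  assert (Nf : majorized al mu J I 0 CF f x t).
  { apply (HF al mu J); try assumption; try lia; [lra|apply Hsub]. }
  assert (Nt : majorized al mu (J + 1) I 1 G (dt u) x t).
  { apply (majorized_dt_u al mu (J + 1) I 0 G x t Hb).
    replace (S (J + 1)) with (J + 2)%nat by lia; exact NW. }
  pose proof (psmooth_pderiv d x0 t0 u (false :: nil) psmooth_u) as St.
  pose proof (psmooth_pderiv d x0 t0 u (false :: false :: nil) psmooth_u) as Stt.
  assert (NHw : forall J', (J' <= J + 2)%nat -> majorized al mu J' I 0 CH H x t).
  { intros J' HJ'; apply (majorized_weaken al mu x t Hal Hmu (J + 2) J' I I 0 CH CH H);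
      try assumption; try lia; lra. }
  assert (NQ : majorized al mu (J + 1) I 1 (CH * G) Q x t).
  { apply (majorized_mult d x0 t0 al mu (J + 2) x t Hb Hal Hmu (Hsub _) (J + 1) I 0 1 CH G H (dt u));
      try assumption; try lra; try lia; apply NHw; lia. }
  assert (NdQ : majorized al mu J I 2 (CH * G) (dt Q) x t).
  { apply (majorized_pderiv al mu x t J I 1 (CH * G) Q (false :: nil)); [reflexivity|exact NQ]. }
  assert (Ntt : majorized al mu J I 2 G (dt (dt u)) x t).
  { apply (majorized_pderiv al mu x t J I 1 G (dt u) (false :: nil)); [reflexivity|exact Nt]. }
  assert (HCHG : 0 <= CH * G) by (apply Rmult_le_pos; lra).
  assert (NHdQ : majorized al mu J I 2 (CH * (CH * G)) (fun x t => H x t * dt Q x t) x t).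
  { apply (majorized_mult d x0 t0 al mu (J + 2) x t Hb Hal Hmu (Hsub _) J I 0 2 CH (CH * G) H (dt Q));
      try assumption; try lra; try lia; [exact psmooth_dtQ|apply NHw; lia]. }
  assert (SHdQ : psmooth d x0 t0 (fun x t => H x t * dt Q x t))
    by (apply psmooth_mult; [exact SH|exact psmooth_dtQ]).
  assert (NE : majorized al mu J I 2 (G + CH * (CH * G)) E x t).
  { apply (majorized_plus d x0 t0 al mu x t Hb J I 2 _ _ (dt (dt u)) (fun x t => H x t * dt Q x t));
      assumption. }
  destruct (Gx_ge x t Hb) as [HGx HxG].
  assert (HGx0 : 0 < Gx) by lra.
  assert (Nx : majorized al mu J I 0 Gx (fun x _ => x) x t).
  { apply (majorized_ext d x0 t0 al mu x t Hb J I 0 Gx (fun x t => 1 * x + 0 * t + 0));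
      [intros; ring|].
    apply (majorized_affine d x0 t0); try assumption.
    - rewrite Hmu1; eapply Rle_trans; [|exact HNG].
      apply Rmult_le_compat_l; [lra|apply Rinv_le_contravar; lra].
    - rewrite Rabs_R1; lra.
    - rewrite Rabs_R0; lra.
    - replace (1 * x + 0 * t + 0) with x by ring; exact HxG. }
  assert (Sx : psmooth d x0 t0 (fun x _ => x)).
  { apply (psmooth_ext d x0 t0 (fun x _ => x ^ 1)); [intros; ring|apply psmooth_pow_x]. }
  destruct (majorized_pow d x0 t0 al mu J x t Hb Hal Hmu (Hsub _) Hmu0 J I Gx (fun x _ => x) r Sx
    ltac:(lra) (Nat.le_refl J) Nx) as [Sr Nr].
  assert (HCr : 0 <= 8 * Gx ^ r) by (pose proof (pow_le Gx r ltac:(lra)); lra).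
  assert (HCZ : 0 <= CZ) by (unfold CZ; apply Rmult_le_pos; assumption).
  assert (Sz : psmooth d x0 t0 (fun x _ => x ^ r * x ^ r)) by (apply psmooth_mult; exact Sr).
  assert (Nz : majorized al mu J I 0 CZ (fun x _ => x ^ r * x ^ r) x t).
  { apply (majorized_mult d x0 t0 al mu J x t Hb Hal Hmu (Hsub _) J I 0 0 _ _
      (fun x _ => x ^ r) (fun x _ => x ^ r)); try assumption; lia. }
  assert (HCEp : 0 <= G + CH * (CH * G)) by (assert (0 <= CH * (CH * G)) by nonneg; lra).
  assert (NzE : majorized al mu J I 2 (CZ * (G + CH * (CH * G)))
     (fun x t => x ^ r * x ^ r * E x t) x t).
  { apply (majorized_mult d x0 t0 al mu (J + 2) x t Hb Hal Hmu (Hsub _) J I 0 2 _ _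
      (fun x _ => x ^ r * x ^ r) E); try assumption; try lia; exact psmooth_E. }
  assert (SzE : psmooth d x0 t0 (fun x t => x ^ r * x ^ r * E x t))
    by (apply (psmooth_mult d x0 t0 (fun x _ => x ^ r * x ^ r)); [exact Sz|exact psmooth_E]).
  destruct (pderiv_plus d x0 t0 f (fun x t => x ^ r * x ^ r * E x t) Sf SzE) as [Sp Dp].
  destruct (pderiv_opp d x0 t0 _ Sp) as [_ Do].
  intros l Hl Hn.
  rewrite (pderiv_ext d x0 t0 (dx (dx u)) (fun x t => - (f x t + x ^ r * x ^ r * E x t))); [| |exact Hb].
  2:{ intros x' t' Hb'; rewrite (Heqn x' t' Hb'); unfold E, Q; ring. }
  rewrite (Do l x t Hb), Rabs_Ropp, (Dp l x t Hb).
  eapply Rle_trans; [apply Rabs_triang|].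
  unfold CE; rewrite !Rmult_plus_distr_r; apply Rplus_le_compat.
  - eapply Rle_trans; [apply Nf; assumption|]; rewrite Nat.add_0_r.
    assert (Hal0 : 0 < al ^ nx l) by (apply pow_lt; lra).
    replace (16 * CF * al ^ nx l * (mu (length l + 2)%nat * wt (length l + 2))) with
      (CF * al ^ nx l * (mu (length l + 2)%nat * (16 * wt (length l + 2)))) by ring.
    apply Rmult_le_compat_l; [nonneg|].
    apply Rmult_le_compat; [apply Hmu|left; apply wt_pos| |apply wt_le_shift2].
    apply Rle_pow; [exact HN1|lia].
  - apply NzE; assumption.
Qed.

Lemma word_perm (l : list bool) :
  Permutation l (repeat true (nx l) ++ repeat false (length l - nx l)).
Proof.
  induction l as [|b l IH]; [reflexivity|].
  assert (Hn : (nx l <= length l)%nat) by apply count_occ_bound.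
  destruct b.
  - change (nx (true :: l)) with (S (nx l)); simpl; apply perm_skip, IH.
  - change (nx (false :: l)) with (nx l); cbn [length].
    replace (S (length l) - nx l)%nat with (S (length l - nx l)) by lia.
    apply Permutation_cons_app, IH.
Qed.

Section PhaseTwo.
Variables (d1 N0 : R).
Hypothesis (Hd1 : 0 < d1 <= d) (HN1 : 1 <= N0) (HNG : 32 / G <= N0)
  (HD : forall k x t, in_box d1 x0 t0 x t ->
     Rabs (pderiv (repeat false k) W x t) <= G * N0 ^ k * wt k).

Let d2 := d1 / 2.
(** [CL] comes from interpolation with step [d2]. [al] is large enough to pay for the first
    [x]-derivative ([CL * N0 <= G * al]) and for each further pair ([CE <= G * al]). Doubling [N0]
    absorbs the one order lost by interpolation, since [wt (k + 2) <= 2^(k + 1) wt (k + 1)]. *)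
Let CL := 32 * G / d2 + d2 * CE.
Let al := 1 + CL * N0 / G + CE / G.
Let N := 2 * N0.

Lemma CE_nonneg : 0 <= CE.
Proof.
  pose proof (Rabs_pos x0); assert (0 <= Gx) by (unfold Gx; lra).
  unfold CE, CZ; nonneg.
Qed.

(** Taylor expansion in [x] with step [d1 / 2], which stays in the larger box, bounds the first
    derivative by the values and the second derivative. The weight is that of order [k + 2] for a
    word of length [k + 1]; this loss occurs only once. *)
Lemma D_dx_bound (k : nat) (x t : R) : in_box d2 x0 t0 x t ->
  Rabs (pderiv (true :: repeat false k) u x t) <= CL * (N0 ^ (k + 2) * wt (k + 2)).
Proof.
  intros [Hx Ht]; unfold d2 in *.
  assert (Hb1 : forall y, Rabs (y - x0) < d1 -> in_box d1 x0 t0 y t) by (intros y Hy; split; lra).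
  assert (Hbd : forall y, Rabs (y - x0) < d1 -> in_box d x0 t0 y t)
    by (intros y Hy; apply (in_box_le d1); [lra|apply Hb1, Hy]).
  assert (Hxx : forall y, Rabs (y - x0) < d1 ->
    Rabs (pderiv (true :: true :: repeat false k) u y t) <= CE * (N0 ^ (k + 2) * wt (k + 2))).
  { intros y Hy.
    assert (Hp : Permutation (true :: true :: repeat false k) (repeat false k ++ true :: true :: nil))
      by apply (Permutation_app_comm (true :: true :: nil)).
    rewrite (pderiv_perm d x0 t0 u _ _ Su Hp y t (Hbd y Hy)), pderiv_app.
    assert (NU := majorized_uxx 1 N0 k 0 y t (Hbd y Hy) (Rle_refl 1) HN1 HNG).
    assert (NW : majorized 1 (fun n => N0 ^ n) (k + 2) 0 0 G W y t).
    { intros l Hl Hn; rewrite (nx_0_repeat l) by lia.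
      rewrite repeat_length, pow1, Rmult_1_r, Nat.add_0_r, <- Rmult_assoc; apply HD, Hb1, Hy. }
    specialize (NU NW (repeat false k)).
    rewrite repeat_length, nx_repeat_false, pow_O, Rmult_1_r in NU; apply NU; lia. }
  assert (Hy : Rabs (x + d1 / 2 - x0) < d1).
  { replace (x + d1 / 2 - x0) with ((x - x0) + d1 / 2) by ring.
    eapply Rle_lt_trans; [apply Rabs_triang|]; rewrite (Rabs_pos_eq (d1 / 2)); lra. }
  assert (Hx1 : Rabs (x - x0) < d1) by lra.
  assert (EW : forall l y, Rabs (y - x0) < d1 -> l <> nil -> pderiv l W y t = pderiv l u y t).
  { intros l y Hy' Hl; rewrite pderiv_W by (apply Hbd, Hy'); destruct l; [congruence|reflexivity]. }
  assert (HTy := taylor2_ball (fun y => pderiv (repeat false k) W y t)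
    (fun y => pderiv (true :: repeat false k) W y t)
    (fun y => pderiv (true :: true :: repeat false k) W y t)
    (CE * (N0 ^ (k + 2) * wt (k + 2))) x0 d1 x (x + d1 / 2)
    (fun z Hz => proj1 (psmooth_is_derive d x0 t0 W (repeat false k) z t psmooth_W (Hbd z Hz)))
    (fun z Hz => proj1 (psmooth_is_derive d x0 t0 W (true :: repeat false k) z t psmooth_W (Hbd z Hz)))).
  cbv beta in HTy.
  assert (HTx := HTy ltac:(intros z Hz; rewrite (EW _ z Hz) by discriminate; apply Hxx, Hz) Hx1 Hy).
  rewrite (EW (true :: repeat false k) x Hx1) in HTx by discriminate.
  replace (x + d1 / 2 - x) with (d1 / 2) in HTx by ring.
  rewrite (Rabs_pos_eq (d1 / 2)) in HTx by lra.
  assert (A1 := HD k x t (Hb1 x Hx1)); assert (A2 := HD k _ t (Hb1 _ Hy)).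
  set (p := pderiv (true :: repeat false k) u x t) in *.
  set (a1 := pderiv (repeat false k) W x t) in *.
  set (a2 := pderiv (repeat false k) W (x + d1 / 2) t) in *.
  assert (HNk : N0 ^ k * wt k <= 16 * (N0 ^ (k + 2) * wt (k + 2))).
  { replace (16 * (N0 ^ (k + 2) * wt (k + 2))) with (N0 ^ (k + 2) * (16 * wt (k + 2))) by ring.
    apply Rmult_le_compat; [apply pow_le; lra|left; apply wt_pos| |apply wt_le_shift2].
    apply Rle_pow; [lra|lia]. }
  set (Y := N0 ^ (k + 2) * wt (k + 2)) in *.
  assert (HGk := Rmult_le_compat_l G _ _ ltac:(lra) HNk).
  assert (Hp : Rabs (p * (d1 / 2)) <= 32 * G * Y + CE * Y * (d1 / 2 * (d1 / 2))).
  { replace (p * (d1 / 2)) with (- (a2 - a1 - p * (d1 / 2)) + (a2 + - a1)) by ring.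
    eapply Rle_trans; [apply Rabs_triang|]; rewrite Rabs_Ropp.
    pose proof (Rabs_triang a2 (- a1)) as Ht3; rewrite Rabs_Ropp in Ht3; lra. }
  rewrite Rabs_mult, (Rabs_pos_eq (d1 / 2)) in Hp by lra.
  apply (Rmult_le_reg_r (d1 / 2)); [lra|].
  replace (CL * Y * (d1 / 2)) with (32 * G * Y + CE * Y * (d1 / 2 * (d1 / 2)));
    [exact Hp|unfold CL, d2; field; lra].
Qed.

Lemma al_ge : 1 <= al /\ CL * N0 <= G * al /\ CE <= G * al.
Proof.
  pose proof CE_nonneg as HCE; pose proof (Rinv_0_lt_compat G HG).
  assert (HCL : 0 <= CL).
  { unfold CL, d2; assert (0 <= 32 * G / (d1 / 2)) by (apply Rdiv_le_0_compat; lra).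
    assert (0 <= d1 / 2 * CE) by nonneg; lra. }
  assert (0 <= CL * N0 / G) by (unfold Rdiv; nonneg).
  assert (0 <= CE / G) by (unfold Rdiv; nonneg).
  unfold al; split; [lra|].
  replace (G * (1 + CL * N0 / G + CE / G)) with (G + CL * N0 + CE) by (field; lra).
  assert (0 <= CL * N0) by nonneg; lra.
Qed.

(** The cases of zero and one [x]-derivative are direct. Otherwise the word is permuted so that two
    [x]-derivatives act first on [u], and [majorized_uxx] leaves a word with two fewer;
    [CE <= G * al] and [al >= 1] restore the constant. *)
Lemma W_majorized_all (I : nat) : forall J x t, in_box d2 x0 t0 x t ->
  majorized al (fun n => N ^ n) J I 0 G W x t.
Proof.
  destruct al_ge as [Hal [HaL HaE]].
  assert (HNN : 1 <= N) by (unfold N; lra).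
  assert (Hbd : forall x t, in_box d2 x0 t0 x t -> in_box d x0 t0 x t /\ in_box d1 x0 t0 x t).
  { intros x t Hb; split; apply (in_box_le d2); try assumption; unfold d2; lra. }
  assert (B0 : forall l x t, in_box d2 x0 t0 x t -> nx l = O ->
    Rabs (pderiv l W x t) <= G * (N ^ length l * wt (length l))).
  { intros l x t Hb Hn; rewrite (nx_0_repeat l Hn) at 1.
    eapply Rle_trans; [apply HD, (Hbd x t Hb)|]; rewrite Rmult_assoc.
    apply Rmult_le_compat_l; [lra|]; apply Rmult_le_compat_r; [left; apply wt_pos|].
    apply pow_incr; unfold N; lra. }
  assert (B1 : forall l x t, in_box d2 x0 t0 x t -> nx l = 1%nat ->
    Rabs (pderiv l W x t) <= G * al * (N ^ length l * wt (length l))).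
  { intros l x t Hb Hn.
    rewrite pderiv_W by (apply (Hbd x t Hb)).
    destruct l as [|b l']; [discriminate|]; set (l := b :: l') in *.
    assert (Hp := word_perm l); rewrite Hn in Hp.
    rewrite (pderiv_perm d x0 t0 u _ _ Su Hp x t (proj1 (Hbd x t Hb))).
    set (k := (length l - 1)%nat) in *.
    assert (Hk : length l = S k) by (unfold k, l; simpl; lia).
    change (repeat true 1 ++ repeat false k) with (true :: repeat false k).
    eapply Rle_trans; [apply D_dx_bound, Hb|]; rewrite Hk.
    replace (k + 2)%nat with (S (S k)) by lia.
    pose proof (wt_S_le (S k)) as HW1; pose proof (INR_S_le_pow2 (S k)) as HS2.
    pose proof (wt_pos (S k)) as HwS.
    assert (HW2 : wt (S (S k)) <= 2 ^ S k * wt (S k)).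
    { eapply Rle_trans; [exact HW1|apply Rmult_le_compat_r; lra]. }
    assert (HNk : 0 < N0 ^ S k) by (apply pow_lt; lra).
    assert (HCL0 : 0 <= CL).
    { unfold CL, d2; pose proof CE_nonneg.
      assert (0 <= 32 * G / (d1 / 2)) by (apply Rdiv_le_0_compat; lra).
      assert (0 <= d1 / 2 * CE) by nonneg; lra. }
    apply Rle_trans with (CL * N0 * (N0 ^ S k * (2 ^ S k * wt (S k)))).
    - replace (CL * (N0 ^ S (S k) * wt (S (S k)))) with (CL * N0 * (N0 ^ S k * wt (S (S k))))
        by (simpl; ring).
      apply Rmult_le_compat_l; [nonneg|]; apply Rmult_le_compat_l; lra.
    - replace (N0 ^ S k * (2 ^ S k * wt (S k))) with (N ^ S k * wt (S k))
        by (unfold N; rewrite Rpow_mult_distr; ring).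
      apply Rmult_le_compat_r; [|exact HaL].
      assert (0 < N ^ S k) by (apply pow_lt; lra); nonneg. }
  assert (HI0 : forall l, nx l = O -> forall J x t, in_box d2 x0 t0 x t -> (length l <= J)%nat ->
    Rabs (pderiv l W x t) <= G * al ^ nx l * (N ^ (length l + 0) * wt (length l + 0))).
  { intros l Hn J x t Hb _; rewrite Hn, pow_O, Rmult_1_r, Nat.add_0_r; apply B0; assumption. }
  assert (HI1 : forall l, nx l = 1%nat -> forall J x t, in_box d2 x0 t0 x t -> (length l <= J)%nat ->
    Rabs (pderiv l W x t) <= G * al ^ nx l * (N ^ (length l + 0) * wt (length l + 0))).
  { intros l Hn J x t Hb _; rewrite Hn, pow_1, Nat.add_0_r; apply B1; assumption. }
  induction I as [|I IH]; intros J x t Hb l Hl Hn.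
  { apply (HI0 l ltac:(lia) J); assumption. }
  destruct (Nat.le_gt_cases (nx l) I) as [Hle|Hgt]; [apply (IH J); assumption|].
  assert (En : nx l = S I) by lia.
  destruct I as [|I]; [apply (HI1 l En J); assumption|].
  assert (Hln : (nx l <= length l)%nat) by apply count_occ_bound.
  set (l' := repeat true I ++ repeat false (length l - nx l)).
  assert (Hp : Permutation l (l' ++ true :: true :: nil)).
  { etransitivity; [apply word_perm|]; unfold l'; rewrite En.
    etransitivity; [|apply (Permutation_app_comm (true :: true :: nil))].
    reflexivity. }
  assert (Hl' : length l = (length l' + 2)%nat).
  { rewrite (Permutation_length Hp), length_app; reflexivity. }
  assert (Hn' : nx l' = I).
  { assert (Hc := proj1 (Permutation_count_occ Bool.bool_dec _ _) Hp true).
    rewrite count_occ_app in Hc; fold (nx l) (nx l') in Hc; simpl in Hc; lia. }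
  rewrite pderiv_W by (apply (Hbd x t Hb)).
  destruct l as [|b l0]; [discriminate|]; set (l := b :: l0) in *.
  rewrite (pderiv_perm d x0 t0 u _ _ Su Hp x t (proj1 (Hbd x t Hb))), pderiv_app.
  assert (NU := majorized_uxx al N (length l') (S I) x t (proj1 (Hbd x t Hb)) Hal HNN
    ltac:(unfold N; lra) (IH _ x t Hb) l' (Nat.le_refl _) ltac:(lia)).
  eapply Rle_trans; [exact NU|].
  rewrite <- Hl', Hn', En, Nat.add_0_r.
  assert (HNl : 0 < N ^ length l) by (apply pow_lt; lra).
  pose proof (wt_pos (length l)) as Hwl.
  apply Rmult_le_compat_r; [nonneg|].
  cbn [pow]; assert (0 < al ^ I) by (apply pow_lt; lra).
  replace (G * (al * (al * al ^ I))) with (G * al * al * al ^ I) by ring.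
  apply Rmult_le_compat_r; [lra|]; pose proof CE_nonneg; nra.
Qed.

Lemma u_factorial_bound : exists C Nf, 0 <= C /\ 0 < Nf /\
  forall l x t, in_box d2 x0 t0 x t -> Rabs (pderiv l u x t) <= C * Nf ^ length l * INR (fact (length l)).
Proof.
  destruct al_ge as [Hal _].
  exists (G + Rabs w0), (al * N); repeat split.
  - pose proof (Rabs_pos w0); lra.
  - unfold N; apply Rmult_lt_0_compat; lra.
  - intros l x t Hb.
    assert (Hbd : in_box d x0 t0 x t) by (apply (in_box_le d2); [unfold d2; lra|exact Hb]).
    pose proof (Rabs_pos w0) as Hw0.
    destruct l as [|b l'].
    + simpl; specialize (HW x t Hbd); unfold W in HW.
      pose proof (Rabs_triang (u x t - w0) w0); replace (u x t - w0 + w0) with (u x t) in * by ring; lra.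
    + assert (HW1 := W_majorized_all (nx (b :: l')) (length (b :: l')) x t Hb (b :: l') (Nat.le_refl _) (Nat.le_refl _)).
      rewrite pderiv_W in HW1 by exact Hbd.
      set (l := b :: l') in *; rewrite Nat.add_0_r in HW1.
      eapply Rle_trans; [exact HW1|].
      assert (Hn : (nx l <= length l)%nat) by apply count_occ_bound.
      assert (Ha : al ^ nx l <= al ^ length l) by (apply Rle_pow; lra || lia).
      assert (0 < al ^ nx l) by (apply pow_lt; lra).
      assert (0 < N) by (unfold N; lra).
      assert (0 < N ^ length l) by (apply pow_lt; lra).
      pose proof (wt_pos (length l)); pose proof (wt_le_fact (length l)).
      rewrite Rpow_mult_distr.
      replace ((G + Rabs w0) * (al ^ length l * N ^ length l) * INR (fact (length l))) with
        ((G + Rabs w0) * al ^ length l * (N ^ length l * INR (fact (length l)))) by ring.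
      apply Rmult_le_compat; [nonneg|nonneg| |].
      * apply Rmult_le_compat; lra.
      * apply Rmult_le_compat_l; lra.
Qed.
End PhaseTwo.
End Equation.

(** * Analyticity from factorial bounds *)

(** Binomial coefficients are at most [2^(i + j)], by Pascal's rule. *)
Lemma fact_add_le (i j : nat) :
  INR (fact (i + j)) <= 2 ^ (i + j) * INR (fact i) * INR (fact j).
Proof.
  revert j; induction i as [|i IHi]; intros j.
  - pose proof (INR_fact_lt_0 j); assert (1 <= 2 ^ j) by (apply pow_R1_Rle; lra).
    simpl (fact 0); simpl (INR 1); simpl (0 + j)%nat; nra.
  - induction j as [|j IHj].
    + rewrite Nat.add_0_r; pose proof (INR_fact_lt_0 (S i)).
      assert (1 <= 2 ^ S i) by (apply pow_R1_Rle; lra).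
      simpl (INR (fact 0)); nra.
    + specialize (IHi (S j)).
      replace (S i + S j)%nat with (S (S (i + j))) by lia.
      replace (i + S j)%nat with (S (i + j)) in IHi by lia.
      replace (S i + j)%nat with (S (i + j)) in IHj by lia.
      rewrite (fact_simpl (S (i + j))), mult_INR.
      replace (INR (S (S (i + j)))) with (INR (S i) + INR (S j))
        by (rewrite <- plus_INR; f_equal; lia).
      assert (0 < INR (S i)) by (apply lt_0_INR; lia).
      assert (0 < INR (S j)) by (apply lt_0_INR; lia).
      apply (Rmult_le_compat_l (INR (S i))) in IHi; [|lra].
      apply (Rmult_le_compat_l (INR (S j))) in IHj; [|lra].
      replace (2 ^ S (S (i + j)) * INR (fact (S i)) * INR (fact (S j))) with
        (INR (S i) * (2 ^ S (i + j) * INR (fact i) * INR (fact (S j)))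
         + INR (S j) * (2 ^ S (i + j) * INR (fact (S i)) * INR (fact j))).
      * lra.
      * rewrite (fact_simpl i), (fact_simpl j), !mult_INR; simpl (2 ^ S (S (i + j))); 
        simpl (2 ^ S (i + j)); ring.
Qed.

(** Instead of integrating, the mean value theorem is applied to [C s^(m + 1) / (m + 1)! - e p] with
    [e = 1] and [e = -1], whose derivative is nonnegative. *)
Lemma integrate_power_bound (p p1 : R -> R) (C : R) (m : nat) :
  (forall s, 0 <= s <= 1 -> is_derive p s (p1 s)) -> p 0 = 0 ->
  (forall s, 0 <= s <= 1 -> Rabs (p1 s) <= C * s ^ m / INR (fact m)) ->
  forall s, 0 <= s <= 1 -> Rabs (p s) <= C * s ^ S m / INR (fact (S m)).
Proof.
  intros Hd H0 Hb s Hs.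
  pose proof (INR_fact_neq_0 m) as Hf; pose proof (INR_fact_neq_0 (S m)) as HfS.
  assert (HSm : INR (S m) <> 0) by (apply not_0_INR; lia).
  assert (Hmono : forall e, Rabs e = 1 -> 0 <= C * s ^ S m / INR (fact (S m)) - e * p s).
  { intros e He.
    destruct (MVT_gen (fun s => C * s ^ S m / INR (fact (S m)) - e * p s) 0 s
      (fun s => C * s ^ m / INR (fact m) - e * p1 s)) as [c [Hc Ec]].
    - rewrite Rmin_left, Rmax_right by lra; intros y Hy.
      assert (Hdy := Hd y ltac:(lra)).
      auto_derive; [eexists; exact Hdy|].
      rewrite (is_derive_unique _ _ _ Hdy : Derive (fun z => p z) y = p1 y).
      change (match m with O => 1 | S _ => INR m + 1 end) with (INR (S m)).
      change (fact m + m * fact m)%nat with (fact (S m)).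
      rewrite fact_simpl, mult_INR; field; split; assumption.
    - rewrite Rmin_left, Rmax_right by lra; intros y Hy.
      apply derivable_continuous_pt, ex_derive_Reals_0.
      auto_derive; eexists; apply Hd; lra.
    - rewrite Rmin_left, Rmax_right in Hc by lra.
      rewrite H0 in Ec; simpl (0 ^ S m) in Ec.
      replace (C * (0 * 0 ^ m) / INR (fact (S m)) - e * 0) with 0 in Ec by (field; assumption).
      rewrite Rminus_0_r in Ec; rewrite Ec; apply Rmult_le_pos; [|lra].
      specialize (Hb c ltac:(lra)).
      assert (Rabs (e * p1 c) <= C * c ^ m / INR (fact m)) by (rewrite Rabs_mult, He, Rmult_1_l; exact Hb).
      pose proof (Rle_abs (e * p1 c)); lra. }
  assert (H1 := Hmono 1 Rabs_R1).
  assert (H2 := Hmono (-1) ltac:(rewrite Rabs_left; lra)).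
  apply Rabs_le; lra.
Qed.

Lemma is_derive_taylor_sum (c : nat -> R) (n : nat) (s : R) :
  is_derive (fun s => sum_f_R0 (fun k => c k * s ^ k / INR (fact k)) (S n)) s
    (sum_f_R0 (fun k => c (S k) * s ^ k / INR (fact k)) n).
Proof.
  induction n as [|n IH].
  - apply (is_derive_ext (fun s => c O + c 1%nat * s)).
    { intros y; simpl; change (c O + c 1%nat * y = c O * 1 / 1 + c 1%nat * (y * 1) / 1); field. }
    simpl; auto_derive; trivial; field.
  - cbn [sum_f_R0] in *.
    apply (is_derive_plus
      (fun s => sum_f_R0 (fun k => c k * s ^ k / INR (fact k)) n + c (S n) * s ^ S n / INR (fact (S n)))
      (fun s => c (S (S n)) * s ^ S (S n) / INR (fact (S (S n)))) s); [exact IH|].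
    pose proof (INR_fact_neq_0 (S n)) as Hf.
    assert (HSm : INR (S (S n)) <> 0) by (apply not_0_INR; lia).
    apply (is_derive_ext (fun s => c (S (S n)) / INR (fact (S (S n))) * s ^ S (S n))).
    { intros t; change (c (S (S n)) / INR (fact (S (S n))) * t ^ S (S n)
        = c (S (S n)) * t ^ S (S n) / INR (fact (S (S n)))); unfold Rdiv; ring. }
    replace (c (S (S n)) * s ^ S n / INR (fact (S n))) with
      (c (S (S n)) / INR (fact (S (S n))) * (INR (S (S n)) * 1 * s ^ S n)).
    + apply (is_derive_scal (fun s => s ^ S (S n))).
      apply (is_derive_pow (fun s => s) (S (S n)) s 1); apply @is_derive_id.
    + rewrite (fact_simpl (S n)), mult_INR; field; split; assumption.
Qed.

(** The remainder of [F 0] has as derivative the remainder of [F 1] of one order less, so the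
    induction shifts the family and integrates once. *)
Lemma taylor01 (n : nat) : forall (F : nat -> R -> R) (C : R),
  (forall k s, 0 <= s <= 1 -> is_derive (F k) s (F (S k) s)) ->
  (forall s, 0 <= s <= 1 -> Rabs (F (S n) s) <= C) ->
  forall s, 0 <= s <= 1 ->
    Rabs (F O s - sum_f_R0 (fun k => F k 0 * s ^ k / INR (fact k)) n)
      <= C * s ^ S n / INR (fact (S n)).
Proof.
  induction n as [|n IH]; intros F C Hd Hb s Hs.
  - apply (integrate_power_bound (fun s => F O s - sum_f_R0 (fun k => F k 0 * s ^ k / INR (fact k)) 0)
      (F 1%nat) C 0); try assumption.
    + intros y Hy; specialize (Hd O y Hy).
      cbn [sum_f_R0]; auto_derive; [eexists; exact Hd|].
      rewrite (is_derive_unique _ _ _ Hd : Derive (fun z => F O z) y = F 1%nat y); simpl; field.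
    + simpl; field.
    + intros y Hy; simpl; specialize (Hb y Hy); lra.
  - apply (integrate_power_bound (fun s => F O s - sum_f_R0 (fun k => F k 0 * s ^ k / INR (fact k)) (S n))
      (fun s => F 1%nat s - sum_f_R0 (fun k => F (S k) 0 * s ^ k / INR (fact k)) n) C (S n));
      try assumption.
    + intros y Hy; apply (is_derive_minus (F O)); [apply Hd, Hy|].
      apply (is_derive_taylor_sum (fun k => F k 0)).
    + rewrite decomp_sum by lia; cbn [pred].
      rewrite (sum_eq _ (fun _ => 0)) by (intros i _; simpl (0 ^ S i); field; apply INR_fact_neq_0).
      rewrite sum_cte; simpl; field.
    + intros y Hy; apply (IH (fun k => F (S k)) C); try assumption.
      intros k z Hz; apply Hd, Hz.
Qed.

Lemma taylor_ball (F : nat -> R -> R) (C a d x h : R) (n : nat) :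
  (forall k z, Rabs (z - a) < d -> is_derive (F k) z (F (S k) z)) ->
  (forall z, Rabs (z - a) < d -> Rabs (F (S n) z) <= C) ->
  Rabs (x - a) < d -> Rabs (x + h - a) < d ->
  Rabs (F O (x + h) - sum_f_R0 (fun k => F k x * h ^ k / INR (fact k)) n)
    <= C * Rabs h ^ S n / INR (fact (S n)).
Proof.
  intros Hd Hb Hx Hxh.
  assert (Hin : forall s, 0 <= s <= 1 -> Rabs (x + s * h - a) < d).
  { intros s Hs; replace (x + s * h - a) with ((1 - s) * (x - a) + s * (x + h - a)) by ring.
    eapply Rle_lt_trans; [apply Rabs_triang|]; rewrite !Rabs_mult, (Rabs_pos_eq s), (Rabs_pos_eq (1 - s)) by lra.
    destruct (Req_dec s 0) as [->|]; [lra|]; nra. }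
  assert (HT := taylor01 n (fun k s => h ^ k * F k (x + s * h)) (C * Rabs h ^ S n)).
  cbv beta in HT.
  assert (HT1 : forall s, 0 <= s <= 1 -> Rabs (h ^ 0 * F O (x + s * h) -
      sum_f_R0 (fun k => h ^ k * F k (x + 0 * h) * s ^ k / INR (fact k)) n)
      <= C * Rabs h ^ S n * s ^ S n / INR (fact (S n))).
  { apply HT.
    - intros k s Hs; specialize (Hd k _ (Hin s Hs)); auto_derive; [eexists; exact Hd|].
      rewrite (is_derive_unique _ _ _ Hd : Derive (fun z => F k z) (x + s * h) = F (S k) (x + s * h)).
      simpl; ring.
    - intros s Hs; rewrite Rabs_mult, <- RPow_abs, Rmult_comm.
      apply Rmult_le_compat_r; [apply pow_le, Rabs_pos|apply Hb, Hin, Hs]. }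
  specialize (HT1 1 ltac:(lra)).
  rewrite pow1, Rmult_1_r, pow_O, !Rmult_1_l in HT1.
  rewrite (sum_eq (fun k => F k x * h ^ k / INR (fact k))
    (fun k => h ^ k * F k (x + 0 * h) * 1 ^ k / INR (fact k))); [exact HT1|].
  intros i _; rewrite pow1, Rmult_0_l, Rplus_0_r; unfold Rdiv; ring.
Qed.

Lemma sum_psum2 (a : nat -> nat -> R) (X Y : R) (n : nat) :
  sum_f_R0 (psum2 a X Y) n
   = sum_f_R0 (fun i => sum_f_R0 (fun j => a i j * X ^ i * Y ^ j) (n - i)) n.
Proof.
  induction n as [|n IH]; [reflexivity|].
  cbn [sum_f_R0]; rewrite IH; unfold psum2; cbn [sum_f_R0].
  rewrite !Nat.sub_diag; cbn [sum_f_R0].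
  rewrite <- Rplus_assoc, <- sum_plus; f_equal.
  apply sum_eq; intros i Hi; replace (S n - i)%nat with (S (n - i)) by lia; reflexivity.
Qed.

Lemma Rabs_sum_le_const (g : nat -> R) (C : R) (n : nat) :
  (forall i, (i <= n)%nat -> Rabs (g i) <= C) -> Rabs (sum_f_R0 g n) <= INR (S n) * C.
Proof.
  intros H; eapply Rle_trans; [apply Rsum_abs|].
  eapply Rle_trans; [apply (sum_Rle _ (fun _ => C) n H)|].
  rewrite sum_cte; lra.
Qed.

(** Every point of the half box is a centre. The function is expanded in [x] at fixed [t], then each
    coefficient in [t], both truncated at total order [n]. *)
Lemma factorial_bound_analytic (d x0 t0 C N : R) (u : R -> R -> R) :
  0 < d -> psmooth d x0 t0 u -> 0 <= C -> 0 < N ->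
  (forall l x t, in_box d x0 t0 x t ->
     Rabs (pderiv l u x t) <= C * N ^ length l * INR (fact (length l))) ->
  analytic_on_box (d / 2) x0 t0 u.
Proof.
  intros Hd Su HC HN Hu x1 t1 [Hx1 Ht1].
  (* Derivatives in [x] are taken first and those in [t] outermost, in agreement with the order of
     the two expansions. *)
  set (w := fun i j => repeat false j ++ repeat true i).
  exists (fun i j => pderiv (w i j) u x1 t1 / (INR (fact i) * INR (fact j))).
  set (a := fun i j => pderiv (w i j) u x1 t1 / (INR (fact i) * INR (fact j))).
  (* [1 / (8 N)] gives [2 N de <= 1/4], where the [2] stems from binomial coefficients. The
     polynomial number of terms is then paid by [2^n], leaving a geometric series of ratio [1/2]. *)
  set (de := Rmin (d / 2) (/ (8 * N))).
  assert (H8 : 0 < / (8 * N)) by (apply Rinv_0_lt_compat; lra).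
  assert (Hde : 0 < de) by (apply Rmin_glb_lt; lra).
  assert (Hde1 : de <= d / 2) by apply Rmin_l.
  assert (Hde2 : 2 * N * de <= / 4).
  { assert (de <= / (8 * N)) by apply Rmin_r.
    replace (/ 4) with (2 * N * / (8 * N)) by (field; lra).
    apply Rmult_le_compat_l; lra. }
  assert (Hq : forall n, (2 * N * de) ^ n <= (/ 4) ^ n).
  { intros n; apply pow_incr; split; [|exact Hde2]; repeat apply Rmult_le_pos; lra. }
  exists de; split; [exact Hde|]; intros x t Hx Ht.
  set (X := x - x1) in *; set (Y := t - t1) in *.
  assert (Hb1 : in_box d x0 t0 x1 t1) by (split; lra).
  assert (Hlen : forall i j, length (w i j) = (i + j)%nat).
  { intros i j; unfold w; rewrite length_app, !repeat_length; lia. }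
  assert (HXY : forall i j, Rabs X ^ i * Rabs Y ^ j <= de ^ (i + j)).
  { intros i j; rewrite pow_add.
    apply Rmult_le_compat; try (apply pow_le, Rabs_pos); apply pow_incr; split;
      try apply Rabs_pos; lra. }
  assert (Hfi : forall i, 0 < / INR (fact i)) by (intros; apply Rinv_0_lt_compat, INR_fact_lt_0).
  assert (Hterm : forall i j, Rabs (a i j) * Rabs X ^ i * Rabs Y ^ j <= C * (2 * N * de) ^ (i + j)).
  { intros i j; unfold a, Rdiv; rewrite Rabs_mult, Rmult_assoc.
    specialize (Hu (w i j) x1 t1 Hb1); rewrite Hlen in Hu.
    pose proof (INR_fact_lt_0 i); pose proof (INR_fact_lt_0 j); pose proof (fact_add_le i j).
    rewrite (Rabs_pos_eq (/ _)) by (left; apply Rinv_0_lt_compat, Rmult_lt_0_compat; assumption).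
    assert (0 < N ^ (i + j)) by (apply pow_lt; exact HN).
    rewrite !Rpow_mult_distr.
    replace (C * (2 ^ (i + j) * N ^ (i + j) * de ^ (i + j))) with
      (C * (2 ^ (i + j) * N ^ (i + j)) * de ^ (i + j)) by ring.
    apply Rmult_le_compat; [|apply Rmult_le_pos; apply pow_le, Rabs_pos| |apply HXY].
    - apply Rmult_le_pos; [apply Rabs_pos|left; apply Rinv_0_lt_compat, Rmult_lt_0_compat; assumption].
    - apply Rle_div_l; [apply Rmult_lt_0_compat; assumption|].
      eapply Rle_trans; [exact Hu|].
      replace (C * (2 ^ (i + j) * N ^ (i + j)) * (INR (fact i) * INR (fact j))) with
        (C * N ^ (i + j) * (2 ^ (i + j) * INR (fact i) * INR (fact j))) by ring.
      apply Rmult_le_compat_l; [nonneg|assumption]. }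
  split.
  - apply (@ex_series_le R_AbsRing R_CompleteNormedModule _ (fun n => (/ 2) ^ n * C)).
    + intros n; unfold norm; simpl; unfold abs; simpl; unfold psum2.
      eapply Rle_trans; [apply (Rabs_sum_le_const _ (C * (/ 4) ^ n))|].
      * intros i Hi; rewrite !Rabs_mult, <- !RPow_abs, !Rabs_Rabsolu.
        eapply Rle_trans; [apply Hterm|]; replace (i + (n - i))%nat with n by lia.
        apply Rmult_le_compat_l; [exact HC|apply Hq].
      * replace ((/ 2) ^ n * C) with (2 ^ n * (C * (/ 4) ^ n)).
        -- apply Rmult_le_compat_r; [|apply INR_S_le_pow2].
           apply Rmult_le_pos; [exact HC|apply pow_le; lra].
        -- replace (/ 2) with (2 * / 4) by field; rewrite Rpow_mult_distr; ring.
    + apply ex_series_scal_r, ex_series_geom; rewrite Rabs_pos_eq; lra.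
  - symmetry; apply is_series_unique, is_series_Reals.
    assert (Hxx : forall z, Rabs (z - x0) < d -> in_box d x0 t0 z t).
    { intros z Hz; split; [exact Hz|].
      replace (t - t0) with (Y + (t1 - t0)) by (unfold Y; ring).
      pose proof (Rabs_triang Y (t1 - t0)); lra. }
    assert (Htt : forall z, Rabs (z - t0) < d -> in_box d x0 t0 x1 z) by (intros z Hz; split; lra).
    assert (Hx0 : Rabs (x - x0) < d).
    { replace (x - x0) with (X + (x1 - x0)) by (unfold X; ring).
      pose proof (Rabs_triang X (x1 - x0)); lra. }
    assert (Ht0 : Rabs (t - t0) < d).
    { replace (t - t0) with (Y + (t1 - t0)) by (unfold Y; ring).
      pose proof (Rabs_triang Y (t1 - t0)); lra. }
    assert (Hrem : forall n, Rabs (u x t - sum_f_R0 (psum2 a X Y) n) <= C * (/ 2) ^ S n).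
    { intros n; rewrite sum_psum2.
      set (p := fun i => pderiv (repeat true i) u).
      assert (T1 := taylor_ball (fun i z => p i z t) (C * N ^ S n * INR (fact (S n))) x0 d x1 X n).
      cbv beta in T1.
      assert (T1' : Rabs (u x t - sum_f_R0 (fun i => p i x1 t * X ^ i / INR (fact i)) n)
         <= C * (2 * N * de) ^ S n).
      { replace (x1 + X) with x in T1 by (unfold X; ring).
        eapply Rle_trans; [apply T1|].
        - intros k z Hz; apply (psmooth_is_derive d x0 t0 u (repeat true k) z t Su (Hxx z Hz)).
        - intros z Hz; pose proof (Hu (repeat true (S n)) z t (Hxx z Hz)) as Hz'.
          rewrite repeat_length in Hz'; exact Hz'.
        - lra.
        - exact Hx0.
        - pose proof (INR_fact_neq_0 (S n)).
          replace (C * N ^ S n * INR (fact (S n)) * Rabs X ^ S n / INR (fact (S n))) with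
            (C * (N ^ S n * Rabs X ^ S n)) by (field; assumption).
          apply Rmult_le_compat_l; [exact HC|]; rewrite <- Rpow_mult_distr.
          apply pow_incr; pose proof (Rabs_pos X); split; [nonneg|nra]. }
      (* The coefficient of [X^i] is expanded to order [n - i], so every remainder has total order
         [n + 1]. There are [n + 1] of them and one from the expansion in [x]. *)
      assert (T2 : forall i, (i <= n)%nat ->
         Rabs (p i x1 t * X ^ i / INR (fact i) - sum_f_R0 (fun j => a i j * X ^ i * Y ^ j) (n - i))
         <= C * (2 * N * de) ^ S n).
      { intros i Hi.
        assert (T := taylor_ball (fun j z => pderiv (w i j) u x1 z)
          (C * N ^ S n * INR (fact (S n))) t0 d t1 Y (n - i)).
        cbv beta in T; replace (t1 + Y) with t in T by (unfold Y; ring).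
        assert (T' : Rabs (p i x1 t - sum_f_R0 (fun j => pderiv (w i j) u x1 t1 * Y ^ j / INR (fact j)) (n - i))
          <= C * N ^ S n * INR (fact (S n)) * Rabs Y ^ S (n - i) / INR (fact (S (n - i)))).
        { apply T.
          - intros k z Hz; apply (psmooth_is_derive d x0 t0 u (w i k) x1 z Su (Htt z Hz)).
          - intros z Hz; pose proof (Hu (w i (S (n - i))) x1 z (Htt z Hz)) as Hz'.
            rewrite Hlen in Hz'; replace (i + S (n - i))%nat with (S n) in Hz' by lia; exact Hz'.
          - lra.
          - exact Ht0. }
        replace (p i x1 t * X ^ i / INR (fact i) - sum_f_R0 (fun j => a i j * X ^ i * Y ^ j) (n - i))
          with ((p i x1 t - sum_f_R0 (fun j => pderiv (w i j) u x1 t1 * Y ^ j / INR (fact j)) (n - i))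
             * (X ^ i / INR (fact i))).
        2:{ rewrite Rmult_minus_distr_r; f_equal; [unfold Rdiv; ring|].
            f_equal; rewrite Rmult_comm, scal_sum; apply sum_eq; intros j Hj; unfold a; field.
            split; apply INR_fact_neq_0. }
        rewrite Rabs_mult.
        apply (Rmult_le_compat_r (Rabs (X ^ i / INR (fact i)))) in T'; [|apply Rabs_pos].
        eapply Rle_trans; [exact T'|].
        unfold Rdiv; rewrite Rabs_mult, (Rabs_pos_eq (/ INR (fact i))) by (left; apply Hfi).
        rewrite <- RPow_abs.
        pose proof (fact_add_le i (S (n - i))) as HFa.
        specialize (HXY i (S (n - i))).
        replace (i + S (n - i))%nat with (S n) in * by lia.
        pose proof (Hfi i); pose proof (Hfi (S (n - i))).
        set (A := INR (fact i)) in *; set (B := INR (fact (S (n - i)))) in *.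
        assert (HA : 0 < A) by apply INR_fact_lt_0; assert (HB : 0 < B) by apply INR_fact_lt_0.
        assert (HFab : INR (fact (S n)) * (/ A * / B) <= 2 ^ S n).
        { apply (Rmult_le_compat_r (/ A * / B)) in HFa; [|nonneg].
          replace (2 ^ S n * A * B * (/ A * / B)) with (2 ^ S n) in HFa by (field; lra); exact HFa. }
        replace (C * N ^ S n * INR (fact (S n)) * Rabs Y ^ S (n - i) * / B * (Rabs X ^ i * / A)) with
          (C * N ^ S n * ((INR (fact (S n)) * (/ A * / B)) * (Rabs X ^ i * Rabs Y ^ S (n - i)))) by ring.
        rewrite !Rpow_mult_distr.
        replace (C * (2 ^ S n * N ^ S n * de ^ S n)) with (C * N ^ S n * (2 ^ S n * de ^ S n)) by ring.
        assert (0 < N ^ S n) by (apply pow_lt; exact HN).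
        apply Rmult_le_compat_l; [nonneg|].
        apply Rmult_le_compat; [|apply Rmult_le_pos; apply pow_le, Rabs_pos|exact HFab|exact HXY].
        apply Rmult_le_pos; [apply pos_INR|nonneg]. }
      replace (u x t - sum_f_R0 (fun i => sum_f_R0 (fun j => a i j * X ^ i * Y ^ j) (n - i)) n) with
        ((u x t - sum_f_R0 (fun i => p i x1 t * X ^ i / INR (fact i)) n) +
         sum_f_R0 (fun i => p i x1 t * X ^ i / INR (fact i)
            - sum_f_R0 (fun j => a i j * X ^ i * Y ^ j) (n - i)) n)
        by (rewrite minus_sum; ring).
      eapply Rle_trans; [apply Rabs_triang|].
      pose proof (Rabs_sum_le_const _ _ n T2) as T3.
      apply Rle_trans with (INR (S (S n)) * (C * (2 * N * de) ^ S n)); [rewrite (S_INR (S n)); lra|].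
      replace (C * (/ 2) ^ S n) with (2 ^ S n * (C * (/ 4) ^ S n)).
      - apply Rmult_le_compat; [apply pos_INR| |apply INR_S_le_pow2|].
        + apply Rmult_le_pos; [exact HC|apply pow_le; repeat apply Rmult_le_pos; lra].
        + apply Rmult_le_compat_l; [exact HC|apply Hq].
      - replace (/ 2) with (2 * / 4) by field; rewrite Rpow_mult_distr; ring. }
    intros eps Heps.
    destruct (pow_lt_1_zero (/ 2) ltac:(rewrite Rabs_pos_eq; lra) (eps / (C + 1))) as [n0 Hn0].
    { apply Rdiv_lt_0_compat; lra. }
    exists n0; intros n Hn; unfold R_dist; rewrite Rabs_minus_sym.
    eapply Rle_lt_trans; [apply Hrem|].
    specialize (Hn0 (S n) ltac:(lia)); rewrite Rabs_pos_eq in Hn0 by (apply pow_le; lra).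
    apply Rlt_div_r in Hn0; [|lra].
    assert (0 <= (/ 2) ^ S n) by (apply pow_le; lra); lra.
Qed.

(* [psi] vanishes at [x0] to so high an order that [psi'^2] and [psi''] are
   controlled by the degenerate coefficient [x^(2r)]. *)
Lemma exhaustion_function (r : nat) (x0 rho : R) :
  0 < rho <= / 2 -> (x0 <> 0 -> rho <= Rabs x0 / 2) ->
  exists (psi psi1 psi2 : R -> R) (C1 T : R),
    0 < T <= rho /\ 0 <= C1 /\ psi x0 = 0 /\
    (forall x, is_derive psi x (psi1 x)) /\ (forall x, is_derive psi1 x (psi2 x)) /\
    (forall x, Rabs (x - x0) <= rho -> 0 <= x ^ r * x ^ r /\
       psi1 x ^ 2 <= C1 * (x ^ r * x ^ r) /\ Rabs (psi2 x) <= C1 * (x ^ r * x ^ r)) /\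
    (forall x, Rabs (x - x0) = rho -> T <= psi x).
Proof.
  intros Hr Hx0.
  destruct (Req_dec x0 0) as [->|Hne].
  (* Centred on the degeneracy, [psi = x^(2r + 2)]: its second derivative is a multiple of
     [x^(2r)]. *)
  - set (n := (r + r)%nat); set (c := INR (S (S n))).
    assert (Hc : 2 <= c) by (unfold c; rewrite !S_INR; pose proof (pos_INR n); lra).
    exists (fun x => x ^ S (S n)), (fun x => c * x ^ S n), (fun x => c * (INR (S n) * x ^ n)),
      (c ^ 2), (rho ^ S (S n)).
    assert (Hn : forall x, x ^ n = x ^ r * x ^ r) by (intros x; unfold n; apply pow_add).
    split; [split|split; [|split; [|split; [|split; [|split]]]]].
    + apply pow_lt; lra.
    + cbn [pow]; assert (rho ^ n <= 1) by (rewrite <- (pow1 n); apply pow_incr; lra).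
      assert (0 <= rho ^ n) by (apply pow_le; lra); nra.
    + apply pow2_ge_0.
    + simpl; ring.
    + intros x; unfold c; replace (INR (S (S n)) * x ^ S n) with (INR (S (S n)) * 1 * x ^ S n) by ring.
      apply (is_derive_pow (fun x => x) (S (S n)) x 1); apply @is_derive_id.
    + intros x; apply (is_derive_scal (fun x => x ^ S n)).
      replace (INR (S n) * x ^ n) with (INR (S n) * 1 * x ^ n) by ring.
      apply (is_derive_pow (fun x => x) (S n) x 1); apply @is_derive_id.
    + intros x H; rewrite Rminus_0_r in H; rewrite <- Hn.
      assert (H0 : 0 <= x ^ n) by (rewrite Hn, <- (Rsqr_def (x ^ r)); apply Rle_0_sqr).
      split; [exact H0|split].
      { replace ((c * x ^ S n) ^ 2) with (c ^ 2 * x ^ n * (x ^ n * (x * x))) by (simpl; ring).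
      rewrite <- (Rmult_1_r (c ^ 2 * x ^ n)) at 2.
      apply Rmult_le_compat_l; [apply Rmult_le_pos; [apply pow2_ge_0|exact H0]|].
      assert (x ^ n <= 1).
      { rewrite <- (Rabs_pos_eq (x ^ n)) by exact H0; rewrite <- RPow_abs, <- (pow1 n).
        apply pow_incr; split; [apply Rabs_pos|lra]. }
      pose proof (Rabs_le_mult_self x rho H).
      assert (rho ^ 2 <= 1) by nra.
      pose proof (Rle_0_sqr x) as Hxx; unfold Rsqr in Hxx.
      rewrite <- (Rmult_1_l 1); apply Rmult_le_compat; lra. }
      pose proof (pos_INR (S n)).
      rewrite Rabs_pos_eq by (apply Rmult_le_pos; [lra|apply Rmult_le_pos; assumption]).
      assert (INR (S n) <= c) by (unfold c; rewrite (S_INR (S n)); lra).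
      replace (c ^ 2 * x ^ n) with (c * (c * x ^ n)) by ring.
      apply Rmult_le_compat_l; [lra|]; apply Rmult_le_compat_r; assumption.
    + intros x Hx; rewrite Rminus_0_r in Hx; rewrite <- Hx, RPow_abs.
      right; apply Rabs_pos_eq; replace (x ^ S (S n)) with ((x ^ S r) ^ 2); [apply pow2_ge_0|].
      rewrite <- pow_mult; f_equal; unfold n; lia.
  (* Away from the degeneracy, [rho <= |x0| / 2] keeps [x^(2r)] above a positive [m], and
     [(x - x0)^2] suffices. *)
  - specialize (Hx0 Hne); assert (Hax : 0 < Rabs x0) by (apply Rabs_pos_lt, Hne).
    set (m := (Rabs x0 / 2) ^ r * (Rabs x0 / 2) ^ r).
    assert (Hp : 0 < (Rabs x0 / 2) ^ r) by (apply pow_lt; lra).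
    assert (Hm : 0 < m) by (unfold m; apply Rmult_lt_0_compat; assumption).
    assert (Hmz : forall x, Rabs (x - x0) <= rho -> m <= x ^ r * x ^ r).
    { intros x Hx; assert (Hxr : Rabs x0 / 2 <= Rabs x).
      { pose proof (Rabs_triang_inv x0 (x0 - x)) as Ht.
        replace (x0 - (x0 - x)) with x in Ht by ring; rewrite (Rabs_minus_sym x0 x) in Ht; lra. }
      rewrite <- (Rabs_pos_eq (x ^ r * x ^ r)), Rabs_mult, <- RPow_abs
        by (rewrite <- (Rsqr_def (x ^ r)); apply Rle_0_sqr).
      assert (Hpx : (Rabs x0 / 2) ^ r <= Rabs x ^ r) by (apply pow_incr; lra).
      unfold m; apply Rmult_le_compat; lra. }
    exists (fun x => (x - x0) ^ 2), (fun x => 2 * (x - x0)), (fun _ => 2), (2 / m), (rho ^ 2).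
    assert (Hz : forall x, Rabs (x - x0) <= rho -> 2 <= 2 / m * (x ^ r * x ^ r)).
    { intros x Hx; specialize (Hmz x Hx).
      replace 2 with (2 / m * m) at 1 by (field; lra).
      apply Rmult_le_compat_l; [apply Rlt_le, Rdiv_lt_0_compat; lra|exact Hmz]. }
    split; [split|split; [|split; [|split; [|split; [|split]]]]].
    + apply pow_lt; lra.
    + nra.
    + apply Rlt_le, Rdiv_lt_0_compat; lra.
    + ring.
    + intros x; auto_derive; trivial; ring.
    + intros x; auto_derive; trivial; ring.
    + intros x H; specialize (Hmz x H); specialize (Hz x H).
      split; [lra|split; [|rewrite Rabs_pos_eq; lra]].
      pose proof (Rabs_le_mult_self (x - x0) rho H); nra.
    + intros x Hx; rewrite <- Hx, <- sqr_Rabs; apply Rle_refl.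
Qed.

(** * Choice of neighbourhoods and assembly *)

Lemma smooth_le (d d' x0 t0 : R) (u : R -> R -> R) :
  d <= d' -> smooth_on_box d' x0 t0 u -> smooth_on_box d x0 t0 u.
Proof. intros Hd H l x t Hb; apply H; apply (in_box_le d d'); assumption. Qed.

Lemma smooth_bounded_pderivs (d d' x0 t0 : R) (u : R -> R -> R) :
  d < d' -> smooth_on_box d' x0 t0 u -> bounded_pderivs d x0 t0 u.
Proof.
  intros Hd Su l.
  destruct (continuity_2d_rect_bounded (pderiv l u) (x0 - d) (x0 + d) (t0 - d) (t0 + d)) as [C HC].
  - intros x t Hx Ht; apply (smooth_continuity_2d d' x0 t0 u l x t Su).
    split; apply Rabs_def1; lra.
  - exists C; intros x t [Hx Ht]; apply Rabs_def2 in Hx, Ht; apply HC; lra.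
Qed.

Lemma bounded_pderivs_affine (d x0 t0 a b c B : R) :
  (forall x t, in_box d x0 t0 x t -> Rabs (a * x + b * t + c) <= B) ->
  bounded_pderivs d x0 t0 (fun x t => a * x + b * t + c).
Proof.
  intros H l; exists (B + Rabs a + Rabs b); intros x t Hb.
  rewrite (proj2 (pderiv_affine d x0 t0 c a b) l x t Hb).
  specialize (H x t Hb); pose proof (Rabs_pos (a * x + b * t + c)).
  pose proof (Rabs_pos a); pose proof (Rabs_pos b).
  destruct l as [|[|] [|b2 l]]; rewrite ?Rabs_R0; lra.
Qed.

Lemma bounded_pderivs_sub_const (d x0 t0 c : R) (u : R -> R -> R) :
  psmooth d x0 t0 u -> bounded_pderivs d x0 t0 u -> bounded_pderivs d x0 t0 (fun x t => u x t - c).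
Proof.
  intros Su H l; destruct (H l) as [C HC]; exists (C + Rabs c); intros x t Hb.
  rewrite (proj2 (pderiv_sub_const d x0 t0 c u Su) l x t Hb).
  specialize (HC x t Hb); pose proof (Rabs_pos c).
  destruct l as [|b l]; [|lra].
  simpl in HC; pose proof (Rabs_triang (u x t) (- c)) as Ht; rewrite Rabs_Ropp in Ht.
  unfold Rminus; lra.
Qed.

(** Regards [f] as a power series in three variables, so that [majorized_compose3] covers it as well
    as [h(x,t,u)]. *)
Lemma psum3_of_psum2 (a : nat -> nat -> R) (y z w : R) (n : nat) :
  psum3 (fun i j k => match k with O => a i j | S _ => 0 end) y z w n = psum2 a y z n.
Proof.
  unfold psum3, psum2; apply sum_eq; intros i Hi.
  destruct (n - i)%nat as [|m]; [simpl; ring|].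
  rewrite tech5, Nat.sub_diag, pow_O, Rmult_1_r.
  rewrite (sum_eq _ (fun _ => 0)).
  - rewrite sum_cte; ring.
  - intros j Hj; replace (S m - j)%nat with (S (m - j)) by lia; ring.
Qed.

(** Since [x^r] does not depend on [t], it leaves both [t]-derivatives, again by the unconditional
    [Derive_scal]. *)
Lemma P_op_expand (r : nat) (h : R -> R -> R -> R) (u : R -> R -> R) (x t : R) :
  P_op r h u u x t = - (dx (dx u) x t + x ^ r * x ^ r *
    (dt (dt u) x t + h x t (u x t) * dt (fun x t => h x t (u x t) * dt u x t) x t)).
Proof.
  unfold P_op, vf_t.
  assert (E1 : dt (fun x t => x ^ r * dt u x t) x t = x ^ r * dt (dt u) x t).
  { unfold dt at 1; apply Derive_scal. }
  assert (E2 : dt (fun x t => x ^ r * h x t (u x t) * dt u x t) x t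
     = x ^ r * dt (fun x t => h x t (u x t) * dt u x t) x t).
  { unfold dt at 1; rewrite (Derive_ext _ (fun s => x ^ r * (h x s (u x s) * dt u x s)))
      by (intros; ring).
    apply Derive_scal. }
  rewrite E1, E2; ring.
Qed.

Theorem mainTheorem1 (r : nat) (hr : (0 < r)%nat)
  (h : R -> R -> R -> R) (u f : R -> R -> R) (x0 t0 d : R) :
  (forall x t w, analytic_at3 h x t w) ->
  0 < d ->
  analytic_on_box d x0 t0 f ->
  smooth_on_box d x0 t0 u ->
  (forall x t, in_box d x0 t0 x t -> P_op r h u u x t = f x t) ->
  exists d', 0 < d' /\ analytic_on_box d' x0 t0 u.
Proof.
  intros Hh Hd Hf Su Heq.
  assert (Hb0 : in_box d x0 t0 x0 t0) by (split; rewrite Rminus_diag, Rabs_R0; exact Hd).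
  set (w0 := u x0 t0).
  destruct (Hh x0 t0 w0) as [a3 [dh [Hdh Ah]]].
  destruct (Hf x0 t0 Hb0) as [a2 [df [Hdf Af]]].
  (* [G] lies strictly inside both radii, so both series converge absolutely at radius [G]. *)
  set (G := Rmin dh df / 2).
  assert (HGm : 0 < Rmin dh df) by (apply Rmin_glb_lt; assumption).
  assert (HG : 0 < G) by (unfold G; lra).
  assert (HGh : G < dh) by (pose proof (Rmin_l dh df); unfold G; lra).
  assert (HGf : G < df) by (pose proof (Rmin_r dh df); unfold G; lra).
  assert (HG8 : 0 < G / 8) by lra.
  destruct (smooth_continuity_2d d x0 t0 u nil x0 t0 Su Hb0 (mkposreal _ HG8)) as [e He].
  simpl in He; fold w0 in He.
  (* [d / 2] puts a closed rectangle inside the box, hence all derivatives are bounded; [e] and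
     [G / 8] keep [u - w0], [x - x0] and [t - t0] below [G * wt 0]. *)
  set (d0 := Rmin (Rmin (d / 2) e) (G / 8)).
  assert (Hd0 : 0 < d0).
  { repeat apply Rmin_glb_lt; try lra; apply cond_pos. }
  assert (Hd0d : d0 <= d / 2) by (eapply Rle_trans; [apply Rmin_l|apply Rmin_l]).
  assert (Hd0e : d0 <= e) by (eapply Rle_trans; [apply Rmin_l|apply Rmin_r]).
  assert (Hd0G : d0 <= G / 8) by apply Rmin_r.
  assert (Su0 : smooth_on_box d0 x0 t0 u) by (apply (smooth_le d0 d); [lra|exact Su]).
  assert (Pu0 := smooth_psmooth _ _ _ _ Su0).
  set (X := fun x t : R => 1 * x + 0 * t + - x0).
  set (Y := fun x t : R => 0 * x + 1 * t + - t0).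
  set (W := fun x t : R => u x t - w0).
  assert (HXv : forall x t, in_box d0 x0 t0 x t -> Rabs (X x t) <= G / 8).
  { intros x t [Hx _]; unfold X; replace (1 * x + 0 * t + - x0) with (x - x0) by ring; lra. }
  assert (HYv : forall x t, in_box d0 x0 t0 x t -> Rabs (Y x t) <= G / 8).
  { intros x t [_ Ht]; unfold Y; replace (0 * x + 1 * t + - t0) with (t - t0) by ring; lra. }
  assert (HWv : forall x t, in_box d0 x0 t0 x t -> Rabs (W x t) <= G / 8).
  { intros x t [Hx Ht]; left; apply He; lra. }
  assert (HZv : forall x t, in_box d0 x0 t0 x t -> Rabs ((fun _ _ : R => 0) x t) <= G / 8).
  { intros x t _; rewrite Rabs_R0; lra. }
  assert (SX : psmooth d0 x0 t0 X) by apply pderiv_affine.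
  assert (SY : psmooth d0 x0 t0 Y) by apply pderiv_affine.
  assert (SW : psmooth d0 x0 t0 W) by (apply pderiv_sub_const; exact Pu0).
  assert (SZ : psmooth d0 x0 t0 (fun _ _ => 0)) by apply pderiv_const.
  assert (BX : bounded_pderivs d0 x0 t0 X) by (apply (bounded_pderivs_affine d0 x0 t0 1 0 (- x0) _ HXv)).
  assert (BY : bounded_pderivs d0 x0 t0 Y) by (apply (bounded_pderivs_affine d0 x0 t0 0 1 (- t0) _ HYv)).
  assert (BW : bounded_pderivs d0 x0 t0 W).
  { apply bounded_pderivs_sub_const; [exact Pu0|]; apply (smooth_bounded_pderivs d0 d); [lra|exact Su]. }
  assert (BZ : bounded_pderivs d0 x0 t0 (fun _ _ => 0)).
  { intros l; exists 0; intros x t Hb; rewrite (proj2 (pderiv_const d0 x0 t0 0) l x t Hb).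
    destruct l; rewrite Rabs_R0; lra. }
  set (H := fun x t => h x t (u x t)).
  assert (Habs : forall c g, Rabs (c + G - c) = G /\ (G < g -> Rabs (c + G - c) < g)).
  { intros c g; replace (c + G - c) with G by ring; rewrite Rabs_pos_eq; lra. }
  destruct (majorized_compose3 d0 x0 t0 G a3 X Y W H HG) as [SH [CH [HCH NH]]]; try assumption.
  (* Evaluation at the corner gives absolute convergence with all three increments equal to [G]. *)
  { destruct (Ah (x0 + G) (t0 + G) (w0 + G)) as [Es _]; try (apply Habs; exact HGh).
    rewrite !(proj1 (Habs _ 0)) in Es; exact Es. }
  { intros x t Hb; specialize (HXv x t Hb); specialize (HYv x t Hb); specialize (HWv x t Hb).
    unfold X, Y, W in *.
    replace (1 * x + 0 * t + - x0) with (x - x0) in * by ring.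
    replace (0 * x + 1 * t + - t0) with (t - t0) in * by ring.
    apply Ah; lra. }
  destruct (majorized_compose3 d0 x0 t0 G (fun i j k => match k with O => a2 i j | S _ => 0 end)
    X Y (fun _ _ => 0) f HG) as [Sf [CF [HCF NF]]]; try assumption.
  { destruct (Af (x0 + G) (t0 + G)) as [Es _]; try (apply Habs; exact HGf).
    rewrite !(proj1 (Habs _ 0)) in Es; revert Es; apply ex_series_ext; intros n.
    rewrite <- (psum3_of_psum2 _ G G G); unfold psum3; apply sum_eq; intros i _.
    apply sum_eq; intros j _; destruct (n - i - j)%nat; rewrite ?Rabs_R0; reflexivity. }
  { intros x t Hb; specialize (HXv x t Hb); specialize (HYv x t Hb).
    unfold X, Y in *.
    replace (1 * x + 0 * t + - x0) with (x - x0) in * by ring.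
    replace (0 * x + 1 * t + - t0) with (t - t0) in * by ring.
    destruct (Af x t ltac:(lra) ltac:(lra)) as [_ ->].
    apply Series_ext; intros n; symmetry; apply psum3_of_psum2. }
  assert (NX : forall al mu J I x t, in_box d0 x0 t0 x t -> 1 <= al -> (forall n, 0 <= mu n) ->
     1 <= mu 0%nat -> 32 / G <= mu 1%nat ->
     majorized al mu J I 0 G X x t /\ majorized al mu J I 0 G Y x t /\ majorized al mu J I 0 G (fun _ _ => 0) x t).
  { intros al mu J I x t Hb Hal Hmu Hmu0 Hmu1; split; [|split].
    - apply (majorized_affine d0 x0 t0); try assumption;
        [rewrite Rabs_R1; lra|rewrite Rabs_R0; lra|apply HXv, Hb].
    - apply (majorized_affine d0 x0 t0); try assumption;
        [rewrite Rabs_R0; lra|rewrite Rabs_R1; lra|apply HYv, Hb].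
    - apply (majorized_ext d0 x0 t0 al mu x t Hb J I 0 G (fun x t => 0 * x + 0 * t + 0)); [intros; ring|].
      apply (majorized_affine d0 x0 t0); try assumption; try (rewrite Rabs_R0; lra).
      replace (0 * x + 0 * t + 0) with 0 by ring; rewrite Rabs_R0; lra. }
  assert (NH' : forall al mu K J I x t, in_box d0 x0 t0 x t -> 1 <= al -> (forall n, 0 <= mu n) ->
    1 <= mu 0%nat -> 32 / G <= mu 1%nat ->
    (forall i j, (i + j <= K)%nat -> mu i * mu j <= mu (i + j)%nat) -> (J <= K)%nat ->
    majorized al mu J I 0 G W x t -> majorized al mu J I 0 CH H x t).
  { intros al mu K J I x t Hb Hal Hmu Hmu0 Hmu1 Hsub HJ NW.
    destruct (NX al mu J I x t Hb Hal Hmu Hmu0 Hmu1) as [N1 [N2 _]].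
    apply (NH al mu K); assumption. }
  assert (NF' : forall al mu K J I x t, in_box d0 x0 t0 x t -> 1 <= al -> (forall n, 0 <= mu n) ->
    1 <= mu 0%nat -> 32 / G <= mu 1%nat ->
    (forall i j, (i + j <= K)%nat -> mu i * mu j <= mu (i + j)%nat) -> (J <= K)%nat ->
    majorized al mu J I 0 CF f x t).
  { intros al mu K J I x t Hb Hal Hmu Hmu0 Hmu1 Hsub HJ.
    destruct (NX al mu J I x t Hb Hal Hmu Hmu0 Hmu1) as [N1 [N2 N3]].
    apply (NF al mu K); assumption. }
  assert (Heqn : forall x t, in_box d0 x0 t0 x t ->
    dx (dx u) x t = - f x t
      - x ^ r * x ^ r * (dt (dt u) x t + H x t * dt (fun x t => H x t * dt u x t) x t)).
  { intros x t Hb; rewrite <- (Heq x t) by (apply (in_box_le d0 d); [lra|exact Hb]).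
    rewrite P_op_expand; unfold H; ring. }
  (* Orders up to [3] need boundedness only: they are the base of the induction, where the exponent
     [k - 3] vanishes. *)
  destruct (bounded_pderivs_majorized d0 x0 t0 G W 3 HG BW HWv) as [B0 [HB0 NB]].
  set (B := Rmax B0 (32 / G)).
  assert (HB0B : B0 <= B) by apply Rmax_l.
  assert (HGB : 32 / G <= B) by apply Rmax_r.
  assert (Hbase : forall j x t, (j <= 3)%nat -> in_box d0 x0 t0 x t ->
     Rabs (pderiv (repeat false j) W x t) <= G * B ^ j * wt j).
  { intros j x t Hj Hb; assert (N := NB B 1 HB0B (Rle_refl 1) x t Hb (repeat false j)).
    rewrite repeat_length, nx_repeat_false, Nat.add_0_r, pow_O, Rmult_1_r in N.
    rewrite Rmult_assoc; apply N; lia. }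
  (* For [x0 <> 0] the interval must stay away from [0]; for [x0 = 0] the default value [1] imposes
     nothing. *)
  set (rho := Rmin (Rmin (d0 / 2) (/ 2)) (if Req_EM_T x0 0 then 1 else Rabs x0 / 2)).
  assert (Hrho0 : 0 < rho).
  { repeat apply Rmin_glb_lt; try lra.
    destruct (Req_EM_T x0 0) as [|Hne]; [lra|pose proof (Rabs_pos_lt x0 Hne); lra]. }
  assert (Hrho1 : rho <= d0 / 2) by (eapply Rle_trans; [apply Rmin_l|apply Rmin_l]).
  assert (Hrho2 : rho <= / 2) by (eapply Rle_trans; [apply Rmin_l|apply Rmin_r]).
  assert (Hrho3 : x0 <> 0 -> rho <= Rabs x0 / 2).
  { intros Hne; eapply Rle_trans; [apply Rmin_r|]; destruct (Req_EM_T x0 0); [contradiction|lra]. }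
  destruct (exhaustion_function r x0 rho (conj Hrho0 Hrho2) Hrho3) as
    [psi [psi1 [psi2 [C1 [T [HT [HC1 [Hpsi0 [D1 [D2 [Hpsi Hpsib]]]]]]]]]]].
  destruct (D_geometric_bound r d0 x0 t0 w0 G CH CF u H f Su0 SH Sf HG HCH HCF HWv NH' NF' Heqn
    rho T C1 B psi psi1 psi2 ltac:(lra) Hrho2 HT HC1 D1 D2 Hpsi Hpsib ltac:(lra) HGB Hbase)
    as [N0 [HN1 [HNG HN]]].
  (* As [psi x0 = 0], a neighbourhood of [x0] lies in the sublevel set on which the [t]-derivatives
     are controlled. *)
  assert (Hpsic : locally x0 (fun x => 0 < T / 2 - psi x)).
  { apply (locally_pos (fun x => T / 2 - psi x)); [|lra].
    auto_derive; eexists; apply D1. }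
  destruct (locally_ball_R _ _ Hpsic) as [e1 [He1 Hpsie]].
  set (d1 := Rmin (Rmin e1 rho) (T / 2)).
  assert (Hd1 : 0 < d1) by (apply Rmin_glb_lt; [apply Rmin_glb_lt; assumption|lra]).
  assert (Hd1e : d1 <= e1) by (eapply Rle_trans; [apply Rmin_l|apply Rmin_l]).
  assert (Hd1r : d1 <= rho) by (eapply Rle_trans; [apply Rmin_l|apply Rmin_r]).
  assert (Hd1T : d1 <= T / 2) by apply Rmin_r.
  destruct (u_factorial_bound r d0 x0 t0 w0 G CH CF u H f Su0 SH Sf HG HCH HCF HWv NH' NF' Heqn
    d1 N0 ltac:(lra) HN1 HNG) as [C [Nf [HC [HNf HU]]]].
  { intros k x t [Hx Ht]; apply HN; [lra|lra|].
    specialize (Hpsie x ltac:(lra)); lra. }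
  (* One halving is lost in the interpolation of the first [x]-derivative, the other in the passage
     to power series. *)
  exists (d1 / 2 / 2); split; [lra|].
  apply (factorial_bound_analytic (d1 / 2) x0 t0 C Nf u); try assumption; [lra|].
  apply (psmooth_le _ d0); [lra|exact Pu0].
Qed.
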